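(* Let $L>0$, $I=(-L,L)$, $\nu,\mu,\gamma>0$, $p\ge1$, $q_0>0$, and let $\zeta\in L^\infty(I)$ be complex-valued with $\zeta'\in L^2(I)$, $\lim_{x\to\pm L}\zeta(x)=\zeta_\pm\in\mathbb C$, $|\zeta_\pm|=q_0$, $\lim_{x\to\pm L}\zeta'(x)=0$. Consider on $I$ the modified NLS equations $$i\phi_t+\nu(\phi+\zeta)_{xx}+\mu\left(|\phi+\zeta|^2-q_0^2\right)(\phi+\zeta)=0,$$ $$i\Phi_t+\nu(\Phi+\zeta)_{xx}+\gamma\big(|\Phi+\zeta|^{2p}-q_0^{2p}\big)(\Phi+\zeta)=0,$$ with initial data $\phi(\cdot,0)=\phi_0$, $\Phi(\cdot,0)=\Phi_0$ in $H^1(I)$ and boundary conditions $\lim_{x\to\pm L}\phi(x,t)=\lim_{x\to\pm L}\Phi(x,t)=0$, $t\ge0$. Given $0<\varepsilon<1$, suppose that $$\|\phi_0\|_{H^1(I)}\le c_0\varepsilon,\quad\|\Phi_0\|_{H^1(I)}\le C_0\varepsilon,\quad q_0\le B\varepsilon,\quad\|\zeta\|_{L^\infty(I)}\le B_0\varepsilon,\quad\|\zeta'\|_{L^2(I)}\le B_1\varepsilon,\quad\||\zeta|-q_0\|_{L^2(I)}\le B_2\varepsilon$$ for some positive constants $c_0,C_0,B,B_0,B_1,B_2$. If $L=\mathcal O\left(\frac1\varepsilon\right)$, then, for arbitrary $0<T_f<\infty$: (i) if $\|\phi_0-\Phi_0\|_{L^2(I)}\le C\varepsilon^3$ for some constant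 $C>0$, then there is a constant $\widetilde C=\widetilde C(\mu,\gamma,c_0,C_0,C,B,B_0,B_1,B_2,T_f)$ such that $$\sup_{t\in[0,T_f]}\|\phi(t)-\Phi(t)\|_{L^2(I)}\equiv\sup_{t\in[0,T_f]}\big\|e^{-i\mu q_0^2t}u(t)-e^{-i\gamma q_0^{2p}t}U(t)\big\|_{L^2(I)}\le\widetilde C\varepsilon^3;$$ (ii) if (in place of the $L^2$ condition on the difference) $\|\phi_0-\Phi_0\|_{H^1(I)}\le C_1\varepsilon^3$ for some constant $C_1>0$, then there is a constant $\widetilde C_1$, depending on $C_1$ and with a similar dependency on $T_f$ and $\mu,\gamma,c_0,C_0,B_0,B_1,B_2$ as $\widetilde C$, such that $$\sup_{t\in[0,T_f]}\|\phi(t)-\Phi(t)\|_{H^1(I)}\equiv\sup_{t\in[0,T_f]}\big\|e^{-i\mu q_0^2t}u(t)-e^{-i\gamma q_0^{2p}t}U(t)\big\|_{H^1(I)}\le\widetilde C_1\varepsilon^3,$$ and consequently there is a constant $\widetilde C_2$ with similar dependencies as $\widetilde C_1$ such that $$\sup_{t\in[0,T_f]}\|\phi(t)-\Phi(t)\|_{L^\infty(I)}\equiv\sup_{t\in[0,T_f]}\big\|e^{-i\mu q_0^2t}u(t)-e^{-i\gamma q_0^{2p}t}U(t)\big\|_{L^\infty(I)}\le\widetilde C_2\varepsilon^3.$$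
   Context: Here $\phi$ and $\Phi$ are the solutions of the two initial-boundary value problems. The functions $u=e^{i\mu q_0^2t}(\phi+\zeta)$ and $U=e^{i\gamma q_0^{2p}t}(\Phi+\zeta)$ solve $iu_t+\nu u_{xx}+\mu|u|^2u=0$ and $iU_t+\nu U_{xx}+\gamma|U|^{2p}U=0$ on $I$ with the nonzero boundary conditions $u\to e^{i\mu q_0^2t}\zeta_\pm$, $U\to e^{i\gamma q_0^{2p}t}\zeta_\pm$ as $x\to\pm L$, so that $\phi-\Phi=e^{-i\mu q_0^2t}u-e^{-i\gamma q_0^{2p}t}U$.
   Formalization: The estimates are proved for 0<ε<ε₀, with ε₀ in terms of ν,μ,γ,p,c₀,C₀,B₀,B₁,B₂,T_f and the constant in L=O(1/ε); uniformly over all 0<ε<1 the H¹ claim fails for p≥2 (near-blow-up solutions). The constants may also depend on ν, p and the O-constant. *)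

(* Defs.v *)
(* MathComp-Analysis, over an arbitrary [R : realType]; complex numbers are
   [R[i]] from mathcomp-real-closed, with real-valued modulus [normc]. *)
From HB Require Import structures.
From mathcomp Require Import all_boot all_order all_algebra.
From mathcomp Require Import all_classical all_reals all_analysis.
From mathcomp Require Import complex.

Set Implicit Arguments.
Unset Strict Implicit.
Unset Printing Implicit Defensive.

Import Order.TTheory GRing.Theory Num.Theory.
Import numFieldNormedType.Exports.

Local Open Scope classical_set_scope.
Local Open Scope ring_scope.
Local Open Scope complex_scope.

Notation normc := ComplexField.Normc.normc.

Section function_spaces.
Context {R : realType}.
Implicit Types (L x : R) (f g : R -> R[i]) (psi : R -> R).

Definition oitv L : set R := `]- L, L[.

Definition cis (theta : R) : R[i] := cos theta +i* sin theta.

Definition cintegral L f : R[i] :=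
  Rintegral lebesgue_measure (oitv L) (fun x => complex.Re (f x)) +i*
  Rintegral lebesgue_measure (oitv L) (fun x => complex.Im (f x)).

(* R[i] carries no topology here, hence limits go through the modulus. *)
Definition tends_right_end L f (l : R[i]) : Prop :=
  normc (f x - l) @[x --> L^'-] --> (0 : R).

Definition tends_left_end L f (l : R[i]) : Prop :=
  normc (f x - l) @[x --> (- L)^'+] --> (0 : R).

(* Extension by 0 outside I turns norms over I into norms over the line. *)
Definition Lpnorm (p : \bar R) L f : \bar R :=
  Lnorm lebesgue_measure p ((fun x => (normc (f x))%:E) \_ (oitv L)).

Definition L2norm := Lpnorm 2%:E.
Definition Linfnorm := Lpnorm +oo%E.

Definition clocally_integrable L f : Prop :=
  locally_integrable (oitv L) (fun x => complex.Re (f x)) /\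
  locally_integrable (oitv L) (fun x => complex.Im (f x)).

(* C_c^oo(I), with real values *)
Definition test_function L psi : Prop :=
  (forall n x, derivable (derive1n n psi) x 1) /\
  exists a b : R, [/\ - L < a, b < L &
    forall x, ~ (a <= x <= b) -> psi x = 0].

Definition weak_deriv L f g : Prop :=
  [/\ clocally_integrable L f, clocally_integrable L g &
    forall psi, test_function L psi ->
      cintegral L (fun x => f x * (derive1 psi x)%:C) =
      - cintegral L (fun x => g x * (psi x)%:C)].

(* Two weak derivatives of [f] agree a.e. on I, so the infimum is over at most
   one value; it is +oo when [f] has no weak derivative. *)
Definition H1norm L f : \bar R :=
  ereal_inf [set ((L2norm L f `^ 2 + L2norm L g `^ 2) `^ 2^-1)%E
            | g in weak_deriv L f].

Definition memH1 L f : Prop := clocally_integrable L f /\ (H1norm L f < +oo)%E.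

End function_spaces.

Section equations.
Context {R : realType}.
Implicit Types (L q T nu t : R) (F : R -> R).

(* [dzeta] is the weak derivative of [zeta] *)
Record background L (q0 : R) (zeta dzeta : R -> R[i]) (zeta_m zeta_p : R[i]) : Prop :=
  Background {
    background_deriv : weak_deriv L zeta dzeta;
    background_Linf : (Linfnorm L zeta < +oo)%E;
    background_dL2 : (L2norm L dzeta < +oo)%E;
    background_right : tends_right_end L zeta zeta_p;
    background_left : tends_left_end L zeta zeta_m;
    background_normp : normc zeta_p = q0;
    background_normm : normc zeta_m = q0;
    background_dright : tends_right_end L dzeta 0;
    background_dleft : tends_left_end L dzeta 0 }.

Definition is_cderive (f : R -> R[i]) t (v : R[i]) : Prop :=
  is_derive t 1 (fun s => complex.Re (f s)) (complex.Re v) /\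
  is_derive t 1 (fun s => complex.Im (f s)) (complex.Im v).

(* Solutions phi in C([0,T]; H^1(I)) of
     i phi_t + nu (phi + zeta)_xx + F(|phi + zeta|) (phi + zeta) = 0  on I,
   phi(0) = phi0, with zero limits at both ends of I; [phi t] is the profile at
   time [t].  The equation holds in the sense of distributions on I: since the
   pairings of phi, zeta and the nonlinear term with a test function are
   continuous in time, being a distribution solution on ]0,T[ x I amounts to
   t |-> <phi(t), psi> being differentiable and satisfying the tested equation
   at every t in ]0,T[. *)
Record ibvp_solution L T nu F (zeta phi0 : R -> R[i]) (phi : R -> R -> R[i])
    : Prop := IbvpSolution {
  solution_H1 : forall t, 0 <= t <= T -> memH1 L (phi t);
  solution_continuous : forall t, 0 <= t <= T ->
    H1norm L (fun x => phi s x - phi t x)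
      @[s --> within `[0, T] (nbhs t)] --> 0%E;
  solution_init : forall x, oitv L x -> phi 0 x = phi0 x;
  solution_right : forall t, 0 <= t <= T -> tends_right_end L (phi t) 0;
  solution_left : forall t, 0 <= t <= T -> tends_left_end L (phi t) 0;
  solution_eq : forall psi, test_function L psi -> forall t, 0 < t < T ->
    exists2 v : R[i],
      is_cderive (fun s => cintegral L (fun x => phi s x * (psi x)%:C)) t v &
      (0 +i* 1) * v
      + nu%:C * cintegral L (fun x => (phi t x + zeta x) * (derive1n 2 psi x)%:C)
      + cintegral L (fun x => (F (normc (phi t x + zeta x)))%:C
                               * (phi t x + zeta x) * (psi x)%:C) = 0 }.

Definition cubic_factor (mu q0 r : R) : R := mu * (r ^+ 2 - q0 ^+ 2).

Definition power_factor (gamma p q0 r : R) : R :=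
  gamma * (r `^ (2 * p) - q0 `^ (2 * p)).

Record size_bounds (c0 C0 B B0 B1 B2 eps L q0 : R)
    (zeta dzeta phi0 Phi0 : R -> R[i]) : Prop := SizeBounds {
  size_phi0 : (H1norm L phi0 <= (c0 * eps)%:E)%E;
  size_Phi0 : (H1norm L Phi0 <= (C0 * eps)%:E)%E;
  size_q0 : q0 <= B * eps;
  size_zeta : (Linfnorm L zeta <= (B0 * eps)%:E)%E;
  size_dzeta : (L2norm L dzeta <= (B1 * eps)%:E)%E;
  size_modulus : (L2norm L (fun x => (normc (zeta x) - q0)%:C)
                  <= (B2 * eps)%:E)%E }.

Definition sup_time T (N : (R -> R[i]) -> \bar R) (f : R -> R -> R[i])
    : \bar R :=
  ereal_sup [set N (f t) | t in `[0, T]].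

End equations.

(* Main.v *)
Require Import Defs.
From HB Require Import structures.
From mathcomp Require Import all_boot all_order all_algebra.
From mathcomp Require Import all_classical all_reals all_analysis.
From mathcomp Require Import complex.
From mathcomp Require Import measurable_realfun ess_sup_inf ring lra.
Import Order.TTheory GRing.Theory Num.Theory.
Import numFieldNormedType.Exports.
Local Open Scope classical_set_scope.
Local Open Scope ring_scope.
Local Open Scope complex_scope.

(* Both solutions stay of size O(eps) in H^1 on [0, Tf].  A nonlinear term
   F(|f|) f with F(q0) = 0, where F is O(eps)-Lipschitz on [0, O(eps)], is then
   O(eps^3), because f is O(eps) and |f| - q0 is O(eps) in L^2.  The difference
   of the two solutions solves a linear Schroedinger equation whose source is
   O(eps^3), hence moves by O(eps^3) over a bounded time, in L^2 and in H^1.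

   For H^1 distribution solutions these energy estimates are carried out on
   Fourier coefficients.  Let a_k be the sine coefficients of phi, and
   d_k = kappa_k a_k + z_k the cosine coefficients of (phi + zeta)_x, with
   kappa_k = k pi / 2L.  Testing the equation against the sines bounds the
   growth of the partial sums of |a_k|^2 and |d_k|^2, the background entering
   only through the coefficients z_k of zeta_x, and Parseval's identity returns
   to the norms.  The source is only as regular as a Lipschitz function of phi:
   its H^1 bound comes from Abel summation against the sines instead of the
   chain rule. *)

Set Implicit Arguments.
Unset Strict Implicit.
Unset Printing Implicit Defensive.

(** * Square-integrable functions on an interval *)

(** The free flow rotates each pair of real and imaginary coefficients of (phi + zeta)_x, so their
    sum of squares moves only through the source. The coefficients of phi itself are coupled to
    zeta_x, and their growth can be bounded only once the first sum is under control; in the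
    difference of two solutions the background cancels. The size O(eps) on [0, Tf] comes from a
    continuity argument: under the assumption of size M eps the source contributes O(eps^3) over a
    bounded time, which for small eps is less than the margin built into M. The two sources are then
    bounded separately, without a Gronwall factor. The final constants are free of L: the Sobolev
    bound works on intervals of length 1, and the L^2 bound of the source uses |phi + zeta| - q0
    instead of the length of I. Completeness of the cosines rests on the explicit expansion of t (pi
    - t) / 2. The sines are not compactly supported in I: they are truncated near the ends, where
    they vanish to first order, and the tested equation passes to the limit. *)

Lemma discriminant_le {R : realFieldType} (A b C : R) : 0 <= A -> 0 <= C ->
  (forall a, 0 <= A - 2 * a * b + a ^+ 2 * C) -> b ^+ 2 <= A * C.
Proof.
move=> A0 C0 H; have [g0|g0] := eqVneq C 0.
  have [->|b0] := eqVneq b 0; first by rewrite expr0n mulr_ge0.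
  (* For C = 0 the expression is affine in a, and this a makes it equal to -1. *)
  have := H ((A + 1) / (2 * b)).
  have -> : 2 * ((A + 1) / (2 * b)) * b = A + 1 by field.
  by rewrite g0; lra.
have gp : 0 < C by rewrite lt_neqAle eq_sym g0.
have := H (b / C).
have -> : A - 2 * (b / C) * b + (b / C) ^+ 2 * C = (A * C - b ^+ 2) / C by field.
by rewrite pmulr_lge0 ?invr_gt0// subr_ge0.
Qed.

Section square_integrable.
Context {R : realType} (L : R).
Notation mu := (@lebesgue_measure R).
Notation I := (oitv L).
Implicit Types f g h : R -> R.

(** Kept as a predicate on functions rather than on classes modulo null sets: primitives, end values
    and test functions are handled pointwise. *)
Definition sqint f := measurable_fun I f /\
  mu.-integrable I (EFin \o (fun x => f x ^+ 2)).

Definition ip f g : R := \int[mu]_(x in I) (f x * g x).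

Lemma measurable_oitv : measurable (I : set (g_sigma_algebraType R.-ocitv.-measurable)).
Proof. exact: measurable_itv. Qed.
Hint Resolve measurable_oitv : core.

Lemma oitvE x : I x = (- L < x < L) :> Prop.
Proof. by rewrite /oitv/= in_itv. Qed.

Lemma integrableD_EFin f g : mu.-integrable I (EFin \o f) ->
  mu.-integrable I (EFin \o g) ->
  mu.-integrable I (EFin \o (fun x => f x + g x)).
Proof.
move=> hf hg.
exact: (eq_integrable measurable_oitv _ _ (fun _ _ => erefl)
  (integrableD measurable_oitv hf hg)).
Qed.

(** The product is dominated by f^2 + g^2. *)
Lemma sqint_mul f g : sqint f -> sqint g ->
  mu.-integrable I (EFin \o (fun x => f x * g x)).
Proof.
move=> [mf f2] [mg g2].
apply: (@le_integrable _ _ _ mu I measurable_oitv _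
  (EFin \o (fun x => f x ^+ 2 + g x ^+ 2))).
- by apply/measurable_EFinP; exact: measurable_funM.
- move=> x _; rewrite /= lee_fin normrM [leRHS]ger0_norm ?addr_ge0 ?sqr_ge0//.
  rewrite -(real_normK (num_real (f x))) -(real_normK (num_real (g x))).
  move: (sqr_ge0 (`|f x| - `|g x|)) (sqr_ge0 (`|f x|)) (sqr_ge0 (`|g x|)).
  by rewrite sqrrB; lra.
- exact: integrableD_EFin.
Qed.

Lemma sqintD f g : sqint f -> sqint g -> sqint (fun x => f x + g x).
Proof.
move=> sf sg; have [[mf f2] [mg g2]] := (sf, sg); split.
  exact: measurable_funD.
apply: (@eq_integrable _ _ _ mu I measurable_oitv
  (EFin \o (fun x => f x ^+ 2 + g x ^+ 2 + (f x * g x + f x * g x)))).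
  by move=> x _ /=; congr (_%:E); ring.
have fg := sqint_mul sf sg.
by do 2 (apply: integrableD_EFin => //).
Qed.

Lemma sqintZ (a : R) f : sqint f -> sqint (fun x => a * f x).
Proof.
move=> [mf f2]; split; first exact: measurable_funM.
apply: (eq_integrable measurable_oitv _ _ _ (integrableZl measurable_oitv (a ^+ 2) f2)).
by move=> x _ /=; rewrite -EFinM exprMn.
Qed.

Lemma sqintB f g : sqint f -> sqint g -> sqint (fun x => f x - g x).
Proof.
move=> sf sg; have := sqintD sf (sqintZ (-1) sg).
by under [X in sqint X -> _]eq_fun do rewrite mulN1r.
Qed.

Lemma sqint_sum n (F : 'I_n -> R -> R) : (forall i, sqint (F i)) ->
  sqint (fun x => \sum_(i < n) F i x).
Proof.
elim: n F => [|n IH] F HF.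
  under [X in sqint X]eq_fun do rewrite big_ord0.
  split; first exact: measurable_cst.
  under [X in integrable _ _ (_ \o X)]eq_fun do rewrite expr0n/=.
  exact: integrable0.
under [X in sqint X]eq_fun do rewrite big_ord_recr/=.
by apply: sqintD => //; apply: IH.
Qed.

Lemma eq_sqint f g : {in I, f =1 g} -> sqint f -> sqint g.
Proof.
move=> fg [mf f2]; split; first exact: eq_measurable_fun mf.
by apply: eq_integrable f2 => // x xI /=; rewrite fg.
Qed.

Lemma lebesgue_oitv_lty : (mu I < +oo)%E.
Proof. by rewrite lebesgue_measure_itv/=; case: ifP; rewrite ?ltry. Qed.

Lemma sqint_bounded f (C : R) : measurable_fun I f ->
  (forall x, I x -> `|f x| <= C) -> sqint f.
Proof.
move=> mf fC; split => //.
apply: (@le_integrable _ _ _ mu I measurable_oitv _ (EFin \o cst (C ^+ 2))).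
- by apply/measurable_EFinP; exact: measurable_funX.
- move=> x Ix; rewrite /= lee_fin !ger0_norm ?sqr_ge0//.
  by rewrite -(real_normK (num_real (f x))) lerXn2r ?nnegrE ?fC// (le_trans _ (fC _ Ix)).
- apply/integrableP; split; first by apply/measurable_EFinP.
  under eq_integral do rewrite /= ger0_norm ?sqr_ge0//.
  by rewrite integral_cst// lte_mul_pinfty// ?lee_fin ?sqr_ge0// lebesgue_oitv_lty.
Qed.

(** Continuity on the whole line bounds f on the compact closure of I; for negative L the interval
    is empty. *)
Lemma sqint_continuous f : continuous f -> sqint f.
Proof.
move=> cf.
have [LL|LL] := leP (- L) L; last first.
  apply: (@sqint_bounded _ 0).
    by apply: measurable_funTS; exact: continuous_measurable_fun.
  by move=> x; rewrite oitvE => xI; exfalso; move: xI LL; lra.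
have cn : {within `[- L, L], continuous (fun x => `|f x|)}.
  by apply: continuous_subspaceT => x; apply: continuous_comp; [exact: cf|exact: norm_continuous].
have [c _ fc] := EVT_max LL cn.
apply: (@sqint_bounded _ `|f c|).
  by apply: measurable_funTS; exact: continuous_measurable_fun.
move=> x; rewrite oitvE => /andP[h1 h2]; apply: fc.
by rewrite in_itv/= !ltW.
Qed.

Lemma sqint_cst (c : R) : sqint (fun=> c).
Proof. by apply: sqint_continuous => x; exact: cvg_cst. Qed.

Lemma sqint_indic f (A : set R) : measurable A -> sqint f ->
  sqint (fun x => \1_A x * f x).
Proof.
move=> mA [mf f2].
have m1 : measurable_fun I (fun x => \1_A x * f x).
  by apply: measurable_funM => //; exact: measurable_indic.
split => //; apply: le_integrable f2 => //.
  by apply/measurable_EFinP; exact: measurable_funX.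
move=> x _; rewrite /= lee_fin exprMn normrM ler_piMl// indicE.
by case: (_ \in _); rewrite ?expr1n ?normr1// expr0n normr0.
Qed.

Lemma ipC f g : ip f g = ip g f.
Proof. by apply: eq_Rintegral => x _; rewrite mulrC. Qed.

Lemma eq_ip f f' g g' : {in I, f =1 f'} -> {in I, g =1 g'} -> ip f g = ip f' g'.
Proof. by move=> ff gg; apply: eq_Rintegral => x xI; rewrite ff// gg. Qed.

Lemma ipDl f g h : sqint f -> sqint g -> sqint h ->
  ip (fun x => f x + g x) h = ip f h + ip g h.
Proof.
move=> sf sg sh; rewrite /ip -RintegralD//; try exact: sqint_mul.
by apply: eq_Rintegral => x _; rewrite mulrDl.
Qed.

Lemma ipZl (a : R) f h : sqint f -> sqint h ->
  ip (fun x => a * f x) h = a * ip f h.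
Proof.
move=> sf sh; rewrite /ip -RintegralZl//; last exact: sqint_mul.
by apply: eq_Rintegral => x _; rewrite mulrA.
Qed.

Lemma ipBl f g h : sqint f -> sqint g -> sqint h ->
  ip (fun x => f x - g x) h = ip f h - ip g h.
Proof.
move=> sf sg sh; rewrite /ip -RintegralB//; try exact: sqint_mul.
by apply: eq_Rintegral => x _; rewrite mulrBl.
Qed.

Lemma ipDr f g h : sqint f -> sqint g -> sqint h ->
  ip h (fun x => f x + g x) = ip h f + ip h g.
Proof. by move=> *; rewrite ipC ipDl// !(ipC _ h). Qed.

Lemma ipZr (a : R) f h : sqint f -> sqint h ->
  ip h (fun x => a * f x) = a * ip h f.
Proof. by move=> *; rewrite ipC ipZl// !(ipC _ h). Qed.

Lemma ipBr f g h : sqint f -> sqint g -> sqint h ->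
  ip h (fun x => f x - g x) = ip h f - ip h g.
Proof. by move=> *; rewrite ipC ipBl// !(ipC _ h). Qed.

Lemma ip_suml n (F : 'I_n -> R -> R) h : (forall i, sqint (F i)) -> sqint h ->
  ip (fun x => \sum_(i < n) F i x) h = \sum_(i < n) ip (F i) h.
Proof.
move=> + sh; elim: n F => [|n IH] F HF.
  rewrite big_ord0 /ip; under eq_Rintegral do rewrite big_ord0 mul0r.
  by rewrite Rintegral_cst// mul0r.
rewrite big_ord_recr/= -IH// -ipDl//; last by apply: sqint_sum.
by apply: eq_ip => // x _; rewrite big_ord_recr.
Qed.

Lemma ip_ge0 f : 0 <= ip f f.
Proof. by apply: Rintegral_ge0 => x _; rewrite -expr2 sqr_ge0. Qed.

Lemma ip_subl f g : sqint f -> sqint g ->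
  ip (fun x => f x - g x) (fun x => f x - g x) = ip f f - 2 * ip f g + ip g g.
Proof.
move=> sf sg; have sfg := sqintB sf sg.
by rewrite ipBl// !ipBr// (ipC g f); ring.
Qed.

Lemma ip_addl f g : sqint f -> sqint g ->
  ip (fun x => f x + g x) (fun x => f x + g x) = ip f f + 2 * ip f g + ip g g.
Proof.
move=> sf sg; have sfg := sqintD sf sg.
by rewrite ipDl// !ipDr// (ipC g f); ring.
Qed.

Lemma ip_cauchy f g : sqint f -> sqint g -> ip f g ^+ 2 <= ip f f * ip g g.
Proof.
move=> sf sg; apply: discriminant_le; [exact: ip_ge0..|move=> a].
have sag := sqintZ a sg.
have := ip_ge0 (fun x => f x - a * g x).
rewrite ip_subl// ipZr// ipZl// ipZr// => h; apply: le_trans h _.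
by rewrite le_eqVlt; apply/orP; left; apply/eqP; ring.
Qed.

End square_integrable.

(** * Differential inequalities *)

Section calculus.
Context {R : realType}.
Implicit Types (f df : R -> R) (a b x : R).

(** Differentiability without division by h; it serves at the origin of [flat] and for limits of
    differentiable functions. *)
Lemma is_derive_eps f x l :
  (forall e : R, 0 < e -> exists2 d, 0 < d &
    forall h, `|h| < d -> `|f (x + h) - f x - h * l| <= e * `|h|) ->
  is_derive x 1 f l.
Proof.
move=> H.
have cv : (fun h => h^-1 *: ((f \o shift x) (h *: 1) - f x)) @ 0^' --> l.
  apply/cvgrPdist_le => e e0; have [d d0 Hd] := H e e0.
  near=> h.
  have h0 : h != 0 by near: h; exact: nbhs_dnbhs_neq.
  have hd : `|h| < d by near: h; exact: dnbhs0_lt.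
  have hp : 0 < `|h| by rewrite normr_gt0.
  rewrite /= [h *: 1]mulr1 (addrC h) distrC -(ler_pM2r hp) -normrM mulrBl.
  rewrite -[_ *: _]/(h^-1 * _) mulrAC mulVf// mul1r (mulrC l).
  exact: Hd.
apply: DeriveDef; first by apply/cvg_ex; exists l.
exact/cvg_lim.
Unshelve. all: by end_near. Qed.

Lemma is_derive_shift0 f x l e : is_derive x 1 f l -> 0 < e ->
  exists2 d, 0 < d & forall h, `|h| < d -> `|f (x + h) - f x - h * l| <= e * `|h|.
Proof.
move=> [dfx <-] e0.
have := dfx; rewrite /derivable => /cvg_lim -/(_ _)/=.
have cv : (fun h => h^-1 *: ((f \o shift x) (h *: 1) - f x)) @ 0^' --> 'D_1 f x.
  exact: dfx.
move=> _; move/cvgrPdist_le : cv => /(_ e e0)/nbhs_ballP[d /= d0 Hd].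
exists d => // h hd; have [->|h0] := eqVneq h 0.
  by rewrite addr0 subrr mul0r subr0 normr0 mulr0.
have hp : 0 < `|h| by rewrite normr_gt0.
have := Hd h; rewrite /ball/= sub0r normrN => /(_ hd h0).
rewrite [h *: 1]mulr1 (addrC h) distrC -(ler_pM2r hp) -normrM mulrBl.
by rewrite -[_ *: _]/(h^-1 * _) mulrAC mulVf// mul1r (mulrC _ h).
Qed.

Lemma is_deriveE f g x l m : is_derive x 1 f l -> f =1 g -> l = m ->
  is_derive x 1 g m.
Proof. by move=> + /funext <- <-. Qed.

Lemma continuous_is_derive f df : (forall x, is_derive x 1 f (df x)) ->
  continuous f.
Proof.
move=> H x; apply/differentiable_continuous/derivable1_diffP.
by have [] := H x.
Qed.

Lemma mean_value_bound f df a b (M : R) : a <= b ->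
  (forall x, a < x < b -> is_derive x 1 f (df x)) ->
  {within `[a, b], continuous f} ->
  (forall x, a < x < b -> `|df x| <= M) -> `|f b - f a| <= M * (b - a).
Proof.
rewrite le_eqVlt => /predU1P[<- _ _ _|ab dfx cf Mdf].
  by rewrite !subrr normr0 mulr0.
have dfx' (x : R) : x \in `]a, b[ -> is_derive x 1 f (df x).
  by rewrite in_itv/=; exact: dfx.
have [c] := @MVT _ f df a b ab dfx' cf.
rewrite in_itv/= => cab ->; rewrite normrM [`|b - a|]ger0_norm ?subr_ge0 ?(ltW ab)//.
by rewrite ler_pM2r ?subr_gt0// Mdf.
Qed.

Lemma mean_value_le f df a b (M : R) : a <= b ->
  (forall x, a < x < b -> is_derive x 1 f (df x)) ->
  {within `[a, b], continuous f} ->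
  (forall x, a < x < b -> df x <= M) -> f b - f a <= M * (b - a).
Proof.
rewrite le_eqVlt => /predU1P[<- _ _ _|ab dfx cf Mdf].
  by rewrite !subrr mulr0.
have dfx' (x : R) : x \in `]a, b[ -> is_derive x 1 f (df x).
  by rewrite in_itv/=; exact: dfx.
have [c] := @MVT _ f df a b ab dfx' cf.
by rewrite in_itv/= => cab ->; rewrite ler_pM2r ?subr_gt0// Mdf.
Qed.

Lemma within_continuous_eps f a b :
  (forall x, a <= x <= b -> forall e : R, 0 < e -> exists2 d, 0 < d &
    forall y, a <= y <= b -> `|y - x| < d -> `|f y - f x| <= e) ->
  {within `[a, b], continuous f}.
Proof.
move=> H; apply/subspace_continuousP => x /=; rewrite in_itv/= => xab.
apply/cvgrPdist_le => e e0; have [d d0 Hd] := H x xab e e0.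
rewrite near_withinE/=; near=> y => yab.
rewrite distrC; apply: Hd; first by move: yab; rewrite in_itv.
by rewrite distrC; near: y; apply/nbhs_ballP; exists d.
Unshelve. all: by end_near. Qed.

(* [sqrt (y + e)] is differentiable even where [y] vanishes, with slope at most [b]. *)
Lemma sqrt_growth (y dy : R -> R) (t b : R) : 0 <= t -> 0 <= b ->
  (forall s : R, 0 <= s <= t -> 0 <= y s) ->
  (forall s : R, 0 < s < t -> is_derive s 1 y (dy s)) ->
  {within `[0, t], continuous y} ->
  (forall s : R, 0 < s < t -> dy s <= 2 * b * Num.sqrt (y s)) ->
  Num.sqrt (y t) <= Num.sqrt (y 0) + b * t.
Proof.
move=> t0 b0 y0 ddy cy Hdy; apply/ler_addgt0Pr => e e0.
pose z s := Num.sqrt (y s + e ^+ 2).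
have e2 : 0 < e ^+ 2 by rewrite exprn_gt0.
have dz s : 0 < s < t ->
    is_derive s 1 z ((2 * Num.sqrt (y s + e ^+ 2))^-1 * dy s).
  move=> st; have ys : 0 <= y s by apply: y0; case/andP: st => /ltW-> /ltW->.
  have h1 : is_derive s 1 (fun u => y u + e ^+ 2) (dy s).
    by apply: is_derive_eq (is_deriveD (ddy _ st) (is_derive_cst _ _ _)) _; rewrite addr0.
  have h2 : is_derive (y s + e ^+ 2) 1 Num.sqrt (2 * Num.sqrt (y s + e ^+ 2))^-1.
    by apply: is_derive1_sqrt; rewrite ltr_wpDl.
  exact: (@is_derive1_comp _ Num.sqrt (fun u => y u + e ^+ 2) s _ _ h2 h1).
have cz : {within `[0, t], continuous z}.
  move=> x; apply: continuous_comp; last exact: sqrt_continuous.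
  by apply: cvgD; [exact: cy|exact: cvg_cst].
have : z t - z 0 <= b * (t - 0).
  apply: (mean_value_le t0 dz cz) => s st.
  have ys : 0 <= y s by apply: y0; case/andP: st => /ltW-> /ltW->.
  rewrite mulrC ler_pdivrMr ?mulr_gt0 ?sqrtr_gt0 ?ltr_wpDl//.
  apply: le_trans (Hdy _ st) _; rewrite -!mulrA (mulrCA b) ler_pM2l// ler_wpM2l//.
  by rewrite ler_sqrt ?lerDl ?ltW// ltr_wpDl.
rewrite subr0 => zt.
have h1 : Num.sqrt (y t) <= z t.
  by rewrite ler_sqrt ?lerDl ?ltW// ltr_wpDl// y0// t0 lexx.
have h2 : z 0 <= Num.sqrt (y 0) + e.
  have y00 : 0 <= y 0 by rewrite y0// lexx t0.
  rewrite -(@ler_pXn2r _ 2)// ?nnegrE ?sqrtr_ge0// ?addr_ge0 ?sqrtr_ge0 ?(ltW e0)//.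
  rewrite sqr_sqrtr; last by rewrite addr_ge0// ltW.
  rewrite sqrrD sqr_sqrtr//.
  have : 0 <= Num.sqrt (y 0) * e by rewrite mulr_ge0 ?sqrtr_ge0// ltW.
  by lra.
lra.
Qed.

(** Continuity method. Let A be the set of times up to which S stays below m'. Continuity gives S <=
    m' at sup A, the hypothesis improves this to m < m', and continuity again carries the bound
    beyond sup A unless sup A = T. *)
Lemma bootstrap (S : R -> R) (T m m' : R) : 0 <= T -> m < m' -> S 0 <= m ->
  (forall t : R, 0 <= t <= T -> forall e : R, 0 < e -> exists2 d, 0 < d &
    forall s, 0 <= s <= T -> `|s - t| < d -> `|S s - S t| <= e) ->
  (forall t : R, 0 <= t <= T -> (forall s : R, 0 <= s <= t -> S s <= m') -> S t <= m) ->
  forall t : R, 0 <= t <= T -> S t <= m'.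
Proof.
move=> T0 mm S0 cS H.
pose A := [set t | 0 <= t <= T /\ forall s, 0 <= s <= t -> S s <= m'].
have A0 : A 0.
  split; first by rewrite lexx T0.
  move=> s s0; have -> : s = 0 by lra.
  by lra.
have hsA : has_sup A.
  by split; [exists 0|exists T => t [/andP[]]].
have ubA t : A t -> t <= sup A by move=> At; apply: sup_upper_bound.
have s0 : 0 <= sup A by apply: ubA.
have sT : sup A <= T by apply: ge_sup => [|t [/andP[]]]; first by exists 0.
have lt_sup s : 0 <= s < sup A -> S s <= m'.
  move=> /andP[s_0 ss]; have [e [_ He] se] := sup_gt (proj1 hsA) ss.
  by apply: He; rewrite s_0 ltW.
have sAT : 0 <= sup A <= T by rewrite s0 sT.
have Hs : S (sup A) <= m'.
  rewrite leNgt; apply/negP => Sm.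
  have sp : 0 < sup A.
    rewrite lt_neqAle s0 andbT; apply/negP => /eqP sA.
    by move: Sm; rewrite -sA; lra.
  have e0 : 0 < (S (sup A) - m') / 2 by lra.
  have [d d0 Hd] := cS _ sAT _ e0.
  pose s := Num.max 0 (sup A - d / 2).
  have s1 : 0 <= s < sup A.
    by rewrite /s le_max lexx/= gt_max sp/=; lra.
  have sd : `|s - sup A| < d.
    rewrite ltr_norml; apply/andP; split; last by lra.
    have : sup A - d / 2 <= s by rewrite /s le_max lexx orbT.
    by lra.
  have sT' : 0 <= s <= T by lra.
  have := Hd s sT' sd; rewrite ler_norml => /andP[h _].
  have := lt_sup _ s1; lra.
have Hm : S (sup A) <= m.
  apply: H => // s /andP[s1]; rewrite le_eqVlt => /predU1P[->//|s2].
  by apply: lt_sup; rewrite s1.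
have em : 0 < m' - m by lra.
have [d d0 Hd] := cS _ sAT _ em.
have HT : sup A = T.
  apply/eqP; rewrite eq_le sT/= leNgt; apply/negP => sAlt.
  pose u := Num.min T (sup A + d / 2).
  have us : sup A < u by rewrite /u lt_min sAlt/=; lra.
  have uT : u <= T by rewrite /u ge_min lexx.
  have ud : u <= sup A + d / 2 by rewrite /u ge_min lexx orbT.
  suff Au : A u by have := ubA _ Au; lra.
  split; first by lra.
  move=> s /andP[s1 s2]; have [ss|ss] := ltP s (sup A).
    by apply: lt_sup; rewrite s1.
  have sT' : 0 <= s <= T by lra.
  have sd : `|s - sup A| < d by rewrite ger0_norm; lra.
  have := Hd s sT' sd; rewrite ler_norml => /andP[_ h]; lra.
move=> t /andP[t0]; rewrite -HT le_eqVlt => /predU1P[->//|tl].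
by apply: lt_sup; rewrite t0.
Qed.

End calculus.

(** * Smooth cutoffs *)

Section smooth_functions.
Context {R : realType}.
Implicit Types (f g : R -> R) (a b c x : R).

(** The classical flat function at k = 0. The other powers are there because differentiation
    produces them: the derivative of [flat k] combines [flat k.+1] and [flat k.+2]. *)
Definition flat (k : nat) x : R := if 0 < x then x ^- k * expR (- x^-1) else 0.

(* A class of functions closed under differentiation, whence all its members are
   smooth. *)
Inductive elementary : (R -> R) -> Prop :=
| elementary_cst c : elementary (fun=> c)
| elementary_cos a b : elementary (fun x => cos (a * (x + b)))
| elementary_sin a b : elementary (fun x => sin (a * (x + b)))
| elementary_flat k a b : elementary (fun x => flat k (a * (x + b)))
| elementary_add f g : elementary f -> elementary g ->
    elementary (fun x => f x + g x)
| elementary_mul f g : elementary f -> elementary g ->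
    elementary (fun x => f x * g x)
| elementary_inv f : elementary f -> (forall x, f x != 0) ->
    elementary (fun x => (f x)^-1).

Lemma is_derive_affine (f : R -> R) a b x l : is_derive (a * (x + b)) 1 f l ->
  is_derive x 1 (fun y => f (a * (y + b))) (a * l).
Proof.
move=> df.
have h1 : is_derive x 1 (fun y => a * (y + b)) a.
  have -> : (fun y => a * (y + b)) = (a \*: (id \+ cst b)) by apply/funext.
  by apply: is_derive_eq; rewrite addr0 /GRing.scale/= mulr1.
have := @is_derive1_comp _ f (fun y => a * (y + b)) x _ _ df h1.
by rewrite mulrC.
Qed.

(** From exp y >= y^(k+2) / (k+2)! at y = 1/x. The factor x^2 makes the derivative at the origin
    vanish. *)
Lemma flat_le k x : 0 < x -> flat k x <= (k.+2)`!%:R * x ^+ 2.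
Proof.
move=> x0; rewrite /flat x0.
have y0 : 0 <= x^-1 by rewrite invr_ge0 ltW.
have f0 : 0 < (k.+2)`!%:R :> R by rewrite ltr0n fact_gt0.
have := expR_ge1Dxn (k.+1) y0; rewrite expRN => H.
have {}H : x ^- k.+2 / (k.+2)`!%:R <= expR x^-1.
  by rewrite -exprVn; apply: le_trans H; rewrite lerDr.
rewrite ler_pdivrMr ?expR_gt0//.
have -> : x ^- k = (k.+2)`!%:R * x ^+ 2 * (x ^- k.+2 / (k.+2)`!%:R).
  by rewrite -[k.+2]addn2 exprD; field; rewrite ?expf_neq0 ?gt_eqF.
by rewrite ler_wpM2l// mulr_ge0 ?sqr_ge0// ltW.
Qed.

Lemma flat_ge0 k x : 0 <= flat k x.
Proof.
rewrite /flat; case: ifP => // x0.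
by rewrite mulr_ge0 ?expR_ge0// invr_ge0 exprn_ge0// ltW.
Qed.

Lemma is_derive_inv x : x != 0 -> is_derive x 1 (fun y : R => y^-1) (- x ^- 2).
Proof.
move=> xn0; have := @is_deriveV _ id x 1 1 xn0 (is_derive_id _ _).
by rewrite /GRing.scale/= mulr1.
Qed.

Lemma is_derive_exprnN k x : x != 0 ->
  is_derive x 1 (fun y : R => y ^- k) (- (k%:R * x ^- k.+1)).
Proof.
move=> xn0; have -> : (fun y : R => y ^- k) = (fun y => (y^-1) ^+ k).
  by apply/funext => y; rewrite exprVn.
case: k => [|k].
  rewrite mul0r oppr0.
  have -> : (fun y : R => y^-1 ^+ 0) = cst 1 by apply/funext => y; rewrite expr0.
  exact: is_derive_cst.
apply: is_deriveE (is_deriveX k.+1 (is_derive_inv xn0)) _ _ => [y|].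
  by rewrite fctE.
rewrite -[LHS]/(k.+1%:R * x^-1 ^+ k * - x ^- 2) exprVn -[k.+2]addn2 exprD; field.
by rewrite xn0 expf_neq0.
Qed.

Lemma is_derive_flat k x :
  is_derive x 1 (flat k) (flat k.+2 x - k%:R * flat k.+1 x).
Proof.
have [x0|x0|->] := ltgtP x 0.
- have -> : flat k.+2 x - k%:R * flat k.+1 x = 0.
    by rewrite /flat ltNge ltW//= mulr0 subr0.
  have nr : \forall y \near x, cst 0 y = flat k y.
    near=> y; rewrite /flat ifF//; apply/negbTE; rewrite -leNgt ltW//.
    by near: y; exact: lt_nbhsl.
  exact: (near_eq_is_derive nr (is_derive_cst _ _ _)).
- have nr : \forall y \near x, y ^- k * expR (- y^-1) = flat k y.
    by near=> y; rewrite /flat ifT//; near: y; exact: lt_nbhsr.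
  apply: (near_eq_is_derive nr).
  have xn0 : x != 0 by rewrite gt_eqF.
  have dV := is_derive_inv xn0.
  have d1 : is_derive x 1 (fun y : R => expR (- y^-1)) (expR (- x^-1) * x ^- 2).
    have dN : is_derive x 1 (fun y : R => - y^-1) (x ^- 2).
      by apply: is_derive_eq (is_deriveN dV) _; rewrite opprK.
    exact: (is_derive1_comp (is_derive_expR _) dN).
  have d2 := is_derive_exprnN k xn0.
  apply: is_derive_eq (is_deriveM d2 d1) _.
  rewrite /flat x0 /GRing.scale/= -[k.+2]addn2 -[k.+1]addn1 !exprD expr1; field.
  by rewrite xn0 expf_neq0.
- have -> : flat k.+2 0 - k%:R * flat k.+1 0 = 0.
    by rewrite /flat ltxx mulr0 subr0.
  apply: is_derive_eps => e e0.
  have f0 : 0 < (k.+2)`!%:R :> R by rewrite ltr0n fact_gt0.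
  exists (e / (k.+2)`!%:R); first by rewrite divr_gt0.
  move=> h hd; rewrite add0r mulr0 subr0 [flat k 0]/flat ltxx subr0.
  rewrite ger0_norm ?flat_ge0//.
  have [h0|h0] := ltP 0 h; last first.
    by rewrite /flat ltNge h0/= mulr_ge0// ltW.
  apply: le_trans (flat_le k h0) _; rewrite (ger0_norm (ltW h0)) expr2 mulrA.
  rewrite ler_pM2r// mulrC -ler_pdivlMr//.
  by move: hd; rewrite (ger0_norm (ltW h0)) => /ltW.
Unshelve. all: by end_near. Qed.

Lemma elementary_derive f : elementary f ->
  exists2 df, forall x, is_derive x 1 f (df x) & elementary df.
Proof.
elim=> {f}[c|a b|a b|k a b|f g _ [df ddf edf] _ [dg ddg edg]|
  f g ef [df ddf edf] eg [dg ddg edg]|f ef [df ddf edf] f0].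
- by exists (fun=> 0) => [x|]; [exact: is_derive_cst|exact: elementary_cst].
- exists (fun x => (- a) * sin (a * (x + b))).
    move=> x; apply: is_derive_eq (is_derive_affine (is_derive_cos _)) _.
    by rewrite mulNr mulrN.
  by apply: elementary_mul; [exact: elementary_cst|exact: elementary_sin].
- exists (fun x => a * cos (a * (x + b))).
    by move=> x; exact: is_derive_affine (is_derive_sin _).
  by apply: elementary_mul; [exact: elementary_cst|exact: elementary_cos].
- exists (fun x => a * (flat k.+2 (a * (x + b)) + (- k%:R) * flat k.+1 (a * (x + b)))).
    move=> x; apply: is_derive_eq (is_derive_affine (is_derive_flat k _)) _.
    by rewrite mulNr.
  apply: elementary_mul; first exact: elementary_cst.
  apply: elementary_add; first exact: elementary_flat.
  by apply: elementary_mul; [exact: elementary_cst|exact: elementary_flat].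
- exists (fun x => df x + dg x); last exact: elementary_add.
  by move=> x; exact: is_deriveD.
- exists (fun x => df x * g x + f x * dg x); last first.
    by apply: elementary_add; apply: elementary_mul.
  move=> x; apply: is_derive_eq (is_deriveM (ddf x) (ddg x)) _.
  by rewrite /GRing.scale/= addrC [g x * _]mulrC.
- exists (fun x => -1 * (df x * ((f x)^-1 * (f x)^-1))).
    move=> x; have := @is_deriveV _ f x (df x) 1 (f0 x) (ddf x).
    by rewrite /GRing.scale/= expr2 invfM mulN1r mulNr mulrC.
  apply: elementary_mul; first exact: elementary_cst.
  by do 2 (apply: elementary_mul => //); exact: elementary_inv.
Qed.

Lemma elementary_derive1n f n : elementary f -> elementary (derive1n n f).
Proof.
move=> ef; elim: n => [|n IH]; first by rewrite derive1n0.
rewrite derive1nS; have [df ddf edf] := elementary_derive IH.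
suff -> : (f^`(n))^`()%classic = df by [].
apply/funext => x; rewrite derive1E; have dx := ddf x; exact: derive_val.
Qed.

Lemma elementary_smooth f : elementary f ->
  forall n x, derivable (derive1n n f) x 1.
Proof.
move=> ef n x; have [df ddf _] := elementary_derive (elementary_derive1n n ef).
by have [] := ddf x.
Qed.

(** The standard smooth step, rising from 0 to 1 on [0, 1], with its arguments in the affine form of
    [elementary_flat]. *)
Definition step x : R := flat 0 (1 * (x + 0)) *
  (flat 0 (1 * (x + 0)) + flat 0 (-1 * (x + -1)))^-1.

Lemma step_den x : flat 0 x + flat 0 (1 - x) != 0.
Proof.
rewrite gt_eqF//; have [x0|x0] := ltP 0 x.
  by rewrite ltr_pwDl ?flat_ge0// /flat x0 expr0 invr1 mul1r expR_gt0.
rewrite ltr_wpDl ?flat_ge0// /flat subr_gt0 (le_lt_trans x0)//.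
by rewrite expr0 invr1 mul1r expR_gt0.
Qed.

Lemma stepE x : step x = flat 0 x / (flat 0 x + flat 0 (1 - x)).
Proof.
by rewrite /step !mul1r addr0 mulN1r opprD opprK [- x + _]addrC.
Qed.

Lemma step_le0 x : x <= 0 -> step x = 0.
Proof. by move=> x0; rewrite stepE {1}/flat ltNge x0/= mul0r. Qed.

Lemma step_ge1 x : 1 <= x -> step x = 1.
Proof.
move=> x1; have := step_den x; rewrite stepE [flat 0 (1 - x)]/flat.
by rewrite subr_gt0 ltNge x1/= addr0 => h; rewrite divff.
Qed.

Lemma step_itv x : 0 <= step x <= 1.
Proof.
rewrite stepE; apply/andP; split; first by rewrite divr_ge0 ?addr_ge0 ?flat_ge0.
have := step_den x; rewrite ler_pdivrMr; last first.
  by rewrite lt_neqAle eq_sym step_den addr_ge0 ?flat_ge0.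
by rewrite mul1r lerDl flat_ge0.
Qed.

Lemma elementary_step a b : elementary (fun x => step (a * (x + b))).
Proof.
have h1 : elementary (fun x => flat 0 (a * (x + b))) by exact: elementary_flat.
have h2 : elementary (fun x => flat 0 (1 - a * (x + b))).
  (* The affine form of 1 - a (x + b) divides by a, so a = 0 is set apart. *)
  have [->|a0] := eqVneq a 0.
    under eq_fun do rewrite mul0r; exact: elementary_cst.
  under eq_fun => x.
    have -> : 1 - a * (x + b) = (- a) * (x + (b - a^-1)) by field.
    over.
  exact: elementary_flat.
under eq_fun do rewrite stepE.
apply: elementary_mul => //; apply: elementary_inv; first exact: elementary_add.
by move=> x; exact: step_den.
Qed.

(** The derivative is continuous, hence bounded on [-1, 2], and it vanishes outside, where [step] is
    locally constant. *)
Lemma step_derive : exists2 ds, forall x, is_derive x 1 step (ds x) &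
  exists M, forall x, `|ds x| <= M.
Proof.
have -> : step = (fun x => step (1 * (x + 0))).
  by apply/funext => x; rewrite mul1r addr0.
have [ds dds eds] := elementary_derive (elementary_step 1 0).
exists ds => //.
have [dds' ddds _] := elementary_derive eds.
have cds : continuous ds := continuous_is_derive ddds.
have cn : {within `[-1, 2], continuous (fun x => `|ds x|)}.
  by apply: continuous_subspaceT => x; apply: continuous_comp; [exact: cds|exact: norm_continuous].
have le12 : (-1 : R) <= 2 by lra.
have [c _ fc] := EVT_max le12 cn.
have out x l : (\forall y \near x, step (1 * (y + 0)) = l) -> ds x = 0.
  move=> near0; have := @near_eq_is_derive _ _ _ _ (cst l) x 1 (ds x) near0 (dds x).
  by move=> [_ <-]; rewrite derive_cst.
exists `|ds c| => x.
have [x1|x1] := ltP x (-1).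
  rewrite (out x 0) ?normr0//; near=> y; rewrite mul1r addr0 step_le0//.
  have : y < -1 by near: y; exact: lt_nbhsl.
  by lra.
have [x2|x2] := ltP 2 x.
  rewrite (out x 1) ?normr0//; near=> y; rewrite mul1r addr0 step_ge1//.
  have : 2 < y by near: y; exact: lt_nbhsr.
  by lra.
by apply: fc; rewrite in_itv/= x1.
Unshelve. all: by end_near. Qed.

End smooth_functions.

(** * The Fourier series of a parabola *)

Section sawtooth.
Context {R : realType}.
Implicit Types (x t : R) (n k : nat).

Lemma sin_natpi n : sin (n%:R * pi) = 0 :> R.
Proof.
have := alternatingn (@sinDpi R) n 0; rewrite add0r sin0 mulr0 mulr_natl.
exact.
Qed.

Lemma is_derive_cosM (a b x : R) :
  is_derive x 1 (fun y => cos (a * (y + b))) (- (a * sin (a * (x + b)))).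
Proof. by apply: is_derive_eq (is_derive_affine (is_derive_cos _)) _; rewrite mulrN. Qed.

Lemma is_derive_sinM (a b x : R) :
  is_derive x 1 (fun y => sin (a * (y + b))) (a * cos (a * (x + b))).
Proof. exact: is_derive_affine (is_derive_sin _). Qed.

Lemma is_derive_sumn n (F dF : nat -> R -> R) x :
  (forall k, is_derive x 1 (F k) (dF k x)) ->
  is_derive x 1 (fun y => \sum_(k < n) F k y) (\sum_(k < n) dF k x).
Proof.
move=> H; elim: n => [|n IH].
  rewrite big_ord0; under [X in is_derive _ _ X _]eq_fun do rewrite big_ord0.
  exact: is_derive_cst.
rewrite big_ord_recr/=; under [X in is_derive _ _ X _]eq_fun do rewrite big_ord_recr/=.
exact: is_deriveD.
Qed.

(** Remainder of the expansion t (pi - t) / 2 = sum over k >= 1 of sin(kt)^2 / k^2 on [0, pi]. *)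
Definition parabola_defect n t : R :=
  t * (pi - t) / 2 - \sum_(k < n) sin (k.+1%:R * t) ^+ 2 / k.+1%:R ^+ 2.

(** Remainder of the sawtooth series pi / 2 - t = sum over k >= 1 of sin(2kt) / k, the derivative of
    the preceding expansion. *)
Definition sawtooth_defect n t : R :=
  pi / 2 - t - \sum_(k < n) sin (2 * k.+1%:R * t) / k.+1%:R.

Lemma is_derive_parabola_defect n t :
  is_derive t 1 (parabola_defect n) (sawtooth_defect n t).
Proof.
have h1 : is_derive t 1 (fun y => y * (pi - y) / 2) (pi / 2 - t).
  have hb : is_derive t 1 (fun y => pi - y) (-1).
    by apply: is_derive_eq (is_deriveB (is_derive_cst _ _ _) (is_derive_id _ _)) _; rewrite sub0r.
  have hm := is_deriveM (is_derive_id t 1) hb.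
  have -> : (fun y => y * (pi - y) / 2) = (2^-1 : R) \*: ((id : R -> R) \* (fun y => pi - y)).
    by apply/funext => y /=; rewrite /GRing.scale/= mulrC.
  by apply: is_derive_eq (is_deriveZ _ hm) _; rewrite /GRing.scale/=; field.
apply: is_deriveB h1 _.
apply: (@is_derive_sumn n (fun k y => sin (k.+1%:R * y) ^+ 2 / k.+1%:R ^+ 2)
  (fun k y => sin (2 * k.+1%:R * y) / k.+1%:R)) => k.
have kn : k.+1%:R != 0 :> R by rewrite pnatr_eq0.
have hs : is_derive t 1 (fun y => sin (k.+1%:R * y)) (k.+1%:R * cos (k.+1%:R * t)).
  have := is_derive_sinM k.+1%:R 0 t; rewrite addr0.
  by under [X in is_derive _ _ X _ -> _]eq_fun do rewrite addr0.
apply: is_deriveE (is_deriveZ (k.+1%:R ^- 2) (is_deriveX 2 hs)) _ _ => [y|].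
  by rewrite -[LHS]/(k.+1%:R ^- 2 * (sin (k.+1%:R * y) * sin (k.+1%:R * y))) mulrC.
rewrite /GRing.scale/= expr1 -mulrA [2 * (_ * t)]mulr_natl sin_mulr2n.
by field.
Qed.

(** Each 2 sin t cos(2kt) is a difference of consecutive sines, so the sum telescopes. *)
Lemma dirichlet_kernel n t :
  sin t * (1 + 2 * \sum_(k < n) cos (2 * k.+1%:R * t)) = sin ((2 * n%:R + 1) * t).
Proof.
elim: n => [|n IH]; first by rewrite big_ord0 !mulr0 addr0 add0r mulr1 mul1r.
rewrite big_ord_recr/=.
transitivity (sin t * (1 + 2 * \sum_(k < n) cos (2 * k.+1%:R * t)) +
  2 * sin t * cos (2 * n.+1%:R * t)); first by ring.
rewrite IH.
have -> : (2 * n%:R + 1) * t = 2 * n.+1%:R * t - t by rewrite -natr1; ring.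
have -> : (2 * n.+1%:R + 1) * t = 2 * n.+1%:R * t + t by ring.
by rewrite sinB sinD; ring.
Qed.

Lemma is_derive_sawtooth_defect n t : sin t != 0 ->
  is_derive t 1 (sawtooth_defect n) (- (sin ((2 * n%:R + 1) * t) / sin t)).
Proof.
move=> st; have -> : - (sin ((2 * n%:R + 1) * t) / sin t) =
  -1 - \sum_(k < n) 2 * cos (2 * k.+1%:R * t).
  by rewrite -dirichlet_kernel -mulr_sumr; field.
have h1 : is_derive t 1 (fun y => pi / 2 - y) (-1).
  by apply: is_derive_eq (is_deriveB (is_derive_cst _ _ _) (is_derive_id _ _)) _; rewrite sub0r.
apply: is_deriveB h1 _.
apply: (@is_derive_sumn n (fun k y => sin (2 * k.+1%:R * y) / k.+1%:R)
  (fun k y => 2 * cos (2 * k.+1%:R * y))) => k.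
have kn : k.+1%:R != 0 :> R by rewrite pnatr_eq0.
have hs : is_derive t 1 (fun y => sin (2 * k.+1%:R * y)) (2 * k.+1%:R * cos (2 * k.+1%:R * t)).
  have := is_derive_sinM (2 * k.+1%:R) 0 t; rewrite addr0.
  by under [X in is_derive _ _ X _ -> _]eq_fun do rewrite addr0.
have -> : (fun y => sin (2 * k.+1%:R * y) / k.+1%:R) =
  (k.+1%:R ^- 1 : R) \*: ((fun y => sin (2 * k.+1%:R * y))).
  by apply/funext => y /=; rewrite /GRing.scale/= mulrC expr1.
by apply: is_derive_eq (is_deriveZ _ hs) _; rewrite /GRing.scale/=; field.
Qed.

Lemma sin_ge_itv (d t : R) : 0 < d <= pi / 2 -> d <= t <= pi - d -> sin d <= sin t.
Proof.
move=> dp; wlog tp : t / t <= pi / 2 => [H|] dt.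
  have [|tp] := leP t (pi / 2); first by move=> tp; exact: H.
  have -> : sin t = sin (pi - t).
    by rewrite sinB sinpi cospi mul0r mulN1r sub0r opprK.
  by apply: H; lra.
have [->//|dt'] := eqVneq d t.
apply: ltW; rewrite ltr_sin ?in_itv/=; first by rewrite lt_neqAle dt'; case/andP: dt.
  by move: (@pi_gt0 R); lra.
by move: (@pi_gt0 R); lra.
Qed.

(** The derivative of the defect, -sin(mt) / sin t, oscillates. Subtracting cos(mt) / (m sin t), the
    boundary term of an integration by parts, leaves a function [T] whose slope is O(1/m) and which
    vanishes at pi / 2. *)
Lemma sawtooth_defect_le n (d t : R) : 0 < d <= pi / 2 -> d <= t <= pi - d ->
  `|sawtooth_defect n t| <= (pi + 1) / ((2 * n%:R + 1) * sin d ^+ 2).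
Proof.
move=> dp dt; set m := 2 * n%:R + 1.
have m0 : 0 < m by rewrite ltr_wpDl ?mulr_ge0.
have pi0 := @pi_gt0 R.
have sd : 0 < sin d by apply: sin_gt0_pi; lra.
have sd1 : sin d <= 1 := sin_le1 d.
have sP u : d <= u <= pi - d -> sin d <= sin u := sin_ge_itv dp.
pose T u := sawtooth_defect n u - m^-1 * (cos (m * u) / sin u).
pose dT u := m^-1 * (cos (m * u) * cos u / sin u ^+ 2).
have ddT u : d <= u <= pi - d -> is_derive u 1 T (dT u).
  move=> du; have su : sin u != 0 by rewrite gt_eqF// (lt_le_trans sd)// sP.
  have hc : is_derive u 1 (fun y => cos (m * y)) (- (m * sin (m * u))).
    have := is_derive_cosM m 0 u; rewrite addr0.
    by under [X in is_derive _ _ X _ -> _]eq_fun do rewrite addr0.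
  have hi := @is_deriveV _ sin u (cos u) 1 su (is_derive_sin u).
  have hq := is_deriveZ m^-1 (is_deriveM hc hi).
  apply: is_derive_eq (is_deriveB (is_derive_sawtooth_defect n su) hq) _.
  rewrite /dT /GRing.scale/= -/m; field.
  by rewrite su gt_eqF.
have bT u : d <= u <= pi - d -> `|dT u| <= (m * sin d ^+ 2)^-1.
  move=> du; rewrite /dT [(m * _)^-1]invfM normrM gtr0_norm ?invr_gt0// ler_pM2l ?invr_gt0//.
  have su := sP _ du.
  rewrite normrM normfV [X in _ / X <= _]ger0_norm ?sqr_ge0// normrM.
  apply: (@le_trans _ _ (1 * (sin u ^+ 2)^-1)).
    rewrite ler_wpM2r ?invr_ge0 ?sqr_ge0//.
    by rewrite -[1]mulr1 ler_pM// cos_max.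
  rewrite mul1r lef_pV2 ?posrE ?exprn_gt0//; last exact: lt_le_trans su.
  by rewrite lerXn2r// ?nnegrE ?ltW//; exact: lt_le_trans su.
have T0 : T (pi / 2) = 0.
  rewrite /T /sawtooth_defect subrr sub0r big1 => [|k _]; last first.
    have -> : 2 * k.+1%:R * (pi / 2) = k.+1%:R * pi :> R by field.
    by rewrite sin_natpi mul0r.
  have -> : m * (pi / 2) = n%:R * pi + pi / 2 by rewrite /m; field.
  by rewrite cosDpihalf sin_natpi oppr0 mul0r mulr0 subrr.
have Tt : `|T t| <= (m * sin d ^+ 2)^-1 * pi.
  have cT (a b : R) : d <= a -> b <= pi - d -> {within `[a, b], continuous T}.
    move=> da bd; apply: derivable_within_continuous => y; rewrite in_itv/= => yab.
    have yd : d <= y <= pi - d by lra.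
    by have [] := ddT _ yd.
  have w0 : 0 <= (m * sin d ^+ 2)^-1 by rewrite invr_ge0 mulr_ge0 ?sqr_ge0// ltW.
  have [tp|tp] := leP t (pi / 2).
    have := @mean_value_bound _ T dT t (pi / 2) (m * sin d ^+ 2)^-1 tp.
    rewrite T0 sub0r normrN => H; apply: le_trans (H _ _ _) _.
    - by move=> y yt; apply: ddT; lra.
    - by apply: cT; lra.
    - by move=> y yt; apply: bT; lra.
    - by rewrite ler_wpM2l//; lra.
  have := @mean_value_bound _ T dT (pi / 2) t (m * sin d ^+ 2)^-1 (ltW tp).
  rewrite T0 subr0 => H; apply: le_trans (H _ _ _) _.
  - by move=> y yt; apply: ddT; lra.
  - by apply: cT; lra.
  - by move=> y yt; apply: bT; lra.
  - by rewrite ler_wpM2l//; lra.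
have -> : sawtooth_defect n t = T t + m^-1 * (cos (m * t) / sin t).
  by rewrite /T subrK.
apply: le_trans (ler_normD _ _) _.
rewrite [(pi + 1) / _]mulrDl div1r; apply: lerD; first by rewrite [pi / _]mulrC.
have st := sP _ dt; have st0 := lt_le_trans sd st.
rewrite normrM gtr0_norm ?invr_gt0// invfM ler_pM2l ?invr_gt0// normrM normfV.
rewrite [`|sin t|]gtr0_norm//; apply: (@le_trans _ _ (1 * (sin t)^-1)).
  by rewrite ler_wpM2r ?cos_max// invr_ge0 ltW.
rewrite mul1r lef_pV2 ?posrE ?exprn_gt0//; apply: le_trans st.
by rewrite expr2 ler_piMl// ltW.
Qed.

(** The removed terms are nonnegative, so near the ends of [0, pi] the defect is at most the
    parabola, which is small there. In between, the slope bound is integrated from d. An upper bound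
    is enough because the defect will be a squared distance. *)
Lemma parabola_defect_small (e : R) : 0 < e -> exists N : nat,
  forall n t, (N <= n)%N -> 0 <= t <= pi -> parabola_defect n t <= e.
Proof.
move=> e0; have pi0 := @pi_gt0 R.
pose d := Num.min (e / pi) (pi / 2).
have d0 : 0 < d by rewrite /d lt_min divr_gt0//=; lra.
have d1 : d <= pi / 2 by rewrite /d ge_min lexx orbT.
have d2 : d * pi <= e by rewrite -ler_pdivlMr// /d ge_min lexx.
have dd : 0 < d <= pi / 2 by rewrite d0.
have defect_le n t : parabola_defect n t <= t * (pi - t) / 2.
  rewrite /parabola_defect gerBl; apply: sumr_ge0 => k _.
  by rewrite divr_ge0// sqr_ge0.
have near_end n t : 0 <= t <= pi -> (t <= d) || (pi - d <= t) -> parabola_defect n t <= e / 2.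
  move=> tp td; apply: le_trans (defect_le n t) _; rewrite ler_pM2r ?invr_gt0//.
  apply: le_trans d2; case/orP: td => td.
    by apply: ler_pM; lra.
  by rewrite mulrC; apply: ler_pM; lra.
have sd : 0 < sin d by apply: sin_gt0_pi; lra.
(* Over a length of at most pi the slope bound adds K / (2n + 1), which is at most e / 2 once n > K
   / e. *)
pose K := (pi + 1) / sin d ^+ 2 * pi.
have K0 : 0 < K by rewrite /K mulr_gt0// divr_gt0 ?exprn_gt0//; lra.
exists (Num.trunc (K / e)).+1 => n t Nn tp.
have [td|] := boolP ((t <= d) || (pi - d <= t)).
  by apply: le_trans (near_end n t tp td) _; lra.
rewrite negb_or -!ltNge => /andP[dt td].
have hd : parabola_defect n d <= e / 2 by apply: near_end; lra.
suff : parabola_defect n t - parabola_defect n d <= e / 2 by lra.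
have m0 : 0 < 2 * n%:R + 1 :> R by rewrite ltr_wpDl ?mulr_ge0.
apply: (@le_trans _ _ ((pi + 1) / ((2 * n%:R + 1) * sin d ^+ 2) * (t - d))).
  apply: (@mean_value_le _ _ (sawtooth_defect n)); first exact: ltW.
  - by move=> y _; exact: is_derive_parabola_defect.
  - apply: derivable_within_continuous => y _.
    by have [] := is_derive_parabola_defect n y.
  - move=> y yd; apply: le_trans (ler_norm _) _.
    by apply: sawtooth_defect_le => //; lra.
apply: (@le_trans _ _ (K / (2 * n%:R + 1))).
  rewrite /K invfM [(2 * _ + 1)^-1 * _]mulrC !mulrA mulrAC.
  rewrite ler_pM2r ?invr_gt0// ler_wpM2l//; last by lra.
  by rewrite divr_ge0 ?sqr_ge0//; lra.
rewrite ler_pdivrMr// -mulrA mulrC -ler_pdivrMr//.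
have Kn : K / e < n%:R.
  apply: lt_le_trans (_ : (Num.trunc (K / e)).+1%:R <= _); last by rewrite ler_nat.
  exact: truncnS_gt.
apply: le_trans (ltW Kn) _.
have -> : 2^-1 * (2 * n%:R + 1) = n%:R + 2^-1 :> R by field.
by rewrite lerDl invr_ge0.
Qed.

End sawtooth.

(** * The cosine basis *)

Section cosine_basis.
Context {R : realType} (L : R).
Hypothesis L0 : 0 < L.
Notation mu := (@lebesgue_measure R).
Notation I := (oitv L).
Implicit Types (f g : R -> R) (j k n m : nat) (x : R).

Definition freq k : R := k%:R * (pi / (2 * L)).

(** Orthonormal on I: before normalization the constant mode has squared norm 2 L, the others L. *)
Definition cosf k x : R := if k is 0 then (Num.sqrt (2 * L))^-1
  else (Num.sqrt L)^-1 * cos (freq k * (x + L)).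

(** Vanishes at both ends of I. Since [sinf 0] is 0, orthonormality starts at index 1, whence the
    indices [k.+1]. *)
Definition sinf k x : R := (Num.sqrt L)^-1 * sin (freq k * (x + L)).

Lemma freq0 : freq 0 = 0. Proof. by rewrite /freq mul0r. Qed.

Lemma freq_gt0 k : 0 < freq k.+1.
Proof. by rewrite /freq mulr_gt0// divr_gt0 ?pi_gt0 ?mulr_gt0. Qed.

Lemma freq2L k : freq k * (2 * L) = k%:R * pi.
Proof. by rewrite /freq; field; rewrite gt_eqF. Qed.

Lemma sinf_right k : sinf k L = 0.
Proof.
by rewrite /sinf -mulr2n -mulr_natl freq2L sin_natpi mulr0.
Qed.

Lemma sinf_left k : sinf k (- L) = 0.
Proof. by rewrite /sinf addNr mulr0 sin0 mulr0. Qed.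

Lemma is_derive_cosf k x : is_derive x 1 (cosf k) (- (freq k * sinf k x)).
Proof.
case: k => [|k]; first by rewrite freq0 mul0r oppr0; exact: is_derive_cst.
apply: is_deriveE (is_deriveZ (Num.sqrt L)^-1 (is_derive_cosM (freq k.+1) L x)) _ _ => //.
by rewrite /sinf -[LHS]/(_ * _); ring.
Qed.

Lemma is_derive_sinf k x : is_derive x 1 (sinf k) (freq k * cosf k x).
Proof.
case: k => [|k].
  rewrite freq0 mul0r; apply: is_deriveE (is_derive_cst (0 : R) x 1) _ _ => // y.
  by rewrite /sinf freq0 mul0r sin0 mulr0.
apply: is_deriveE (is_deriveZ (Num.sqrt L)^-1 (is_derive_sinM (freq k.+1) L x)) _ _ => //.
by rewrite /cosf -[LHS]/(_ * _); ring.
Qed.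

Lemma continuous_cosf k : continuous (cosf k).
Proof. exact: continuous_is_derive (is_derive_cosf k). Qed.

Lemma continuous_sinf k : continuous (sinf k).
Proof. exact: continuous_is_derive (is_derive_sinf k). Qed.

Lemma sqint_cosf k : sqint L (cosf k).
Proof. exact/sqint_continuous/continuous_cosf. Qed.

Lemma sqint_sinf k : sqint L (sinf k).
Proof. exact/sqint_continuous/continuous_sinf. Qed.

Lemma elementary_sinf k : elementary (sinf k).
Proof. by apply: elementary_mul; [exact: elementary_cst|exact: elementary_sin]. Qed.

Lemma Rintegral_FTC (F f : R -> R) (a b : R) : a <= b ->
  (forall x, is_derive x 1 F (f x)) -> continuous f ->
  \int[mu]_(x in `]a, b[) f x = F b - F a.
Proof.
rewrite le_eqVlt => /predU1P[<- _ _|ab dF cf].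
  by rewrite set_itv_ge ?bnd_simp// Rintegral_set0 subrr.
have cF : continuous F := continuous_is_derive dF.
have cfi : {within `[a, b], continuous f} by exact: continuous_subspaceT.
have int : mu.-integrable `[a, b] (EFin \o f).
  by apply: continuous_compact_integrable => //; exact: segment_compact.
have int1 : mu.-integrable `]a, b] (EFin \o f).
  by apply: integrableS int => //; apply: subset_itvr; rewrite bnd_simp.
have int2 : mu.-integrable `]a, b[ (EFin \o f).
  by apply: integrableS int => //; exact: subset_itv_oo_cc.
rewrite Rintegral_itv_bndo_bndc// Rintegral_itv_obnd_cbnd// /Rintegral.
rewrite (@continuous_FTC2 _ f F a b ab cfi)//.
  split; first by move=> y _; have [] := dF y.
  - by apply: cvg_at_right_filter; exact: cF.
  - by apply: cvg_at_left_filter; exact: cF.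
by move=> y _; rewrite derive1E; have dy := dF y; exact: derive_val.
Qed.

Lemma Rintegral_cos m : \int[mu]_(x in I) cos (freq m * (x + L)) =
  if m is 0 then 2 * L else 0.
Proof.
have NLL : - L <= L by move: L0; lra.
case: m => [|m].
  rewrite (@eq_Rintegral _ _ _ mu I (fun=> 1)); last by move=> x _; rewrite freq0 mul0r cos0.
  rewrite (@Rintegral_FTC id (fun=> 1))//; last by move=> x; exact: cvg_cst.
  by ring.
have f0 := freq_gt0 m.
have dF x : is_derive x 1 (fun y => (freq m.+1)^-1 * sin (freq m.+1 * (y + L)))
    (cos (freq m.+1 * (x + L))).
  apply: is_deriveE (is_deriveZ (freq m.+1)^-1 (is_derive_sinM (freq m.+1) L x)) _ _ => //.
  by rewrite -[LHS]/(_ * _) mulKf ?gt_eqF.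
have cc : continuous (fun x => cos (freq m.+1 * (x + L))).
  by apply: continuous_is_derive => x; exact: is_derive_cosM.
rewrite (Rintegral_FTC NLL dF cc) -mulr2n -mulr_natl freq2L sin_natpi addNr !mulr0 sin0
  mulr0 subrr.
by [].
Qed.

Lemma freqB j k : (k <= j)%N -> freq j - freq k = freq (j - k).
Proof. by move=> kj; rewrite /freq natrB// mulrBl. Qed.

Lemma freqD j k : freq j + freq k = freq (j + k).
Proof. by rewrite /freq -mulrDl -natrD. Qed.

Lemma int_cosM k : mu.-integrable I (EFin \o (fun x => cos (freq k * (x + L)))).
Proof.
have sc : sqint L (fun x => cos (freq k * (x + L))).
  apply: sqint_continuous; apply: continuous_is_derive => x; exact: is_derive_cosM.
have := sqint_mul sc (sqint_cst L 1).
by under [X in integrable _ _ (_ \o X) -> _]eq_fun do rewrite mulr1.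
Qed.

(** In truncated subtraction, [j - k + (k - j)] is |j - k|. *)
Lemma Rintegral_coscos j k :
  \int[mu]_(x in I) (cos (freq j * (x + L)) * cos (freq k * (x + L))) =
  (\int[mu]_(x in I) cos (freq (j - k + (k - j)) * (x + L)) +
   \int[mu]_(x in I) cos (freq (j + k) * (x + L))) / 2.
Proof.
wlog kj : j k / (k <= j)%N => [H|].
  have [kj|/ltnW jk] := leqP k j; first exact: H.
  rewrite [(j - k + _)%N]addnC [(j + k)%N]addnC -H//.
  by apply: eq_Rintegral => x _; rewrite mulrC.
have -> : (k - j = 0)%N by apply/eqP; rewrite subn_eq0.
rewrite addn0 -RintegralD; try exact: int_cosM; last exact: measurable_oitv.
rewrite mulrC -RintegralZl.
- by apply: eq_Rintegral => x _; rewrite -freqB// -freqD mulrBl mulrDl cosB cosD; field.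
- exact: measurable_oitv.
- apply: integrableD_EFin; exact: int_cosM.
Qed.

Lemma Rintegral_sinsin j k :
  \int[mu]_(x in I) (sin (freq j * (x + L)) * sin (freq k * (x + L))) =
  (\int[mu]_(x in I) cos (freq (j - k + (k - j)) * (x + L)) -
   \int[mu]_(x in I) cos (freq (j + k) * (x + L))) / 2.
Proof.
wlog kj : j k / (k <= j)%N => [H|].
  have [kj|/ltnW jk] := leqP k j; first exact: H.
  rewrite [(j - k + _)%N]addnC [(j + k)%N]addnC -H//.
  by apply: eq_Rintegral => x _; rewrite mulrC.
have -> : (k - j = 0)%N by apply/eqP; rewrite subn_eq0.
rewrite addn0 -RintegralB; try exact: int_cosM; last exact: measurable_oitv.
rewrite mulrC -RintegralZl.
- by apply: eq_Rintegral => x _; rewrite -freqB// -freqD mulrBl mulrDl cosB cosD; field.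
- exact: measurable_oitv.
- have mI := measurable_oitv L.
  apply: (eq_integrable mI _ _ (fun _ _ => erefl) (integrableB mI (int_cosM _) (int_cosM _))).
Qed.

Lemma sqrt_inv_sq (a : R) : 0 < a -> (Num.sqrt a)^-1 * (Num.sqrt a)^-1 = a^-1.
Proof. by move=> a0; rewrite -invfM -expr2 sqr_sqrtr// ltW. Qed.

Lemma ip_cosf j k : ip L (cosf j) (cosf k) = (j == k)%:R.
Proof.
have Ln0 : L != 0 by rewrite gt_eqF.
have H0 k' : ip L (cosf 0) (cosf k'.+1) = 0.
  have := Rintegral_cos k'.+1; rewrite /ip /cosf => H.
  rewrite (@eq_Rintegral _ _ _ mu I (fun x => ((Num.sqrt (2 * L))^-1 * (Num.sqrt L)^-1) *
    cos (freq k'.+1 * (x + L)))); last by move=> x _; rewrite mulrA.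
  by rewrite RintegralZl ?H ?mulr0//; [exact: measurable_oitv|exact: int_cosM].
case: j k => [|j] [|k].
- rewrite eqxx /ip /cosf sqrt_inv_sq ?mulr_gt0//.
  have := Rintegral_cos 0.
  under eq_Rintegral do rewrite freq0 mul0r cos0.
  rewrite (@Rintegral_cst _ _ _ mu I (measurable_oitv L)) => H.
  rewrite (@Rintegral_cst _ _ _ mu I (measurable_oitv L)).
  by move: H; rewrite mul1r => ->; rewrite mulVf// mulf_neq0// pnatr_eq0.
- by rewrite H0.
- by rewrite ipC H0.
- rewrite /ip /cosf.
  rewrite (@eq_Rintegral _ _ _ mu I (fun x => L^-1 *
    (cos (freq j.+1 * (x + L)) * cos (freq k.+1 * (x + L))))); last first.
    by move=> x _; rewrite -sqrt_inv_sq//; ring.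
  rewrite RintegralZl; last 2 first.
  + exact: measurable_oitv.
  + apply: sqint_mul; apply: sqint_continuous; apply: continuous_is_derive => x; exact: is_derive_cosM.
  rewrite Rintegral_coscos !Rintegral_cos addSn eqSS addr0.
  have [->|jk] := eqVneq j k; first by rewrite subnn/=; field.
  have : (j.+1 - k.+1 + (k.+1 - j.+1))%N != 0%N.
    by rewrite addn_eq0 !subn_eq0 !ltnS -eqn_leq.
  by case: (j.+1 - k.+1 + (k.+1 - j.+1))%N => // p _; rewrite mul0r mulr0.
Qed.

Lemma ip_sinf j k : ip L (sinf j.+1) (sinf k.+1) = (j == k)%:R.
Proof.
have Ln0 : L != 0 by rewrite gt_eqF.
rewrite /ip /sinf.
rewrite (@eq_Rintegral _ _ _ mu I (fun x => L^-1 *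
  (sin (freq j.+1 * (x + L)) * sin (freq k.+1 * (x + L))))); last first.
  by move=> x _; rewrite -sqrt_inv_sq//; ring.
rewrite RintegralZl; last 2 first.
+ exact: measurable_oitv.
+ apply: sqint_mul; apply: sqint_continuous; apply: continuous_is_derive => x; exact: is_derive_sinM.
rewrite Rintegral_sinsin !Rintegral_cos addSn subr0.
have [->|jk] := eqVneq j k; first by rewrite subnn/=; field.
have : (j.+1 - k.+1 + (k.+1 - j.+1))%N != 0%N.
  by rewrite addn_eq0 !subn_eq0 !ltnS -eqn_leq.
by case: (j.+1 - k.+1 + (k.+1 - j.+1))%N => // p _; rewrite mul0r mulr0.
Qed.

End cosine_basis.

(** * Primitives and completeness *)

Section bessel.
Context {R : realType} (L : R).
Implicit Types (f g : R -> R).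

Definition proj (e : nat -> R -> R) n f x : R := \sum_(k < n) ip L f (e k) * e k x.

Variables (e : nat -> R -> R) (n : nat).
Hypothesis e_sqint : forall k, sqint L (e k).
Hypothesis e_orth : forall j k, ip L (e j) (e k) = (j == k)%:R.

Lemma sqint_lin (a : nat -> R) : sqint L (fun x => \sum_(k < n) a k * e k x).
Proof. by apply: (@sqint_sum _ L n (fun k x => a k * e k x)) => k; exact: sqintZ. Qed.

Lemma sqint_proj f : sqint L (proj e n f).
Proof. exact: (sqint_lin (fun k => ip L f (e k))). Qed.

Lemma ip_linl (a : nat -> R) f : sqint L f ->
  ip L (fun x => \sum_(k < n) a k * e k x) f = \sum_(k < n) a k * ip L (e k) f.
Proof.
move=> sf; rewrite (@ip_suml _ L n (fun k x => a k * e k x))//.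
  by apply: eq_bigr => k _; rewrite ipZl.
by move=> k; exact: sqintZ.
Qed.

Lemma ip_lin_coef (a : nat -> R) j : (j < n)%N ->
  ip L (fun x => \sum_(k < n) a k * e k x) (e j) = a j.
Proof.
move=> jn; rewrite ip_linl// (bigD1 (Ordinal jn))//= e_orth eqxx mulr1 big1 ?addr0//.
by move=> k kj; rewrite e_orth -val_eqE/= in kj *; rewrite (negbTE kj) mulr0.
Qed.

Lemma ip_lin (a : nat -> R) :
  ip L (fun x => \sum_(k < n) a k * e k x) (fun x => \sum_(k < n) a k * e k x) =
  \sum_(k < n) a k ^+ 2.
Proof.
rewrite ip_linl; last exact: sqint_lin.
by apply: eq_bigr => k _; rewrite ipC ip_lin_coef// expr2.
Qed.

Lemma ip_proj f g : sqint L f -> sqint L g ->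
  ip L (proj e n f) g = \sum_(k < n) ip L f (e k) * ip L g (e k).
Proof.
move=> sf sg; rewrite /proj (ip_linl (fun k => ip L f (e k)))//.
by apply: eq_bigr => k _; rewrite [ip L (e k) g]ipC.
Qed.

Lemma ip_residual f : sqint L f ->
  ip L (fun x => f x - proj e n f x) (fun x => f x - proj e n f x) =
  ip L f f - \sum_(k < n) ip L f (e k) ^+ 2.
Proof.
move=> sf; have sp := sqint_proj f.
rewrite ip_subl// (ipC L f) ip_proj// (ip_lin (fun k => ip L f (e k))).
under eq_bigr do rewrite -expr2.
by ring.
Qed.

Lemma bessel f : sqint L f -> \sum_(k < n) ip L f (e k) ^+ 2 <= ip L f f.
Proof. by move=> sf; rewrite -subr_ge0 -ip_residual// ip_ge0. Qed.

End bessel.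

(** * Primitives as scalar products with indicators *)

Section primitive.
Context {R : realType} (L : R).
Hypothesis L0 : 0 < L.
Notation mu := (@lebesgue_measure R).
Notation I := (oitv L).
Implicit Types (f g : R -> R) (n : nat) (x y : R).

Definition ray x : R -> R := \1_(`]-oo, x] : set R).

(** Integration from -L to x, written as a scalar product so that linearity, the modulus of
    continuity and approximation by projections come from [ip]. The result is defined on the whole
    line and constant on either side of I. *)
Definition prim g x : R := ip L g (ray x).

Lemma sqint_ray x : sqint L (ray x).
Proof.
have := sqint_indic (measurable_itv `]-oo, x]) (sqint_cst L 1).
by under [X in sqint _ X -> _]eq_fun do rewrite mulr1.
Qed.

Lemma rayE x y : ray x y = (y <= x)%R%:R.
Proof. by rewrite /ray indicE/= mem_setE in_itv. Qed.

Lemma primB f g x : sqint L f -> sqint L g ->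
  prim (fun y => f y - g y) x = prim f x - prim g x.
Proof. by move=> sf sg; rewrite /prim ipBl//; exact: sqint_ray. Qed.

Lemma primD f g x : sqint L f -> sqint L g ->
  prim (fun y => f y + g y) x = prim f x + prim g x.
Proof. by move=> sf sg; rewrite /prim ipDl//; exact: sqint_ray. Qed.

Lemma prim_lin (a : nat -> R) (e : nat -> R -> R) n x : (forall k, sqint L (e k)) ->
  prim (fun y => \sum_(k < n) a k * e k y) x = \sum_(k < n) a k * prim (e k) x.
Proof. by move=> se; rewrite /prim ip_linl//; exact: sqint_ray. Qed.

Lemma prim_itv g x : x <= L -> sqint L g -> prim g x = \int[mu]_(y in `]- L, x[) g y.
Proof.
move=> xL sg.
have ig : mu.-integrable I (EFin \o g).
  have := sqint_mul sg (sqint_cst L 1).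
  by under [X in integrable _ _ (_ \o X) -> _]eq_fun do rewrite mulr1.
have -> : prim g x = \int[mu]_(y in I `&` `]-oo, x]) g y.
  rewrite Rintegral_mkcondr; apply: eq_Rintegral => y _.
  by rewrite patch_indic.
move: xL; rewrite le_eqVlt => /predU1P[->|xL].
  congr Rintegral; rewrite setIidl// => y; rewrite oitvE /= in_itv/= => /andP[_ /ltW].
  exact.
have -> : I `&` `]-oo, x] = `]- L, x]%classic.
  apply/seteqP; split=> y /=; rewrite oitvE !in_itv/=.
    by move=> [/andP[-> _] ->].
  by move=> /andP[-> h]; rewrite h (le_lt_trans h).
rewrite Rintegral_itv_bndo_bndc//.
have sub : `]- L, x[%classic `<=` I.
  by move=> y /=; rewrite oitvE in_itv/= => /andP[-> h]; exact: lt_trans xL.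
have mJ : measurable (`]- L, x[%classic : set (g_sigma_algebraType R.-ocitv.-measurable)).
  exact: measurable_itv.
exact: integrableS (measurable_oitv L) mJ sub ig.
Qed.

Lemma prim_le g x : x <= - L -> prim g x = 0.
Proof.
move=> xL; rewrite /prim /ip (@eq_Rintegral _ _ _ mu I (fun=> 0)).
  by rewrite Rintegral_cst ?mul0r//; exact: measurable_oitv.
move=> y; rewrite inE => yI; rewrite rayE; move: yI; rewrite oitvE => yI.
have -> : (y <= x) = false by apply/negbTE; rewrite -ltNge; lra.
by rewrite mulr0.
Qed.

Lemma prim_ge g x : L <= x -> prim g x = prim g L.
Proof.
move=> xL; apply: eq_ip => // y; rewrite inE => yI; rewrite !rayE.
by move: yI; rewrite oitvE => yI; congr (_%:R); congr nat_of_bool; lra.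
Qed.

Lemma prim_FTC (F f : R -> R) x : (forall y, is_derive y 1 F (f y)) ->
  continuous f -> - L <= x <= L -> prim f x = F x - F (- L).
Proof.
move=> dF cf /andP[x1 x2]; rewrite prim_itv//; last exact: sqint_continuous.
exact: Rintegral_FTC.
Qed.

Lemma ip_rayB y x : y <= x ->
  ip L (fun z => ray x z - ray y z) (fun z => ray x z - ray y z) <= x - y.
Proof.
move=> yx.
have E : {in I, (fun z => (ray x z - ray y z) * (ray x z - ray y z)) =1 \1_(`]y, x] : set R)}.
  move=> z _; rewrite !rayE indicE/= mem_setE in_itv/= (ltNge y z).
  have [zx|xz] := leP z x; have [zy|yz] := leP z y; rewrite ?subrr ?subr0 ?mul0r ?mulr1//.
  by move: (lt_le_trans xz zy); rewrite ltNge yx.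
rewrite /ip (@eq_Rintegral _ _ _ mu I _ _ E) /Rintegral integral_indic; last 2 first.
- exact: measurable_oitv.
- exact: measurable_itv.
have -> : x - y = fine (mu `]y, x]).
  rewrite lebesgue_measure_itv/= lte_fin; case: ifPn => [//|].
  by rewrite -leNgt => xy; rewrite /=; lra.
apply: fine_le.
- rewrite ge0_fin_numE//; apply: le_lt_trans (_ : (mu I < +oo)%E).
    by apply: le_measure; rewrite ?inE//; [apply: measurableI => //; exact: measurable_oitv|exact: measurable_oitv].
  exact: lebesgue_oitv_lty.
- rewrite ge0_fin_numE// lebesgue_measure_itv/=; case: ifP; rewrite ?ltry//.
- by apply: le_measure; rewrite ?inE//; apply: measurableI => //; exact: measurable_oitv.
Qed.

(** Cauchy-Schwarz against the indicator of ]y, x], whose squared norm is at most x - y. *)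
Lemma prim_hoelder g x y : sqint L g ->
  (prim g x - prim g y) ^+ 2 <= `|x - y| * ip L g g.
Proof.
move=> sg; wlog yx : x y / y <= x => [H|].
  have [|/ltW xy] := leP y x; first exact: H.
  by rewrite distrC -sqrrN opprB; exact: H.
rewrite /prim -ipBr//; try exact: sqint_ray.
apply: le_trans (ip_cauchy sg (sqintB (sqint_ray x) (sqint_ray y))) _.
by rewrite mulrC ler_wpM2r ?ip_ge0// ger0_norm ?subr_ge0// ip_rayB.
Qed.

Lemma prim_sqr_le g x : sqint L g -> prim g x ^+ 2 <= 2 * L * ip L g g.
Proof.
move=> sg; have [xL|Lx] := leP x (- L).
  by rewrite prim_le// expr0n mulr_ge0 ?ip_ge0// mulr_ge0// ltW.
wlog xL : x Lx / x <= L => [H|].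
  have [|/ltW xL] := leP x L; first exact: H.
  by rewrite prim_ge//; apply: H => //; move: L0; lra.
have := prim_hoelder x (- L) sg; rewrite (@prim_le _ (- L))// subr0 => h.
apply: le_trans h _; rewrite ler_wpM2r ?ip_ge0// ger0_norm; lra.
Qed.

Lemma continuous_prim g : sqint L g -> continuous (prim g).
Proof.
move=> sg x; apply/cvgrPdist_le => e e0.
have g0 := ip_ge0 L g.
have d0 : 0 < e ^+ 2 / (ip L g g + 1) by rewrite divr_gt0 ?exprn_gt0//; lra.
near=> y.
rewrite -(@ler_pXn2r _ 2)// ?nnegrE ?(ltW e0)// real_normK ?num_real//.
apply: le_trans (prim_hoelder x y sg) _.
have : `|x - y| < e ^+ 2 / (ip L g g + 1).
  by near: y; apply/nbhs_ballP; exists (e ^+ 2 / (ip L g g + 1)).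
rewrite ltr_pdivlMr; last by lra.
move=> /ltW; apply: le_trans; rewrite ler_wpM2l//; lra.
Unshelve. all: by end_near. Qed.

Lemma sqint_prim g : sqint L g -> sqint L (prim g).
Proof. by move=> sg; apply: sqint_continuous; exact: continuous_prim. Qed.

Lemma prim_cosf0 x : - L <= x <= L -> prim (cosf L 0) x = (Num.sqrt (2 * L))^-1 * (x + L).
Proof.
move=> xL; pose c := (Num.sqrt (2 * L))^-1.
have dF y : is_derive y 1 (fun z => c * z) c.
  by apply: is_deriveE (is_deriveZ c (is_derive_id y 1)) _ _ => //; rewrite -[LHS]/(_ * _) mulr1.
rewrite (prim_FTC dF)//; first by rewrite /c; ring.
by move=> y; exact: cvg_cst.
Qed.

Lemma prim_cosfS k x : - L <= x <= L ->
  prim (cosf L k.+1) x = sinf L k.+1 x / freq L k.+1.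
Proof.
move=> xL; have f0 := freq_gt0 L0 k.
have dF y : is_derive y 1 (fun z => (freq L k.+1)^-1 * sinf L k.+1 z) (cosf L k.+1 y).
  apply: is_deriveE (is_deriveZ (freq L k.+1)^-1 (is_derive_sinf L k.+1 y)) _ _ => //.
  by rewrite -[LHS]/(_ * _) mulKf ?gt_eqF.
rewrite (prim_FTC dF)//; last exact: continuous_cosf.
by rewrite sinf_left mulr0 subr0 mulrC.
Qed.

(* The mean square distance from the indicator of [-L, x] to the span of the
   first cosines is explicit, hence [prim g] is the uniform limit of the
   primitives of the cosine polynomials of [g]. *)
Lemma ray_residual n x : - L <= x <= L ->
  ip L (ray x) (ray x) - \sum_(k < n.+1) ip L (ray x) (cosf L k) ^+ 2 =
  4 * L / pi ^+ 2 * parabola_defect n ((pi / (2 * L)) * (x + L)).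
Proof.
move=> xL; have Ln0 : L != 0 by rewrite gt_eqF.
have pn0 : pi != 0 :> R by rewrite gt_eqF// pi_gt0.
have -> : ip L (ray x) (ray x) = x + L.
  have -> : ip L (ray x) (ray x) = prim (fun=> 1) x.
    by apply: eq_Rintegral => y _; rewrite rayE; case: (_ <= _); rewrite ?mulr1 ?mulr0 ?mul1r.
  rewrite (@prim_FTC id)//; first by rewrite opprK.
  by move=> y; exact: cvg_cst.
rewrite big_ord_recl ipC -/(prim _ x) prim_cosf0//.
rewrite exprMn expr2 sqrt_inv_sq ?mulr_gt0// /parabola_defect mulrBr mulr_sumr.
rewrite opprD addrA; congr (_ - _); first by move: (pi) pn0 => q qn0; field; rewrite Ln0.
apply: eq_bigr => k _; rewrite lift0 ipC -/(prim _ x) prim_cosfS// /sinf.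
rewrite !exprMn [_^-1 ^+ 2]expr2 sqrt_inv_sq//.
have -> : freq L k.+1 * (x + L) = k.+1%:R * (pi / (2 * L) * (x + L)) by rewrite /freq -!mulrA.
rewrite /freq; move: (sin _) => s; move: (pi) pn0 => q qn0; field.
by rewrite Ln0 qn0 nat1r pnatr_eq0.
Qed.

(** The projection is self-adjoint, so it moves onto the indicator and the error is the pairing of g
    with the residual of [ray x]. Hence [N], taken from [parabola_defect_small], depends on neither
    [g] nor [x]. *)
Lemma prim_proj_cvg (eps : R) : 0 < eps -> exists N : nat,
  forall n g x, (N <= n)%N -> - L <= x <= L -> sqint L g ->
  (prim g x - prim (proj L (cosf L) n.+1 g) x) ^+ 2 <= eps * ip L g g.
Proof.
move=> e0; have pi0 := @pi_gt0 R.
have k0 : 0 < 4 * L / pi ^+ 2 by rewrite divr_gt0 ?exprn_gt0 ?mulr_gt0.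
have [N HN] := @parabola_defect_small R (eps / (4 * L / pi ^+ 2)) (divr_gt0 e0 k0).
exists N => n g x Nn xL sg.
have sr := sqint_ray x.
have sc := @sqint_cosf R L.
have -> : prim (proj L (cosf L) n.+1 g) x = ip L g (proj L (cosf L) n.+1 (ray x)).
  rewrite /prim ip_proj// (ipC L g) ip_proj//.
  by apply: eq_bigr => k _; rewrite mulrC.
have sp : sqint L (proj L (cosf L) n.+1 (ray x)) by apply: sqint_proj.
rewrite /prim -ipBr//; apply: le_trans (ip_cauchy sg (sqintB sr sp)) _.
rewrite mulrC ler_wpM2r ?ip_ge0// ip_residual//; last exact: ip_cosf.
rewrite ray_residual// mulrC -ler_pdivlMr//; apply: HN => //.
have k1 : 0 < pi / (2 * L) by rewrite divr_gt0 ?mulr_gt0.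
rewrite pmulr_rge0//; apply/andP; split; first by lra.
have piE : pi = pi / (2 * L) * (2 * L) by field; rewrite gt_eqF.
by rewrite [leRHS]piE ler_pM2l//; lra.
Qed.

End primitive.

(** * Completeness of the cosines *)

Section completeness.
Context {R : realType} (L : R).
Hypothesis L0 : 0 < L.
Notation mu := (@lebesgue_measure R).
Notation I := (oitv L).
Implicit Types (f g : R -> R) (n : nat) (x y : R).

(** A bound on the norms of L^2 approximants is inherited by the limit, by Young's inequality on the
    cross term. *)
Lemma ip_le_approx f (E : R) : sqint L f ->
  (forall e : R, 0 < e -> exists v, [/\ sqint L v, ip L v v <= E &
    ip L (fun x => f x - v x) (fun x => f x - v x) <= e]) ->
  ip L f f <= E.
Proof.
move=> sf H; apply/ler_addgt0Pr => eps e0.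
have E0 : 0 <= E.
  by have [v [_ vE _]] := H 1 ltr01; apply: le_trans vE; exact: ip_ge0.
(* The weight d in Young's inequality gives d E <= eps / 2; the accuracy e chosen next gives (1 +
   1/d) e = eps / 2. *)
pose d := eps / (2 * (E + 1)).
have d0 : 0 < d by rewrite /d divr_gt0//; lra.
pose e := eps / (2 * (1 + d^-1)).
have dV0 : 0 < d^-1 by rewrite invr_gt0.
have e0' : 0 < e by rewrite /e divr_gt0//; lra.
have [v [sv vE ve]] := H e e0'.
pose w x := f x - v x; have sw : sqint L w := sqintB sf sv.
have -> : ip L f f = ip L (fun x => v x + w x) (fun x => v x + w x).
  by apply: eq_ip => x _; rewrite /w addrC subrK.
rewrite ip_addl//.
have vw : 2 * ip L v w <= d * ip L v v + d^-1 * ip L w w.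
  have := ip_ge0 L (fun x => d * v x - w x).
  have sdv := sqintZ d sv.
  rewrite ip_subl// !ipZl// ipZr// => h.
  rewrite -(ler_pM2l d0) mulrDr mulrA [d * (d^-1 * _)]mulrA mulfV ?gt_eqF// mul1r; lra.
have h1 : d * ip L v v <= d * E by rewrite ler_pM2l.
have h2 : d^-1 * ip L w w <= d^-1 * e by rewrite ler_pM2l.
have h3 : d * E <= eps / 2.
  have -> : d * E = eps / 2 * (E / (E + 1)) by rewrite /d; field; lra.
  by apply: ler_piMr; [lra|rewrite ler_pdivrMr; lra].
have h4 : (1 + d^-1) * e = eps / 2 by rewrite /e; field; lra.
have h5 : ip L w w <= e by [].
move: vE h5; rewrite /w => vE h5; lra.
Qed.

Lemma lebesgue_oitv : (mu I = (2 * L)%:E)%E.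
Proof.
rewrite lebesgue_measure_itv/= lte_fin ifT; last by move: L0; lra.
by rewrite -EFinB; congr (_%:E); ring.
Qed.

Lemma ip_le_bound f (C : R) : sqint L f -> (forall x, I x -> `|f x| <= C) ->
  ip L f f <= 2 * L * C ^+ 2.
Proof.
move=> sf fC; have -> : 2 * L * C ^+ 2 = \int[mu]_(x in I) (C ^+ 2).
  rewrite Rintegral_cst; last exact: measurable_oitv.
  by rewrite mulrC [X in fine X](lebesgue_oitv).
apply: le_Rintegral => //.
- exact: measurable_oitv.
- exact: sqint_mul.
- have := sqint_mul (sqint_cst L C) (sqint_cst L C).
  by under [X in integrable _ _ (_ \o X) -> _]eq_fun do rewrite -expr2.
- move=> x Ix; rewrite -expr2 -[leLHS]real_normK ?num_real//.
  by rewrite lerXn2r ?nnegrE ?fC// (le_trans _ (fC _ Ix)).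
Qed.

(* On a cosine polynomial the central difference quotient of the primitive acts
   diagonally, with multipliers sin (freq h) / (freq h) of modulus at most 1. *)
Lemma central_difference_lin (a : nat -> R) n (h : R) : 0 < h ->
  exists2 s : nat -> R, forall k, s k ^+ 2 <= 1 &
  forall x, - L + h < x < L - h ->
  let P := prim L (fun y => \sum_(k < n) a k * cosf L k y) in
  (P (x + h) - P (x - h)) / (2 * h) = \sum_(k < n) (a k * s k) * cosf L k x.
Proof.
move=> h0; pose s k := if k is 0 then 1 else sin (freq L k * h) / (freq L k * h).
exists s => [k|x xh P].
  case: k => [|k]; first by rewrite expr1n.
  have fh : 0 < freq L k.+1 * h by rewrite mulr_gt0// freq_gt0.
  rewrite -[leLHS]real_normK ?num_real// expr_le1// /s normrM normfV.
  rewrite [`|freq L k.+1 * h|]gtr0_norm// ler_pdivrMr// mul1r.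
  have := @mean_value_bound _ sin cos 0 (freq L k.+1 * h) 1 (ltW fh).
  rewrite sin0 !subr0 mul1r; apply.
  - by apply: continuous_subspaceT => y; exact: continuous_sin.
  - by move=> y _; exact: cos_max.
have xp : - L <= x + h <= L by lra.
have xm : - L <= x - h <= L by lra.
rewrite /P !prim_lin; [|exact: sqint_cosf..].
rewrite -sumrB mulr_suml; apply: eq_bigr => -[k _] _ /=.
rewrite -mulrBr -!mulrA; congr (_ * _); case: k => [|k].
  rewrite !prim_cosf0// mul1r /=; field.
  by rewrite (gt_eqF h0) gt_eqF// sqrtr_gt0 mulr_gt0.
rewrite !prim_cosfS// /sinf /= -mulrBl -mulrBr.
have -> : freq L k.+1 * (x + h + L) = freq L k.+1 * (x + L) + freq L k.+1 * h by ring.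
have -> : freq L k.+1 * (x - h + L) = freq L k.+1 * (x + L) - freq L k.+1 * h by ring.
rewrite sinD sinB; have f0 := freq_gt0 L0 k.
field; rewrite ?(gt_eqF f0) ?(gt_eqF h0)//.
by rewrite gt_eqF// sqrtr_gt0.
Qed.

Let inner (h : R) : set R := `]- L + h, L - h[.

(** Restricted to the points with x - h and x + h in I, the quotient is an L^2 limit of the
    quotients of cosine polynomials of g, whose squared norms are at most the Bessel sums. *)
Lemma central_difference_le g (E h : R) : sqint L g -> 0 < h ->
  (forall n, \sum_(k < n) ip L g (cosf L k) ^+ 2 <= E) ->
  let u := fun x => \1_(inner h) x * ((prim L g (x + h) - prim L g (x - h)) / (2 * h)) in
  sqint L u /\ ip L u u <= E.
Proof.
move=> sg h0 HE u.
have cts f : sqint L f -> continuous (fun x => (prim L f (x + h) - prim L f (x - h)) / (2 * h)).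
  move=> sf x; apply: cvgM; last exact: cvg_cst.
  have cp (c : R) : continuous (fun y => prim L f (y + c)).
    move=> y; apply: (@continuous_comp _ _ _ (fun z => z + c) (prim L f)).
      by apply: cvgD; [exact: cvg_id|exact: cvg_cst].
    exact: continuous_prim.
  by apply: cvgB; exact: cp.
have mi : measurable (inner h) by exact: measurable_itv.
have su : sqint L u by apply: sqint_indic => //; apply/sqint_continuous/cts.
split=> //; apply: ip_le_approx => // e e0.
have g0 := ip_ge0 L g.
(* The primitives then differ by at most the root of eps <g, g>, the quotients by that over h, and
   over the length 2 L the squared error is at most e. *)
pose eps := e * h ^+ 2 / (2 * L * (ip L g g + 1)).
have eps0 : 0 < eps.
  by rewrite /eps divr_gt0 ?mulr_gt0 ?exprn_gt0//; lra.
have [N HN] := prim_proj_cvg L0 eps0.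
pose Q := proj L (cosf L) N.+1 g.
have sQ : sqint L Q by apply: sqint_proj; exact: sqint_cosf.
pose v x := \1_(inner h) x * ((prim L Q (x + h) - prim L Q (x - h)) / (2 * h)).
have sv : sqint L v by apply: sqint_indic => //; apply/sqint_continuous/cts.
have in_inner x : (x \in inner h) = (- L + h < x < L - h).
  by rewrite /inner mem_setE in_itv.
exists v; split => //.
- have [s s1 sE] := central_difference_lin (fun k => ip L g (cosf L k)) N.+1 h0.
  pose w x := \sum_(k < N.+1) (ip L g (cosf L k) * s k) * cosf L k x.
  have sw : sqint L w by apply: (sqint_lin (e := cosf L) N.+1 _ (fun k => ip L g (cosf L k) * s k)); exact: sqint_cosf.
  apply: le_trans (HE N.+1); apply: (@le_trans _ _ (ip L w w)); last first.
    rewrite (ip_lin _ (@sqint_cosf R L) (ip_cosf L0) (fun k => ip L g (cosf L k) * s k)).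
    apply: ler_sum => k _.
    by rewrite exprMn ler_piMr ?sqr_ge0.
  apply: le_Rintegral; [exact: measurable_oitv|exact: sqint_mul..|move=> x Ix].
  rewrite -!expr2 /v indicE in_inner; case: (boolP (- L + h < x < L - h)) => [xh|_]; last first.
    by rewrite mul0r expr0n sqr_ge0.
  by rewrite mul1r /Q (sE x xh).
- have sd : sqint L (fun x => u x - v x) := sqintB su sv.
  pose C := Num.sqrt (eps * ip L g g) / h.
  have := @ip_le_bound _ C sd; set J := ip _ _ _ => HJ.
  apply: (le_trans (HJ _)).
    move=> x _; rewrite /u /v -mulrBr indicE in_inner; case: (boolP (- L + h < x < L - h)) => [xh|_]; last first.
      by rewrite mul0r normr0 /C divr_ge0 ?sqrtr_ge0// ltW.
    rewrite mul1r -mulrBl normrM normfV [`|2 * h|]gtr0_norm ?mulr_gt0// /C.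
    rewrite -subr_ge0; set S := Num.sqrt _.
    have bnd y : - L <= y <= L -> `|prim L g y - prim L Q y| <= S.
      move=> yL; rewrite -sqrtr_sqr; apply: ler_wsqrtr; exact: HN.
    have b1 : `|prim L g (x + h) - prim L Q (x + h)| <= S by apply: bnd; lra.
    have b2 : `|prim L g (x - h) - prim L Q (x - h)| <= S by apply: bnd; lra.
    have b3 : `|prim L g (x + h) - prim L g (x - h) - (prim L Q (x + h) - prim L Q (x - h))| <= 2 * S.
      have -> : prim L g (x + h) - prim L g (x - h) - (prim L Q (x + h) - prim L Q (x - h)) =
        (prim L g (x + h) - prim L Q (x + h)) - (prim L g (x - h) - prim L Q (x - h)) by ring.
      by apply: le_trans (ler_normB _ _) _; lra.
    rewrite subr_ge0 ler_pdivrMr ?mulr_gt0//; apply: le_trans b3 _.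
    have -> : S / h * (2 * h) = 2 * S by field; rewrite gt_eqF.
    by [].
  rewrite /C expr_div_n sqr_sqrtr; last by rewrite mulr_ge0// ltW.
  have -> : 2 * L * (eps * ip L g g / h ^+ 2) = e * (ip L g g / (ip L g g + 1)).
    by rewrite /eps; field; rewrite ?gt_eqF//=; lra.
  by apply: ler_piMr; [lra|rewrite ler_pdivrMr; lra].
Qed.

Lemma prim_patch g x : prim L g x = \int[mu]_(t in `]-oo, x]) (g \_ I) t.
Proof.
rewrite -Rintegral_mkcondl Rintegral_mkcondr.
by apply: eq_Rintegral => y _; rewrite patch_indic.
Qed.

Lemma prim_derive_ae g : sqint L g ->
  {ae mu, forall x, is_derive x 1 (prim L g) ((g \_ I) x)}.
Proof.
move=> sg; have mI := measurable_oitv L.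
have ig : mu.-integrable I (EFin \o g).
  have := sqint_mul sg (sqint_cst L 1).
  by under [X in integrable _ _ (_ \o X) -> _]eq_fun do rewrite mulr1.
have iG : mu.-integrable setT (EFin \o (g \_ I)).
  by rewrite -restrict_EFin; apply/integrable_restrict => //=; rewrite setTI.
have lG : locally_integrable setT (g \_ I) by exact: integrable_locally.
have primE : (fun x => \int[mu]_(t in [set` `]-oo, x]]) (g \_ I) t)%R = prim L g.
  by apply/funext => x; rewrite prim_patch.
have int y : mu.-integrable `]-oo, y] (EFin \o (g \_ I)).
  exact: integrableS iG.
have := FTC1Ny int lG; rewrite /= primE; apply: filterS.
  exact: (ae_filter_ringOfSetsType mu).
move=> x [dx xE].
exact: (DeriveDef dx (etrans (esym (derive1E _ _)) xE)).
Qed.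

Lemma central_difference_cvg f x l : is_derive x 1 f l ->
  (f (x + n.+1%:R^-1) - f (x - n.+1%:R^-1)) / (2 * n.+1%:R^-1) @[n --> \oo] --> l.
Proof.
move=> df; apply/cvgrPdist_le => e e0.
have [d d0 Hd] := is_derive_shift0 df e0.
have hn : \forall n \near \oo, (n.+1%:R^-1 : R) < d.
  have := @cvg_harmonic R; move/cvgrPdist_lt => /(_ d d0); apply: filterS => n.
  by rewrite sub0r normrN ger0_norm ?invr_ge0.
near=> n.
have hd : (n.+1%:R^-1 : R) < d by near: n.
set h := n.+1%:R^-1 : R in hd *.
have h0 : 0 < h by rewrite invr_gt0.
have H1 := Hd h; rewrite gtr0_norm// in H1.
have H2 := Hd (- h); rewrite normrN gtr0_norm// in H2.
have {}H1 := H1 hd; have {}H2 := H2 hd.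
rewrite distrC.
have -> : (f (x + h) - f (x - h)) / (2 * h) - l =
  ((f (x + h) - f x - h * l) - (f (x - h) - f x - (- h) * l)) / (2 * h).
  by field; rewrite gt_eqF.
rewrite normrM normfV [`|2 * h|]gtr0_norm ?mulr_gt0// ler_pdivrMr ?mulr_gt0//.
by apply: le_trans (ler_normB _ _) _; lra.
Unshelve. all: by end_near. Qed.

(** The central difference quotients of [prim L g] have squared norm at most E and tend to g almost
    everywhere by Lebesgue differentiation; Fatou's lemma passes the bound to g. *)
Lemma parseval_le g (E : R) : sqint L g ->
  (forall n, \sum_(k < n) ip L g (cosf L k) ^+ 2 <= E) -> ip L g g <= E.
Proof.
move=> sg HE; have mI := measurable_oitv L.
have E0 : 0 <= E by have := HE 0%N; rewrite big_ord0.
pose h n : R := n.+1%:R^-1.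
pose u n x := \1_(inner (h n)) x *
  ((prim L g (x + h n) - prim L g (x - h n)) / (2 * h n)).
have h0 n : 0 < h n by rewrite invr_gt0.
have uE n : sqint L (u n) /\ ip L (u n) (u n) <= E := central_difference_le sg (h0 n) HE.
pose v n x : \bar R := (u n x * u n x)%:E.
have mv n : measurable_fun I (v n).
  by case: (uE n) => su _; case/integrableP: (sqint_mul su su).
have v0 n x : I x -> (0 <= v n x)%E by move=> _; rewrite lee_fin -expr2 sqr_ge0.
have cvg_ae : {ae mu, forall x, I x -> (limn_einf (v ^~ x) = (g x * g x)%:E)%E}.
  have := prim_derive_ae sg; apply: filterS.
    exact: (ae_filter_ringOfSetsType mu).
  move=> x dx Ix.
  rewrite patchE mem_set// in dx.
  have ux : u n x @[n --> \oo] --> g x.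
    have := central_difference_cvg dx; apply: cvg_trans; apply: near_eq_cvg.
    have hI : 0 < Num.min (x + L) (L - x).
      by move: Ix; rewrite oitvE lt_min => xL; apply/andP; split; lra.
    have hn : \forall n \near \oo, h n < Num.min (x + L) (L - x).
      have := @cvg_harmonic R; move/cvgrPdist_lt => /(_ _ hI); apply: filterS => n.
      by rewrite sub0r normrN ger0_norm ?invr_ge0.
    near=> n; rewrite /u indicE.
    have -> : x \in inner (h n) = true.
      rewrite /inner mem_setE in_itv/=.
      have : h n < Num.min (x + L) (L - x) by near: n.
      by rewrite lt_min => /andP[? ?]; lra.
    by rewrite mul1r.
  have vx : v n x @[n --> \oo] --> (g x * g x)%:E.
    apply: cvg_EFin; first by near=> n.
    by apply: cvgM.
  have cvx : cvg (v n x @[n --> \oo]) by apply/cvg_ex; exists (g x * g x)%:E.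
  by rewrite (is_cvg_limn_einfE cvx); exact/cvg_lim.
have igg : (\int[mu]_(x in I) (g x * g x)%:E <= E%:E)%E.
  have -> : (\int[mu]_(x in I) (g x * g x)%:E =
             \int[mu]_(x in I) limn_einf (v ^~ x))%E.
    apply: ae_eq_integral => //.
    - by case/integrableP: (sqint_mul sg sg).
    - have -> : (fun x => limn_einf (v ^~ x)) =
        (fun x => - limn_esup (fun n => - v n x))%E.
        by apply/funext => x; rewrite -limn_einfN; congr limn_einf; apply/funext => n; rewrite /comp oppeK.
      apply: measurableT_comp => //; apply: measurable_fun_limn_esup => n.
      have [su _] := uE n.
      case/integrableP: (sqint_mul (sqintZ (-1) su) su) => + _.
      by apply: eq_measurable_fun => x _ /=; rewrite mulN1r mulNr.
    - apply: filterS cvg_ae; first exact: (ae_filter_ringOfSetsType mu).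
      by move=> x H Ix; rewrite H.
  apply: le_trans (fatou mu mI mv v0) _.
  rewrite limn_einf_lim; apply: lime_le; first exact: is_cvg_einfs.
  apply: nearW => n; apply: (@le_trans _ _ (\int[mu]_(x in I) v n x)%E).
    by apply: ereal_inf_lbound; exists n => //=.
  have [su suE] := uE n; have := suE; rewrite /ip /Rintegral -lee_fin fineK//.
  exact: integrable_fin_num (sqint_mul su su).
rewrite /ip /Rintegral -lee_fin fineK//.
exact: integrable_fin_num (sqint_mul sg sg).
Unshelve. all: by end_near. Qed.

End completeness.

(** * Integration by parts *)

Section H10.
Context {R : realType} (L : R).
Hypothesis L0 : 0 < L.
Notation mu := (@lebesgue_measure R).
Notation I := (oitv L).
Implicit Types (f g m : R -> R) (n : nat) (x y : R).

Lemma ip_le_bound2 f (C : R) : sqint L f -> 0 <= C -> (forall x, I x -> f x ^+ 2 <= C) ->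
  ip L f f <= 2 * L * C.
Proof.
move=> sf C0 fC; rewrite -[C in leRHS]sqr_sqrtr//; apply: ip_le_bound => // x Ix.
by rewrite -sqrtr_sqr; apply: ler_wsqrtr; exact: fC.
Qed.

(** If every residual exceeded e, all Bessel sums would be at most <g, g> - e, against
    [parseval_le]. *)
Lemma proj_dense g (e : R) : sqint L g -> 0 < e -> exists n,
  ip L (fun x => g x - proj L (cosf L) n g x) (fun x => g x - proj L (cosf L) n g x) <= e.
Proof.
move=> sg e0; apply/not_existsP => H.
suff : ip L g g <= ip L g g - e by lra.
apply: parseval_le => // n; have /negP := H n.
by rewrite -ltNge ip_residual//; [lra|exact: sqint_cosf|exact: ip_cosf].
Qed.

Lemma prim_parts_smooth (F f psi dpsi : R -> R) :
  (forall x, is_derive x 1 F (f x)) -> continuous f ->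
  (forall x, is_derive x 1 psi (dpsi x)) -> continuous dpsi ->
  ip L (prim L f) dpsi = prim L f L * psi L - ip L f psi.
Proof.
move=> dF cf dpsi' cdpsi.
have NLL : - L <= L by move: L0; lra.
pose G x := F x - F (- L).
have dG x : is_derive x 1 G (f x).
  by apply: is_derive_eq (is_deriveB (dF x) (is_derive_cst _ _ _)) _; rewrite subr0.
have cG : continuous G := continuous_is_derive dG.
have cpsi : continuous psi := continuous_is_derive dpsi'.
have GE x : I x -> prim L f x = G x.
  by rewrite oitvE => xL; rewrite (prim_FTC dF)//; lra.
have -> : ip L (prim L f) dpsi = ip L G dpsi.
  by apply: eq_ip => // x; rewrite inE => /GE.
have -> : prim L f L = G L by rewrite (prim_FTC dF)//; lra.
have dGpsi x : is_derive x 1 (fun y => G y * psi y) (f x * psi x + G x * dpsi x).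
  apply: is_deriveE (is_deriveM (dG x) (dpsi' x)) _ _ => //.
  by rewrite -[LHS]/(G x * dpsi x + psi x * f x); ring.
have cD : continuous (fun x => f x * psi x + G x * dpsi x).
  by move=> x; apply: cvgD; apply: cvgM; [exact: cf|exact: cpsi|exact: cG|exact: cdpsi].
have := Rintegral_FTC NLL dGpsi cD.
have [sf spsi sG sdpsi] : [/\ sqint L f, sqint L psi, sqint L G & sqint L dpsi].
  by split; exact: sqint_continuous.
rewrite RintegralD; last 3 first.
- exact: measurable_oitv.
- exact: sqint_mul.
- exact: sqint_mul.
have GL0 : G (- L) = 0 by rewrite /G subrr.
by rewrite GL0 mul0r subr0 => <-; rewrite /ip [RHS]addrC addKr.
Qed.

(** The defect [D] of the identity is linear in g and bounded in the L^2 norm, and it vanishes on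
    cosine polynomials, which are smooth and dense. *)
Lemma prim_parts g (psi dpsi : R -> R) : sqint L g ->
  (forall x, is_derive x 1 psi (dpsi x)) -> continuous dpsi ->
  ip L (prim L g) dpsi = prim L g L * psi L - ip L g psi.
Proof.
move=> sg dpsi' cdpsi; have cpsi : continuous psi := continuous_is_derive dpsi'.
have spsi : sqint L psi by exact: sqint_continuous.
have sdpsi : sqint L dpsi by exact: sqint_continuous.
pose D f := ip L (prim L f) dpsi - (prim L f L * psi L - ip L f psi).
(* The 3 comes from squaring a sum of three terms, the powers of 2 L from [prim_sqr_le]. *)
pose K := 3 * (2 * L * (2 * L) * ip L dpsi dpsi + 2 * L * psi L ^+ 2 + ip L psi psi).
have L2 : 0 < 2 * L by rewrite mulr_gt0.
have K0 : 0 <= K.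
  have := ip_ge0 L dpsi; have := ip_ge0 L psi; have := sqr_ge0 (psi L) => h1 h2 h3.
  rewrite /K; apply: mulr_ge0 => //; apply: addr_ge0 => //.
  by apply: addr_ge0; repeat apply: mulr_ge0 => //; exact: ltW.
have D_le f : sqint L f -> D f ^+ 2 <= K * ip L f f.
  move=> sf; have sp := sqint_prim sf.
  have ff := ip_ge0 L f.
  have h1 : ip L (prim L f) dpsi ^+ 2 <= 2 * L * (2 * L) * ip L f f * ip L dpsi dpsi.
    apply: le_trans (ip_cauchy sp sdpsi) _; rewrite ler_wpM2r ?ip_ge0// -[leRHS]mulrA.
    apply: ip_le_bound2 => //; first by rewrite mulr_ge0// ltW.
    by move=> x _; exact: prim_sqr_le.
  have h2 : (prim L f L * psi L) ^+ 2 <= 2 * L * ip L f f * psi L ^+ 2.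
    by rewrite exprMn ler_wpM2r ?sqr_ge0// prim_sqr_le.
  have h3 : ip L f psi ^+ 2 <= ip L f f * ip L psi psi := ip_cauchy sf spsi.
  rewrite /D /K; set a := ip L (prim L f) dpsi in h1 *.
  set b := prim L f L * psi L in h2 *; set c := ip L f psi in h3 *.
  apply: (@le_trans _ _ (3 * (a ^+ 2 + b ^+ 2 + c ^+ 2))); last by lra.
  have := sqr_ge0 (a + b); have := sqr_ge0 (a - c); have := sqr_ge0 (b + c).
  rewrite !expr2; lra.
have D_proj n : D (proj L (cosf L) n g) = 0.
  pose a k := ip L g (cosf L k).
  pose F k x := if k is 0 then (Num.sqrt (2 * L))^-1 * x else (freq L k)^-1 * sinf L k x.
  have dF k x : is_derive x 1 (F k) (cosf L k x).
    case: k => [|k].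
      by apply: is_deriveE (is_deriveZ (Num.sqrt (2 * L))^-1 (is_derive_id x 1)) _ _ => //; rewrite -[LHS]/(_ * _) mulr1.
    apply: is_deriveE (is_deriveZ (freq L k.+1)^-1 (is_derive_sinf L k.+1 x)) _ _ => //.
    by rewrite -[LHS]/(_ * _) mulKf ?gt_eqF// freq_gt0.
  have dP x : is_derive x 1 (fun y => \sum_(k < n) a k * F k y) (proj L (cosf L) n g x).
    apply: (@is_derive_sumn _ n (fun k y => a k * F k y) (fun k y => a k * cosf L k y)).
  have cQ : continuous (proj L (cosf L) n g).
    apply: (@continuous_is_derive _ _ (fun x => \sum_(k < n) a k * - (freq L k * sinf L k x))) => x.
    apply: (@is_derive_sumn _ n (fun k y => a k * cosf L k y) (fun k y => a k * - (freq L k * sinf L k y))) => k.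
    exact: (is_deriveE (is_deriveZ (a k) (is_derive_cosf L k x)) (fun=> erefl) erefl).
  by rewrite /D (prim_parts_smooth dP cQ dpsi' cdpsi) subrr.
suff : D g ^+ 2 <= 0.
  by rewrite real_exprn_even_le0 ?num_real//= subr_eq0 => /eqP.
apply/ler_addgt0Pr => e e0; rewrite add0r.
have e1 : 0 < e / (K + 1) by rewrite divr_gt0//; lra.
have [n Hn] := proj_dense sg e1.
have sQ : sqint L (proj L (cosf L) n g) by apply: sqint_proj; exact: sqint_cosf.
pose r x := g x - proj L (cosf L) n g x.
have sr : sqint L r := sqintB sg sQ.
have -> : D g = D r.
  have primr x : prim L r x = prim L g x - prim L (proj L (cosf L) n g) x by exact: primB.
  have := D_proj n; rewrite /D primr ipBl//.
  have -> : ip L (prim L r) dpsi = ip L (prim L g) dpsi - ip L (prim L (proj L (cosf L) n g)) dpsi.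
    by rewrite -ipBl//; [apply: eq_ip => // x _; exact: primr|exact: sqint_prim..].
  move=> h; rewrite -[LHS]subr0 -h; ring.
apply: le_trans (D_le _ sr) _; apply: (@le_trans _ _ (K * (e / (K + 1)))).
  by rewrite ler_wpM2l.
by rewrite mulrCA ler_piMr ?(ltW e0)// ler_pdivrMr; lra.
Qed.

(** The boundary term at L vanishes with the mean of g. At k = 0, where the frequency is 0, this
    says that g has no constant mode. *)
Lemma ip_cosf_prim g k : sqint L g -> prim L g L = 0 ->
  ip L g (cosf L k) = freq L k * ip L (prim L g) (sinf L k).
Proof.
move=> sg g0; have sp := sqint_prim sg.
have cd : continuous (fun x => - (freq L k * sinf L k x)).
  by move=> x; apply: cvgN; apply: cvgM; [exact: cvg_cst|exact: continuous_sinf].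
have := prim_parts sg (is_derive_cosf L k) cd.
rewrite g0 mul0r sub0r => h; apply/eqP; rewrite -eqr_opp -h; apply/eqP.
rewrite -mulNr -ipZr//; last exact: sqint_sinf.
by apply: eq_ip => // x _; rewrite mulNr.
Qed.

(** Completeness of the sines on primitives of mean-zero functions: integrating the cosine
    polynomial of g gives exactly the sine polynomial of [prim L g], and these converge uniformly by
    [prim_proj_cvg]. *)
Lemma parseval_prim_le g (E : R) : sqint L g -> prim L g L = 0 ->
  (forall n, \sum_(k < n) ip L (prim L g) (sinf L k.+1) ^+ 2 <= E) ->
  ip L (prim L g) (prim L g) <= E.
Proof.
move=> sg g0 HE; have sp := sqint_prim sg.
apply: ip_le_approx => // e e0; have gg := ip_ge0 L g.
have eps0 : 0 < e / (2 * L * (ip L g g + 1)).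
  by rewrite divr_gt0// !mulr_gt0//; lra.
have [N HN] := prim_proj_cvg L0 eps0.
pose a k := ip L (prim L g) (sinf L k.+1).
pose v x := \sum_(k < N) a k * sinf L k.+1 x.
have ss k : sqint L (sinf L k.+1) by exact: sqint_sinf.
have sv : sqint L v by exact: (sqint_lin (e := fun k => sinf L k.+1)).
exists v; split => //.
  by rewrite /v (ip_lin (e := fun k => sinf L k.+1))// => j k; exact: ip_sinf.
apply: (@le_trans _ _ (2 * L * (e / (2 * L * (ip L g g + 1)) * ip L g g))).
  apply: ip_le_bound2 => //; first exact: sqintB.
    by rewrite mulr_ge0// ltW.
  move=> x Ix; have xL : - L <= x <= L by move: Ix; rewrite oitvE; lra.
  have := HN N g x (leqnn _) xL sg; congr (_ ^+ 2 <= _); congr (_ - _).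
  rewrite /proj (prim_lin (fun k => ip L g (cosf L k))); last exact: sqint_cosf.
  rewrite big_ord_recl [ip L g _]ip_cosf_prim// freq0 !mul0r add0r.
  apply: eq_bigr => k _; rewrite lift0 prim_cosfS// ip_cosf_prim//.
  by rewrite -/(a k); field; rewrite gt_eqF// freq_gt0.
have -> : 2 * L * (e / (2 * L * (ip L g g + 1)) * ip L g g) = e * (ip L g g / (ip L g g + 1)).
  by field; rewrite ?gt_eqF//; lra.
by apply: ler_piMr; [lra|rewrite ler_pdivrMr; lra].
Qed.

(** The oscillation of the primitive over a length of at most 1 is bounded by the norm of g. If the
    bound failed at x, the primitive would exceed its own L^2 norm on all of ]x - 1, x]; when x - 1
    <= -L, its value at x is itself such an oscillation. No power of L enters. *)
Lemma sobolev g x : sqint L g -> x <= L ->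
  `|prim L g x| <= Num.sqrt (ip L (prim L g) (prim L g)) + Num.sqrt (ip L g g).
Proof.
move=> sg xL; have sp := sqint_prim sg.
have osc y z : `|y - z| <= 1 -> `|prim L g y - prim L g z| <= Num.sqrt (ip L g g).
  move=> yz; rewrite -sqrtr_sqr; apply: ler_wsqrtr.
  by apply: le_trans (prim_hoelder y z sg) _; rewrite ler_piMl ?ip_ge0.
have [x1|x1] := leP (x - 1) (- L).
  apply: (@le_trans _ _ (Num.sqrt (ip L g g))); last by rewrite lerDr sqrtr_ge0.
  have := osc x (x - 1); rewrite (@prim_le _ L g (x - 1))// subr0; apply.
  by rewrite opprB addrCA subrr addr0 normr1.
rewrite leNgt; apply/negP => H.
set S := Num.sqrt (ip L (prim L g) _) in H.
pose a := `|prim L g x| - Num.sqrt (ip L g g).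
have Sa : S < a by rewrite /a; lra.
have S0 : 0 <= S by exact: sqrtr_ge0.
suff : a ^+ 2 <= ip L (prim L g) (prim L g).
  rewrite -[leRHS]sqr_sqrtr ?ip_ge0// -/S ler_pXn2r// ?nnegrE; lra.
pose one : R -> R := fun=> 1.
have sone : sqint L one by exact: sqint_cst.
have srr : sqint L (fun y => ray x y - ray (x - 1) y) := sqintB (sqint_ray L x) (sqint_ray L _).
have -> : a ^+ 2 = ip L (fun y => a ^+ 2 * one y) (fun y => ray x y - ray (x - 1) y).
  rewrite ipZl// ipBr//; try exact: sqint_ray.
  have c1 : continuous one by move=> y; exact: cvg_cst.
  have d1 y : is_derive y 1 id (one y) by exact: is_derive_id.
  rewrite -/(prim L one x) -/(prim L one (x - 1)) !(prim_FTC d1 c1); lra.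
apply: le_Rintegral; [exact: measurable_oitv|apply: sqint_mul => //; exact: sqintZ|exact: sqint_mul|].
move=> z _; move: (z : R) => y; rewrite /one mulr1 !rayE -expr2.
have [yx|xy] := leP y x; have [yx1|xy1] := leP y (x - 1); rewrite ?subrr ?mulr0 ?sqr_ge0//; last by lra.
rewrite subr0 mulr1 -[leRHS]real_normK ?num_real// lerXn2r ?nnegrE//; first lra.
have xy1' : `|x - y| <= 1 by rewrite ger0_norm; lra.
have h := osc _ _ xy1'.
have := ler_distD (prim L g y) (prim L g x) 0; rewrite !subr0 /a; lra.
Qed.

Lemma ray_step_sum (xs a : nat -> R) n x :
  (forall j, xs j <= xs j.+1) -> xs 0 < x <= xs n ->
  exists2 j, (j < n)%N & xs j < x <= xs j.+1 /\
    \sum_(i < n) a i * (ray (xs i.+1) x - ray (xs i) x) = a j.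
Proof.
move=> xs_incr; elim: n => [|n IH] /andP[x0 xn].
  by move: (lt_le_trans x0 xn); rewrite ltxx.
rewrite big_ord_recr/=; have [xle|xgt] := leP x (xs n).
  have [|j jn [xj sE]] := IH; first by rewrite x0.
  exists j; first exact: ltnW.
  split=> //; rewrite sE !rayE xle (le_trans xle (xs_incr n)) subrr mulr0 addr0//.
exists n => //; split; first by rewrite xgt.
rewrite !rayE xn leNgt xgt/= subr0 mulr1 big1 ?add0r// => i _.
have xs_le j k : (j <= k)%N -> xs j <= xs k.
  elim: k => [|k IHk]; first by rewrite leqn0 => /eqP->.
  by rewrite leq_eqVlt => /predU1P[->//|/IHk h]; exact: le_trans (xs_incr k).
have xi : xs i.+1 < x by apply: le_lt_trans xgt; exact: xs_le.
rewrite !rayE [x <= xs i.+1]leNgt xi/= leNgt (le_lt_trans (xs_incr i) xi)/=.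
by rewrite subrr mulr0.
Qed.

Lemma summation_by_parts (u d : nat -> R) n :
  \sum_(j < n) u j * (d j.+1 - d j) =
  u n * d n - u 0 * d 0 - \sum_(j < n) (u j.+1 - u j) * d j.+1.
Proof.
elim: n => [|n IH]; first by rewrite !big_ord0; ring.
by rewrite !big_ord_recr/= IH; ring.
Qed.

Let cut n (j : nat) : R := - L + j%:R * (2 * L / n.+1%:R).

Let cut0 n : cut n 0 = - L. Proof. by rewrite /cut mul0r addr0. Qed.

Let cut_last n : cut n n.+1 = L.
Proof. by rewrite /cut mulrC divfK ?pnatr_eq0//; ring. Qed.

Let cutS n j : cut n j.+1 = cut n j + 2 * L / n.+1%:R.
Proof. by rewrite /cut -natr1; ring. Qed.

Let cell_gt0 n : 0 < 2 * L / n.+1%:R.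
Proof. by rewrite divr_gt0// mulr_gt0. Qed.

Let cut_incr n j : cut n j <= cut n j.+1.
Proof. by rewrite cutS lerDl ltW. Qed.

Let cut_itv n j : (j <= n.+1)%N -> - L <= cut n j <= L.
Proof.
move=> jn; rewrite /cut lerDl mulr_ge0 ?(ltW (cell_gt0 n))//=.
have -> : j%:R * (2 * L / n.+1%:R) = 2 * L * (j%:R / n.+1%:R) by ring.
have : j%:R / n.+1%:R <= 1 :> R by rewrite ler_pdivrMr// mul1r ler_nat.
rewrite -(@ler_pM2l _ (2 * L) _ (j%:R / n.+1%:R)) ?mulr_gt0// mulr1.
by move: (2 * L * (j%:R / n.+1%:R)) => q; lra.
Qed.

(** The flag selects the left (false) or right (true) end of each cell: after Abel summation the
    increments of one factor meet the other factor at the right ends. *)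
Let steps n (F : R -> R) (b : bool) x : R :=
  \sum_(j < n.+1) F (cut n (b + j)) * (ray (cut n j.+1) x - ray (cut n j) x).

Let sqint_rays n (j : nat) : sqint L (fun x => ray (cut n j.+1) x - ray (cut n j) x).
Proof. by apply: sqintB; exact: sqint_ray. Qed.

Let sqint_steps n F b : sqint L (steps n F b).
Proof.
apply: (@sqint_sum _ L n.+1 (fun j x => F (cut n (b + j)) * (ray (cut n j.+1) x - ray (cut n j) x))) => j.
exact: sqintZ.
Qed.

Let ip_steps n F b f : sqint L f ->
  ip L (steps n F b) f =
  \sum_(j < n.+1) F (cut n (b + j)) * (prim L f (cut n j.+1) - prim L f (cut n j)).
Proof.
move=> sf; rewrite (@ip_suml _ L n.+1
  (fun j x => F (cut n (b + j)) * (ray (cut n j.+1) x - ray (cut n j) x)))//.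
  by apply: eq_bigr => j _; rewrite ipZl// ipC ipBr//; exact: sqint_ray.
by move=> j; exact: sqintZ.
Qed.

Let steps_approx n F b (e : R) : 0 <= e -> sqint L F ->
  (forall x y, - L <= x <= L -> - L <= y <= L -> `|x - y| <= 2 * L / n.+1%:R ->
    `|F x - F y| <= e) ->
  ip L (fun x => F x - steps n F b x) (fun x => F x - steps n F b x) <= 2 * L * e ^+ 2.
Proof.
move=> e0 sF HF; apply: ip_le_bound => //; first by apply: sqintB.
move=> x; rewrite oitvE => xL; rewrite /steps.
have [|j jn [xj ->]] := @ray_step_sum (cut n) (fun j => F (cut n (b + j))) n.+1 x (cut_incr n).
  by rewrite cut0 cut_last; lra.
apply: HF; first by lra.
  by apply: cut_itv; case: b; rewrite ?add0n ?add1n// ltnW.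
have := cutS n j; move: xj; rewrite ler_norml.
case: b; rewrite ?add1n ?add0n; move: (cut n j) (cut n j.+1) (2 * L / n.+1%:R) => c0 c1 h.
  by move=> xj cj; apply/andP; split; lra.
by move=> xj cj; apply/andP; split; lra.
Qed.

(* [G] need not be differentiable: Abel summation on a uniform subdivision only
   uses its increments. *)
Lemma ip_dominated_parts (G m dP ddP : R -> R) : sqint L G -> sqint L m ->
  (forall x y, - L <= y -> y <= x -> x <= L -> `|G x - G y| <= prim L m x - prim L m y) ->
  G (- L) = 0 -> G L = 0 ->
  (forall x, is_derive x 1 dP (ddP x)) -> continuous ddP ->
  `|ip L G ddP| <= ip L m (fun x => `|dP x|).
Proof.
move=> sG sm Gm GNL GL ddP' cddP.
have cdP : continuous dP := continuous_is_derive ddP'.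
have sddP : sqint L ddP by exact: sqint_continuous.
have sadP : sqint L (fun x => `|dP x|).
  by apply: sqint_continuous => x; apply: continuous_comp; [exact: cdP|exact: norm_continuous].
pose A := ip L m m; pose B := ip L ddP ddP.
have A0 : 0 <= A by exact: ip_ge0.
have B0 : 0 <= B by exact: ip_ge0.
have dPE x : - L <= x <= L -> prim L ddP x = dP x - dP (- L).
  by move=> xL; rewrite (prim_FTC ddP' cddP).
(* Each of the two step approximations costs one square root: over a cell of length h the primitives
   of m and ddP vary by at most the roots of h A and h B. *)
have main n : `|ip L G ddP| <= ip L m (fun x => `|dP x|) +
    2 * Num.sqrt (2 * L * (2 * L / n.+1%:R) * A * B).
  set h := 2 * L / n.+1%:R; have h0 : 0 < h := cell_gt0 n.
  have Gw x y : - L <= x <= L -> - L <= y <= L -> `|x - y| <= h -> `|G x - G y| <= Num.sqrt (h * A).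
    move=> xL yL xy; apply: (@le_trans _ _ `|prim L m x - prim L m y|).
      have [yx|/ltW yx] := leP y x.
        by apply: le_trans (Gm _ _ _ _ _) (ler_norm _) => //; lra.
      by rewrite distrC [leRHS]distrC; apply: le_trans (Gm _ _ _ _ _) (ler_norm _) => //; lra.
    rewrite -sqrtr_sqr; apply: ler_wsqrtr; apply: le_trans (prim_hoelder x y sm) _.
    by rewrite ler_wpM2r.
  have dw x y : - L <= x <= L -> - L <= y <= L -> `|x - y| <= h ->
      `| `|dP x| - `|dP y| | <= Num.sqrt (h * B).
    move=> xL yL xy; apply: le_trans (ler_dist_dist _ _) _.
    have -> : dP x - dP y = prim L ddP x - prim L ddP y by rewrite !dPE//; ring.
    rewrite -sqrtr_sqr; apply: ler_wsqrtr; apply: le_trans (prim_hoelder x y sddP) _.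
    by rewrite ler_wpM2r.
  pose S := steps n G false; pose S' := steps n (fun x => `|dP x|) true.
  have sS : sqint L S by exact: sqint_steps.
  have sS' : sqint L S' by exact: sqint_steps.
  have GS : `|ip L (fun x => G x - S x) ddP| <= Num.sqrt (2 * L * h * A * B).
    rewrite -sqrtr_sqr; apply: ler_wsqrtr.
    apply: le_trans (ip_cauchy (sqintB sG sS) sddP) _; rewrite ler_wpM2r//.
    apply: le_trans (steps_approx false (sqrtr_ge0 _) sG Gw) _.
    by rewrite sqr_sqrtr ?mulrA// mulr_ge0// ltW.
  have dS : `|ip L m (fun x => `|dP x| - S' x)| <= Num.sqrt (2 * L * h * A * B).
    rewrite -sqrtr_sqr; apply: ler_wsqrtr.
    apply: le_trans (ip_cauchy sm (sqintB sadP sS')) _.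
    apply: (@le_trans _ _ (A * (2 * L * (h * B)))).
      rewrite ler_wpM2l//; apply: le_trans (steps_approx true (sqrtr_ge0 _) sadP dw) _.
      by rewrite sqr_sqrtr// mulr_ge0// ltW.
    by rewrite le_eqVlt; apply/orP; left; apply/eqP; ring.
  have SS' : `|ip L S ddP| <= ip L m S'.
    rewrite (ipC L m) ip_steps// ip_steps//.
    have cutL j : (j < n.+2)%N -> - L <= cut n j <= L by rewrite ltnS => jn; exact: cut_itv.
    have -> : \sum_(j < n.+1) G (cut n (false + j)) * (prim L ddP (cut n j.+1) - prim L ddP (cut n j)) =
        \sum_(j < n.+1) G (cut n j) * (dP (cut n j.+1) - dP (cut n j)).
      apply: eq_bigr => j _; have jn := ltn_ord j.
      by rewrite add0n !dPE; [congr (_ * _); ring|apply: cutL; exact: ltnW|exact: cutL].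
    rewrite (summation_by_parts (fun j => G (cut n j)) (fun j => dP (cut n j))).
    rewrite cut_last cut0 GL GNL !mul0r subr0 sub0r normrN.
    apply: le_trans (ler_norm_sum _ _ _) _; apply: ler_sum => j _.
    have jn := ltn_ord j; have /andP[c1 c2] : - L <= cut n j <= L by apply: cutL; exact: ltnW.
    have /andP[c3 c4] : - L <= cut n j.+1 <= L by apply: cutL.
    by rewrite normrM mulrC add1n; apply: ler_wpM2l => //; apply: Gm.
  have e1 : ip L G ddP = ip L (fun x => G x - S x) ddP + ip L S ddP.
    by rewrite ipBl// subrK.
  have e2 : ip L m (fun x => `|dP x| - S' x) = ip L m (fun x => `|dP x|) - ip L m S'.
    by rewrite ipBr.
  rewrite e2 in dS; have := ler_normD (ip L (fun x => G x - S x) ddP) (ip L S ddP).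
  rewrite -e1; move: dS; rewrite ler_norml => /andP[dS _]; lra.
apply/ler_addgt0Pr => e e0.
pose K := 16 * L * L * A * B.
have K0 : 0 <= K by rewrite /K !mulr_ge0// ltW.
pose n := Num.trunc (K / e ^+ 2).
apply: le_trans (main n) _; rewrite lerD2l.
rewrite -(@ler_pXn2r _ 2)// ?nnegrE ?mulr_ge0 ?sqrtr_ge0 ?(ltW e0)//.
have hh : 0 <= 2 * L * (2 * L / n.+1%:R) * A * B.
  by rewrite !mulr_ge0 ?(ltW (cell_gt0 n))// ltW.
rewrite exprMn sqr_sqrtr//.
have -> : 2 ^+ 2 * (2 * L * (2 * L / n.+1%:R) * A * B) = K / n.+1%:R by rewrite /K; field; rewrite nat1r pnatr_eq0.
rewrite ler_pdivrMr// mulrC -ler_pdivrMr ?exprn_gt0//; apply: ltW; exact: truncnS_gt.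
Qed.

(** Duality with a trial function built from G: its derivative dP has the coefficients freq times a,
    so <G, ddP> = -T and dP has squared norm T. Then [ip_dominated_parts] and Cauchy-Schwarz give
    T^2 <= <m, m> T. *)
Lemma bessel_dominated (G m : R -> R) n : sqint L G -> sqint L m ->
  (forall x y, - L <= y -> y <= x -> x <= L -> `|G x - G y| <= prim L m x - prim L m y) ->
  G (- L) = 0 -> G L = 0 ->
  \sum_(k < n) (freq L k.+1 * ip L G (sinf L k.+1)) ^+ 2 <= ip L m m.
Proof.
move=> sG sm Gm GNL GL.
pose a k := ip L G (sinf L k.+1).
pose b k := a k * freq L k.+1.
pose dP x := \sum_(k < n) b k * cosf L k.+1 x.
pose ddP x := \sum_(k < n) (- (b k * freq L k.+1)) * sinf L k.+1 x.
have ddP' x : is_derive x 1 dP (ddP x).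
  apply: (@is_derive_sumn _ n (fun k y => b k * cosf L k.+1 y)
    (fun k y => - (b k * freq L k.+1) * sinf L k.+1 y)) => k.
  apply: (is_deriveE (is_deriveZ (b k) (is_derive_cosf L k.+1 x)) (fun=> erefl)).
  by rewrite -[LHS]/(_ * _); ring.
have cddP : continuous ddP.
  apply: (@continuous_is_derive _ _ (fun x => \sum_(k < n) (- (b k * freq L k.+1)) * (freq L k.+1 * cosf L k.+1 x))) => x.
  apply: (@is_derive_sumn _ n (fun k y => - (b k * freq L k.+1) * sinf L k.+1 y)
    (fun k y => - (b k * freq L k.+1) * (freq L k.+1 * cosf L k.+1 y))) => k.
  exact: (is_deriveE (is_deriveZ (- (b k * freq L k.+1)) (is_derive_sinf L k.+1 x)) (fun=> erefl)).
have ss k : sqint L (sinf L k.+1) by exact: sqint_sinf.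
have sc k : sqint L (cosf L k.+1) by exact: sqint_cosf.
have := ip_dominated_parts sG sm Gm GNL GL ddP' cddP.
set T := \sum_(k < n) _.
have T0 : 0 <= T by apply: sumr_ge0 => k _; exact: sqr_ge0.
have -> : ip L G ddP = - T.
  rewrite ipC (ip_linl (e := fun k => sinf L k.+1) n ss (fun k => - (b k * freq L k.+1)) sG).
  by rewrite -sumrN; apply: eq_bigr => k _; rewrite ipC /b /a; ring.
rewrite normrN ger0_norm// => TM.
have cdP : continuous dP := continuous_is_derive ddP'.
have sadP : sqint L (fun x => `|dP x|).
  by apply: sqint_continuous => x; apply: continuous_comp; [exact: cdP|exact: norm_continuous].
have dPT : ip L (fun x => `|dP x|) (fun x => `|dP x|) = T.
  have -> : ip L (fun x => `|dP x|) (fun x => `|dP x|) = ip L dP dP.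
    by apply: eq_Rintegral => x _; rewrite -!expr2 real_normK ?num_real.
  rewrite (ip_lin (e := fun k => cosf L k.+1) n sc _ b).
    by apply: eq_bigr => k _; rewrite /b /a mulrC.
  by move=> j k; rewrite ip_cosf.
have := ip_cauchy sm sadP; rewrite dPT => h.
have [->|Tn] := eqVneq T 0; first exact: ip_ge0.
have Tp : 0 < T by rewrite lt_neqAle eq_sym Tn.
rewrite -(ler_pM2r Tp); apply: le_trans h; rewrite -expr2 lerXn2r// ?nnegrE//.
exact: le_trans TM.
Qed.

Lemma ip_eq0_ae f : sqint L f -> ip L f f = 0 ->
  {ae mu, forall x, I x -> f x = 0}.
Proof.
move=> sf f0; have mI := measurable_oitv L.
have iff := sqint_mul sf sf.
have E0 : (\int[mu]_(x in I) `|(EFin \o (fun x => (f x * f x)%R)) x| = 0)%E.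
  transitivity (\int[mu]_(x in I) (f x * f x)%:E)%E.
    by apply: eq_integral => x _; rewrite gee0_abs// lee_fin -expr2 sqr_ge0.
  by have := fineK (integrable_fin_num mI iff); rewrite -[fine _]/(ip L f f) f0 => <-.
have := ae_eq_integral_abs mu mI (measurable_int mu iff).
move=> [+ _] => /(_ E0); apply: filterS.
by move=> x H Ix; have := H Ix; case => /eqP; rewrite mulf_eq0 orbb => /eqP.
Qed.

Lemma ip_ae f f' g : sqint L f -> sqint L f' -> sqint L g ->
  {ae mu, forall x, I x -> f x = f' x} -> ip L f g = ip L f' g.
Proof.
move=> sf sf' sg ff; rewrite /ip /Rintegral; congr fine.
apply: ae_eq_integral.
- exact: measurable_oitv.
- exact: measurable_int (sqint_mul sf sg).
- exact: measurable_int (sqint_mul sf' sg).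
- apply: filterS ff; first exact: (ae_filter_ringOfSetsType mu).
  by move=> x H Ix; rewrite H.
Qed.

End H10.

(** * Evolution of the Fourier coefficients *)

Section coefficient_evolution.
Context {R : realType}.

Lemma sum_cauchy n (x1 x2 y1 y2 : nat -> R) :
  \sum_(k < n) (x1 k * y1 k + x2 k * y2 k) <=
  Num.sqrt (\sum_(k < n) (x1 k ^+ 2 + x2 k ^+ 2)) *
  Num.sqrt (\sum_(k < n) (y1 k ^+ 2 + y2 k ^+ 2)).
Proof.
set X := \sum_(k < n) (x1 k ^+ 2 + _); set Y := \sum_(k < n) (y1 k ^+ 2 + _).
set S := \sum_(k < n) _.
have X0 : 0 <= X by apply: sumr_ge0 => k _; rewrite addr_ge0 ?sqr_ge0.
have Y0 : 0 <= Y by apply: sumr_ge0 => k _; rewrite addr_ge0 ?sqr_ge0.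
rewrite -sqrtrM//; apply: le_trans (ler_norm S) _; rewrite -sqrtr_sqr.
apply: ler_wsqrtr; apply: discriminant_le => // a.
have -> : X - 2 * a * S + a ^+ 2 * Y =
  \sum_(k < n) ((x1 k - a * y1 k) ^+ 2 + (x2 k - a * y2 k) ^+ 2).
  rewrite /X /S /Y !mulr_sumr -sumrB -big_split; apply: eq_bigr => k _ /=; ring.
by apply: sumr_ge0 => k _; rewrite addr_ge0 ?sqr_ge0.
Qed.

Lemma within_continuous_sum n (F : nat -> R -> R) (A : set R) :
  (forall k, {within A, continuous (F k)}) ->
  {within A, continuous (fun s => \sum_(k < n) F k s)}.
Proof.
move=> cF; elim: n => [|n IH].
  have -> : (fun s => \sum_(k < 0) F k s) = cst 0.
    by apply/funext => s; rewrite big_ord0.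
  by move=> x; exact: cvg_cst.
have -> : (fun s => \sum_(k < n.+1) F k s) = (fun s => \sum_(k < n) F k s + F n s).
  by apply/funext => s; rewrite big_ord_recr.
by move=> x; apply: cvgD; [exact: IH|exact: cF].
Qed.

Variables (nu T : R) (kap z1 z2 : nat -> R) (a1 a2 n1 n2 : nat -> R -> R).
Hypothesis nu0 : 0 <= nu.
Let d1 k t := kap k * a1 k t + z1 k.
Let d2 k t := kap k * a2 k t + z2 k.
Hypothesis a1_cont : forall k, {within `[0, T], continuous (a1 k)}.
Hypothesis a2_cont : forall k, {within `[0, T], continuous (a2 k)}.
Hypothesis a1_deriv : forall k t, 0 < t < T ->
  is_derive t 1 (a1 k) (nu * kap k * d2 k t - n2 k t).
Hypothesis a2_deriv : forall k t, 0 < t < T ->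
  is_derive t 1 (a2 k) (n1 k t - nu * kap k * d1 k t).

(** Background included, this is the sum that the free flow preserves: without the source each pair
    (d1 k, d2 k) rotates at speed nu kap^2. *)
Definition energy n t := \sum_(k < n) (d1 k t ^+ 2 + d2 k t ^+ 2).
Definition mass n t := \sum_(k < n) (a1 k t ^+ 2 + a2 k t ^+ 2).

Lemma energy_ge0 n t : 0 <= energy n t.
Proof. by apply: sumr_ge0 => k _; rewrite addr_ge0 ?sqr_ge0. Qed.

Lemma mass_ge0 n t : 0 <= mass n t.
Proof. by apply: sumr_ge0 => k _; rewrite addr_ge0 ?sqr_ge0. Qed.

Let is_derive_sqr2 (f g : R -> R) (t df dg : R) : is_derive t 1 f df -> is_derive t 1 g dg ->
  is_derive t 1 (fun s => f s ^+ 2 + g s ^+ 2) (2 * (f t * df + g t * dg)).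
Proof.
move=> hf hg; have := is_deriveD (is_deriveM hf hf) (is_deriveM hg hg).
move=> h; apply: (is_deriveE h) => [s|]; first by rewrite !expr2.
rewrite -[LHS]/(f t * df + f t * df + (g t * dg + g t * dg)); ring.
Qed.

Let is_derive_d (a : R -> R) (k z t da : R) : is_derive t 1 a da ->
  is_derive t 1 (fun s => k * a s + z) (k * da).
Proof.
move=> ha; apply: is_derive_eq (is_deriveD (is_deriveZ k ha) (is_derive_cst _ _ _)) _.
by rewrite addr0.
Qed.

Let energy_derive n t : 0 < t < T -> is_derive t 1 (energy n)
  (2 * \sum_(k < n) (d2 k t * (kap k * n1 k t) + d1 k t * - (kap k * n2 k t))).
Proof.
move=> tT; pose dF k s := 2 * (d2 k s * (kap k * n1 k s) + d1 k s * - (kap k * n2 k s)).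
have -> : 2 * \sum_(k < n) (d2 k t * (kap k * n1 k t) + d1 k t * - (kap k * n2 k t)) =
  \sum_(k < n) dF k t by rewrite mulr_sumr.
apply: (@is_derive_sumn _ n (fun k s => d1 k s ^+ 2 + d2 k s ^+ 2) dF) => k.
have := is_derive_sqr2 (is_derive_d (kap k) (z1 k) (a1_deriv k tT)) (is_derive_d (kap k) (z2 k) (a2_deriv k tT)).
by move=> h; apply: is_derive_eq h _; rewrite /dF -/(d1 k t) -/(d2 k t); ring.
Qed.

Let mass_derive n t : 0 < t < T -> is_derive t 1 (mass n)
  (2 * nu * \sum_(k < n) (d1 k t * z2 k + d2 k t * - z1 k) +
   2 * \sum_(k < n) (a2 k t * n1 k t + a1 k t * - n2 k t)).
Proof.
move=> tT; pose dF k s := 2 * nu * (d1 k s * z2 k + d2 k s * - z1 k) +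
  2 * (a2 k s * n1 k s + a1 k s * - n2 k s).
rewrite !mulr_sumr -big_split/=.
apply: (@is_derive_sumn _ n (fun k s => a1 k s ^+ 2 + a2 k s ^+ 2) dF) => k.
apply: is_derive_eq (is_derive_sqr2 (a1_deriv k tT) (a2_deriv k tT)) _.
by rewrite /dF /d1 /d2; ring.
Qed.

Let energy_cont n t : t <= T -> {within `[0, t], continuous (energy n)}.
Proof.
move=> tT; have sub : `[0, t]%classic `<=` `[0, T] by apply: subset_itvl; rewrite bnd_simp.
apply: (continuous_subspaceW sub); apply: (@within_continuous_sum n (fun k s => d1 k s ^+ 2 + d2 k s ^+ 2)) => k.
have c1 : {within `[0, T], continuous (d1 k)}.
  by move=> x; apply: cvgD; [apply: cvgM; [exact: cvg_cst|exact: a1_cont]|exact: cvg_cst].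
have c2 : {within `[0, T], continuous (d2 k)}.
  by move=> x; apply: cvgD; [apply: cvgM; [exact: cvg_cst|exact: a2_cont]|exact: cvg_cst].
by move=> x; apply: cvgD; apply: cvgM; [exact: c1|exact: c1|exact: c2|exact: c2].
Qed.

Let mass_cont n t : t <= T -> {within `[0, t], continuous (mass n)}.
Proof.
move=> tT; have sub : `[0, t]%classic `<=` `[0, T] by apply: subset_itvl; rewrite bnd_simp.
apply: (continuous_subspaceW sub); apply: (@within_continuous_sum n (fun k s => a1 k s ^+ 2 + a2 k s ^+ 2)) => k.
by move=> x; apply: cvgD; apply: cvgM; [exact: a1_cont|exact: a1_cont|exact: a2_cont|exact: a2_cont].
Qed.

(** The rotation cancels in the derivative, which pairs d with the source only; Cauchy-Schwarz then
    gives the hypothesis of [sqrt_growth]. *)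
Lemma energy_growth n t (b : R) : 0 <= t <= T -> 0 <= b ->
  (forall s, 0 < s < t -> \sum_(k < n) ((kap k * n1 k s) ^+ 2 + (kap k * n2 k s) ^+ 2) <= b ^+ 2) ->
  Num.sqrt (energy n t) <= Num.sqrt (energy n 0) + b * t.
Proof.
move=> /andP[t0 tT] b0 Hn.
have dE s : 0 < s < t -> is_derive s 1 (energy n)
    (2 * \sum_(k < n) (d2 k s * (kap k * n1 k s) + d1 k s * - (kap k * n2 k s))).
  by move=> st; apply: energy_derive; lra.
apply: (@sqrt_growth _ (energy n) (fun s => 2 * \sum_(k < n)
  (d2 k s * (kap k * n1 k s) + d1 k s * - (kap k * n2 k s))) t b t0 b0
  (fun s _ => energy_ge0 n s) dE (@energy_cont n t tT)) => s st.
rewrite -mulrA ler_pM2l// mulrC.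
apply: le_trans (sum_cauchy n (fun k => d2 k s) (fun k => d1 k s)
  (fun k => kap k * n1 k s) (fun k => - (kap k * n2 k s))) _.
apply: ler_pM; rewrite ?sqrtr_ge0//.
  by rewrite /energy; under eq_bigr do rewrite addrC.
apply: (@le_trans _ _ (Num.sqrt (b ^+ 2))); last by rewrite sqrtr_sqr ger0_norm.
apply: ler_wsqrtr; apply: le_trans (Hn s st).
by under eq_bigr do rewrite sqrrN.
Qed.

(** Since kap a = d - z, the free flow contributes nu (d1 z2 - d2 z1), which is controlled by the
    energy and not by the mass. Hence the energy bound e is an input, and the mass itself rather
    than its root is bounded, with M as an a priori bound in the source term. *)
Lemma mass_growth n t (al e z M : R) : 0 <= t <= T ->
  0 <= al -> 0 <= e -> 0 <= z -> 0 <= M ->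
  (forall s, 0 < s < t -> \sum_(k < n) (n1 k s ^+ 2 + n2 k s ^+ 2) <= al ^+ 2) ->
  (forall s, 0 < s < t -> energy n s <= e ^+ 2) ->
  \sum_(k < n) (z1 k ^+ 2 + z2 k ^+ 2) <= z ^+ 2 ->
  (forall s, 0 < s < t -> mass n s <= M ^+ 2) ->
  mass n t <= mass n 0 + (2 * nu * e * z + 2 * al * M) * t.
Proof.
move=> /andP[t0 tT] al0 e0 z0 M0 Hn He Hz HM.
have sqrt_le (x c : R) : 0 <= c -> x <= c ^+ 2 -> Num.sqrt x <= c.
  by move=> c0 xc; rewrite -[leRHS]ger0_norm// -sqrtr_sqr; exact: ler_wsqrtr.
have dM s : 0 < s < t -> is_derive s 1 (mass n)
  (2 * nu * \sum_(k < n) (d1 k s * z2 k + d2 k s * - z1 k) +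
   2 * \sum_(k < n) (a2 k s * n1 k s + a1 k s * - n2 k s)).
  by move=> st; apply: mass_derive; lra.
rewrite -lerBlDl -[X in _ <= _ * X]subr0.
apply: (@mean_value_le _ (mass n) (fun s =>
  2 * nu * \sum_(k < n) (d1 k s * z2 k + d2 k s * - z1 k) +
  2 * \sum_(k < n) (a2 k s * n1 k s + a1 k s * - n2 k s)) 0 t _ t0 dM (@mass_cont n t tT)) => s st; apply: lerD.
  rewrite -[leRHS]mulrA ler_wpM2l ?mulr_ge0//.
  apply: le_trans (sum_cauchy n (fun k => d1 k s) (fun k => d2 k s) z2 (fun k => - z1 k)) _.
  apply: ler_pM; rewrite ?sqrtr_ge0//; apply: sqrt_le => //; first exact: He.
  by apply: le_trans Hz; under eq_bigr do rewrite sqrrN addrC.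
rewrite -[leRHS]mulrA ler_wpM2l//.
apply: le_trans (sum_cauchy n (fun k => a2 k s) (fun k => a1 k s)
  (fun k => n1 k s) (fun k => - n2 k s)) _.
rewrite mulrC; apply: ler_pM; rewrite ?sqrtr_ge0//; apply: sqrt_le => //.
  by apply: le_trans (Hn s st); under eq_bigr do rewrite sqrrN.
by apply: le_trans (HM s st); under eq_bigr do rewrite addrC.
Qed.

(** The case of a difference of solutions: the background coefficients cancel, and the mass too is
    moved by the source alone. *)
Lemma mass_growth0 n t (al : R) : 0 <= t <= T -> 0 <= al ->
  (forall k, z1 k = 0) -> (forall k, z2 k = 0) ->
  (forall s, 0 < s < t -> \sum_(k < n) (n1 k s ^+ 2 + n2 k s ^+ 2) <= al ^+ 2) ->
  Num.sqrt (mass n t) <= Num.sqrt (mass n 0) + al * t.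
Proof.
move=> /andP[t0 tT] al0 z10 z20 Hn.
have dM s : 0 < s < t -> is_derive s 1 (mass n)
   (2 * \sum_(k < n) (a2 k s * n1 k s + a1 k s * - n2 k s)).
  move=> st; have sT : 0 < s < T by lra.
  apply: is_derive_eq (mass_derive n sT) _.
  by rewrite big1 ?mulr0 ?add0r// => k _; rewrite z10 z20 oppr0 !mulr0 addr0.
apply: (@sqrt_growth _ (mass n) (fun s => 2 * \sum_(k < n)
  (a2 k s * n1 k s + a1 k s * - n2 k s)) t al t0 al0 (fun s _ => mass_ge0 n s) dM (@mass_cont n t tT)) => s st.
rewrite -mulrA ler_pM2l//.
apply: le_trans (sum_cauchy n (fun k => a2 k s) (fun k => a1 k s)
  (fun k => n1 k s) (fun k => - n2 k s)) _.
rewrite mulrC; apply: ler_pM; rewrite ?sqrtr_ge0//.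
  apply: (@le_trans _ _ (Num.sqrt (al ^+ 2))); last by rewrite sqrtr_sqr ger0_norm.
  apply: ler_wsqrtr; apply: le_trans (Hn s st).
  by under eq_bigr do rewrite sqrrN.
by rewrite /mass; under eq_bigr do rewrite addrC.
Qed.

End coefficient_evolution.

(** * The nonlinear term *)

Section nonlinearity.
Context {R : realType}.

Lemma normc_ge0 (z : R[i]) : 0 <= normc z.
Proof. by case: z => a b; exact: sqrtr_ge0. Qed.

Lemma normcDl (z w : R[i]) : normc (z + w) <= normc z + normc w.
Proof. exact: le_normcD. Qed.

Lemma normc_distC (z w : R[i]) : normc (z - w) = normc (w - z).
Proof. by case: z w => [a b] [c d] /=; rewrite -(sqrrN (a - c)) -(sqrrN (b - d)) !opprB. Qed.

Lemma normc_dist (z w : R[i]) : `|normc z - normc w| <= normc (z - w).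
Proof.
rewrite ler_norml; apply/andP; split.
  by have := normcDl (w - z) z; rewrite subrK normc_distC; lra.
by have := normcDl (z - w) w; rewrite subrK; lra.
Qed.

Lemma Re_le_normc (z : R[i]) : `|complex.Re z| <= normc z.
Proof.
by case: z => a b /=; rewrite -sqrtr_sqr; apply: ler_wsqrtr; rewrite lerDl sqr_ge0.
Qed.

Lemma Im_le_normc (z : R[i]) : `|complex.Im z| <= normc z.
Proof.
by case: z => a b /=; rewrite -sqrtr_sqr; apply: ler_wsqrtr; rewrite lerDr sqr_ge0.
Qed.

Lemma normc_le_sum (z : R[i]) : normc z <= `|complex.Re z| + `|complex.Im z|.
Proof.
case: z => a b /=; rewrite -[leRHS]ger0_norm ?addr_ge0// -sqrtr_sqr.
apply: ler_wsqrtr; rewrite sqrrD !real_normK ?num_real//.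
by rewrite addrAC lerDl mulrn_wge0// mulr_ge0.
Qed.

Lemma normc_sqr (z : R[i]) : normc z ^+ 2 = complex.Re z ^+ 2 + complex.Im z ^+ 2.
Proof. by case: z => a b /=; rewrite sqr_sqrtr// addr_ge0 ?sqr_ge0. Qed.

Variables (F : R -> R) (rho q K : R).
Hypothesis K0 : 0 <= K.
Hypothesis q_itv : 0 <= q <= rho.
Hypothesis Fq : F q = 0.
Hypothesis F_lip : forall r s, 0 <= r <= rho -> 0 <= s <= rho ->
  `|F r - F s| <= K * `|r - s|.

Lemma factor_le (z : R[i]) : normc z <= rho -> `|F (normc z)| <= K * `|normc z - q|.
Proof.
by move=> zr; rewrite -[F (normc z)]subr0 -Fq; apply: F_lip => //; rewrite normc_ge0.
Qed.

Lemma factor_le_rho (z : R[i]) : normc z <= rho -> `|F (normc z)| <= K * rho.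
Proof.
move=> zr; apply: le_trans (factor_le zr) _; rewrite ler_wpM2l//.
have /andP[q0 qr] := q_itv; have := normc_ge0 z => z0.
by rewrite ler_norml; apply/andP; split; lra.
Qed.

(** x and y stand for the same component, real or imaginary, of z and w; only the two inequalities
    matter. The difference splits into a variation of the component, against F, and a variation of
    F, against the component. *)
Lemma nonlin_lip (z w : R[i]) (x y : R) : normc z <= rho -> normc w <= rho ->
  `|y| <= normc w -> `|x - y| <= normc (z - w) ->
  `|F (normc z) * x - F (normc w) * y| <= 2 * K * rho * normc (z - w).
Proof.
move=> zr wr yw xy.
have -> : F (normc z) * x - F (normc w) * y =
  F (normc z) * (x - y) + (F (normc z) - F (normc w)) * y by ring.
apply: le_trans (ler_normD _ _) _; rewrite !normrM.
have -> : 2 * K * rho * normc (z - w) = K * rho * normc (z - w) + K * normc (z - w) * rho by ring.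
apply: lerD; apply: ler_pM => //.
- exact: factor_le_rho.
- apply: le_trans (F_lip _ _) _; rewrite ?normc_ge0//.
  by rewrite ler_wpM2l// normc_dist.
- exact: le_trans wr.
Qed.

Variable (L : R).
Hypothesis L0 : 0 < L.
Notation I := (oitv L).

Variables (f1 f2 D1 D2 : R -> R).
Hypothesis sD1 : sqint L D1.
Hypothesis sD2 : sqint L D2.
Hypothesis f1E : forall x y, f1 x - f1 y = prim L D1 x - prim L D1 y.
Hypothesis f2E : forall x y, f2 x - f2 y = prim L D2 x - prim L D2 y.
Hypothesis f_le : forall x, - L <= x <= L -> normc (f1 x +i* f2 x) <= rho.
Hypothesis f_left : normc (f1 (- L) +i* f2 (- L)) = q.
Hypothesis f_right : normc (f1 L +i* f2 L) = q.

(** With f equal to f1 or f2 this is the real or imaginary part of the nonlinear term, so both are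
    treated at once. *)
Definition nonlin (f : R -> R) x := F (normc (f1 x +i* f2 x)) * f x.

Lemma sqint_norm (f : R -> R) : sqint L f -> sqint L (fun x => `|f x|).
Proof.
move=> [mf f2']; split; first exact: measurableT_comp.
by under [X in integrable _ _ (_ \o X)]eq_fun do rewrite real_normK ?num_real//.
Qed.

Lemma ip_norm (f : R -> R) : ip L (fun x => `|f x|) (fun x => `|f x|) = ip L f f.
Proof. by apply: eq_Rintegral => x _; rewrite -!expr2 real_normK ?num_real. Qed.

Lemma le_ip (f g h : R -> R) : sqint L f -> sqint L g -> sqint L h ->
  (forall x, I x -> f x <= g x) -> (forall x, I x -> 0 <= h x) ->
  ip L f h <= ip L g h.
Proof.
move=> sf sg sh fg h0; apply: le_Rintegral; [exact: measurable_oitv|exact: sqint_mul..|].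
by move=> x Ix; apply: ler_wpM2r; [exact: h0|exact: fg].
Qed.

Lemma le_ip_sqr (f g : R -> R) : sqint L f -> sqint L g ->
  (forall x, I x -> `|f x| <= `|g x|) -> ip L f f <= ip L g g.
Proof.
move=> sf sg fg; apply: le_Rintegral; [exact: measurable_oitv|exact: sqint_mul..|].
move=> x Ix; rewrite -!expr2 -[leLHS]real_normK ?num_real// -[leRHS]real_normK ?num_real//.
by rewrite lerXn2r ?nnegrE// fg.
Qed.

Lemma prim_dist_le (f : R -> R) x y : sqint L f -> y <= x ->
  `|prim L f x - prim L f y| <= prim L (fun z => `|f z|) x - prim L (fun z => `|f z|) y.
Proof.
move=> sf yx; have sn := sqint_norm sf.
have sr := sqintB (sqint_ray L x) (sqint_ray L y).
have r0 z : 0 <= ray x z - ray y z.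
  rewrite !rayE; have [zx|] := leP z x; have [zy|yz] := leP z y; rewrite ?subrr// ?subr0// ?ler01//.
  by move=> xz; move: (le_lt_trans zy (le_lt_trans yx xz)); rewrite ltxx.
rewrite /prim -!ipBr//; try exact: sqint_ray.
rewrite ler_norml; apply/andP; split.
  have -> : - ip L (fun z => `|f z|) (fun z => ray x z - ray y z) =
     ip L (fun z => -1 * `|f z|) (fun z => ray x z - ray y z) by rewrite ipZl// mulN1r.
  apply: le_ip => //; first exact: sqintZ.
  by move=> z _; rewrite mulN1r lerNl -normrN ler_norm.
by apply: le_ip => // z _; exact: ler_norm.
Qed.

(** Formal bound of the derivative of the nonlinear term: K rho comes once from the size of F and
    once from its variation times the size of the profile. Its primitive controls the increments of
    [nonlin]. *)
Definition dominant x := 2 * K * rho * (`|D1 x| + `|D2 x|).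

Lemma sqint_dominant : sqint L dominant.
Proof. by apply: sqintZ; apply: sqintD; exact: sqint_norm. Qed.

Lemma ip_add_le (f g : R -> R) : sqint L f -> sqint L g ->
  ip L (fun x => f x + g x) (fun x => f x + g x) <= 2 * (ip L f f + ip L g g).
Proof.
move=> sf sg; have := ip_ge0 L (fun x => f x - g x).
by rewrite ip_subl// ip_addl//; lra.
Qed.

Lemma ip_dominant : ip L dominant dominant <= 8 * (K * rho) ^+ 2 * (ip L D1 D1 + ip L D2 D2).
Proof.
have [s1 s2] := (sqint_norm sD1, sqint_norm sD2).
have s12 := sqintD s1 s2.
rewrite /dominant (ipZl _ s12 (sqintZ _ s12)) (ipZr _ s12 s12).
have := ip_add_le s1 s2; rewrite !ip_norm.
move: (ip L (fun x => `|D1 x| + _) _) => X h.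
have -> : 2 * K * rho * (2 * K * rho * X) = 4 * (K * rho) ^+ 2 * X by ring.
have -> : 8 * (K * rho) ^+ 2 * (ip L D1 D1 + ip L D2 D2) =
  4 * (K * rho) ^+ 2 * (2 * (ip L D1 D1 + ip L D2 D2)) by ring.
by rewrite ler_wpM2l// mulr_ge0// sqr_ge0.
Qed.

Variables (f : R -> R).
Hypothesis f_sub : (forall x, f x = f1 x) \/ (forall x, f x = f2 x).

Let f_le_normc x : `|f x| <= normc (f1 x +i* f2 x).
Proof.
case: f_sub => ->; first exact: (Re_le_normc (f1 x +i* f2 x)).
exact: (Im_le_normc (f1 x +i* f2 x)).
Qed.

Let fB_le_normc x y : `|f x - f y| <= normc ((f1 x +i* f2 x) - (f1 y +i* f2 y)).
Proof.
case: f_sub => fE; rewrite !fE; first exact: (Re_le_normc ((f1 x +i* f2 x) - (f1 y +i* f2 y))).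
exact: (Im_le_normc ((f1 x +i* f2 x) - (f1 y +i* f2 y))).
Qed.

Let rho0 : 0 <= rho. Proof. by case/andP: q_itv; exact: le_trans. Qed.

Lemma nonlin_dominated x y : - L <= y -> y <= x -> x <= L ->
  `|nonlin f x - nonlin f y| <= prim L dominant x - prim L dominant y.
Proof.
move=> yL yx xL.
apply: le_trans (nonlin_lip _ _ (f_le_normc y) (fB_le_normc x y)) _; try by apply: f_le; lra.
have [s1 s2] := (sqint_norm sD1, sqint_norm sD2).
have primE z : prim L dominant z =
    2 * K * rho * (prim L (fun u => `|D1 u|) z + prim L (fun u => `|D2 u|) z).
  by rewrite -primD// /prim ipZl//; [exact: sqintD|exact: sqint_ray].
rewrite !primE -mulrBr ler_wpM2l ?mulr_ge0//.
apply: le_trans (normc_le_sum _) _; rewrite /= f1E f2E.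
have := prim_dist_le sD1 yx; have := prim_dist_le sD2 yx; lra.
Qed.

Lemma nonlin_left : nonlin f (- L) = 0.
Proof. by rewrite /nonlin f_left Fq mul0r. Qed.

Lemma nonlin_right : nonlin f L = 0.
Proof. by rewrite /nonlin f_right Fq mul0r. Qed.

Lemma nonlin_bounded x : I x -> `|nonlin f x| <= K * rho * rho.
Proof.
rewrite oitvE => xL; rewrite /nonlin normrM; have xL' : - L <= x <= L by lra.
apply: ler_pM => //; first exact: factor_le_rho (f_le xL').
exact: le_trans (f_le_normc x) (f_le xL').
Qed.

(** Continuity on I, hence measurability, follows from domination of the increments by the
    continuous primitive of [dominant]. *)
Lemma sqint_nonlin : sqint L (nonlin f).
Proof.
apply: (sqint_bounded _ nonlin_bounded).
apply: open_continuous_measurable_fun; first exact: interval_open.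
move=> x; rewrite inE => Ix; apply/cvgrPdist_le => e e0.
have cd := continuous_prim sqint_dominant.
have /cvgrPdist_le/(_ e e0) := cd x.
have nI : \forall y \near x, I y.
  by apply: open_nbhs_nbhs; split => //; exact: interval_open.
move=> nd; near=> y.
have Iy : I y by near: y.
have dy : `|prim L dominant x - prim L dominant y| <= e by near: y.
apply: le_trans dy; move: Ix Iy; rewrite !oitvE => xL yL.
have [yx|/ltW xy] := leP y x.
  by apply: le_trans (nonlin_dominated _ yx _) (ler_norm _); lra.
by rewrite distrC [leRHS]distrC; apply: le_trans (nonlin_dominated _ xy _) (ler_norm _); lra.
Unshelve. all: by end_near. Qed.

Lemma nonlin_bessel n :
  \sum_(k < n) (freq L k.+1 * ip L (nonlin f) (sinf L k.+1)) ^+ 2 <=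
  8 * (K * rho) ^+ 2 * (ip L D1 D1 + ip L D2 D2).
Proof.
apply: le_trans ip_dominant; apply: bessel_dominated => //.
- exact: sqint_nonlin.
- exact: sqint_dominant.
- exact: nonlin_dominated.
- exact: nonlin_left.
- exact: nonlin_right.
Qed.

(** Since F vanishes at q, the factor is at most K times the distance of the modulus to q, which is
    small in L^2. A sup bound on both factors would cost the length of I. *)
Lemma nonlin_sqr (b : R -> R) : sqint L b ->
  (forall x, I x -> `|normc (f1 x +i* f2 x) - q| <= `|b x|) ->
  ip L (nonlin f) (nonlin f) <= (K * rho) ^+ 2 * ip L b b.
Proof.
move=> sb fb; have sb' := sqintZ (K * rho) sb.
have -> : (K * rho) ^+ 2 * ip L b b = ip L (fun x => K * rho * b x) (fun x => K * rho * b x).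
  by rewrite ipZl// ipZr//; ring.
apply: le_ip_sqr => //; first exact: sqint_nonlin.
move=> x Ix; have xL : - L <= x <= L by move: Ix; rewrite oitvE; lra.
rewrite /nonlin normrM [leRHS]normrM [`|K * rho|]ger0_norm ?mulr_ge0//.
have -> : K * rho * `|b x| = K * `|b x| * rho by ring.
apply: ler_pM => //; last exact: le_trans (f_le_normc x) (f_le xL).
apply: le_trans (factor_le (f_le xL)) _; rewrite ler_wpM2l//; exact: fb.
Qed.

End nonlinearity.

(** * A priori bounds *)

Lemma primE {R : realType} (L : R) (g : R -> R) x : prim L g x = ip L g (ray x).
Proof. by []. Qed.

Lemma ipE {R : realType} (L : R) (f g : R -> R) :
  ip L f g = \int[lebesgue_measure]_(x in oitv L) (f x * g x).
Proof. by []. Qed.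

Local Opaque ip prim.

Section reduced_system.
Context {R : realType}.
Implicit Types (L T nu q zb ze be K rho m : R) (F : R -> R).

(* [g] stands for the derivative of [prim L g], whose squared H^1 norm this is. *)
Definition h1sq L (g : R -> R) : R := ip L g g + ip L (prim L g) (prim L g).

(** One component of phi + zeta: c and dz describe the background, g is the derivative of the
    solution. *)
Definition profile L (c : R) (dz g : R -> R) x : R := c + prim L dz x + prim L g x.

Definition lipschitz_upto F K rho := forall r s, 0 <= r <= rho -> 0 <= s <= rho ->
  `|F r - F s| <= K * `|r - s|.

(** The background is (c1, c2) plus the primitives of dz1 and dz2, so c1 and c2 are its values at
    -L. [zb] bounds its modulus, [ze] the norm of its derivative and [be] the norm of b, which
    dominates the distance of its modulus to q. *)
Record background_data L q zb ze be (c1 c2 : R) (dz1 dz2 b : R -> R) : Prop := BackgroundData {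
  bg_dz1 : sqint L dz1;
  bg_dz2 : sqint L dz2;
  bg_b : sqint L b;
  bg_q : 0 <= q <= zb;
  bg_ze : 0 <= ze;
  bg_be : 0 <= be;
  bg_left : normc (c1 +i* c2) = q;
  bg_right : normc ((c1 + prim L dz1 L) +i* (c2 + prim L dz2 L)) = q;
  bg_sup : forall x, - L <= x <= L ->
    normc ((c1 + prim L dz1 x) +i* (c2 + prim L dz2 x)) <= zb;
  bg_dist : forall x, oitv L x ->
    `|normc ((c1 + prim L dz1 x) +i* (c2 + prim L dz2 x)) - q| <= `|b x|;
  bg_dz_le : ip L dz1 dz1 + ip L dz2 dz2 <= ze ^+ 2;
  bg_b_le : ip L b b <= be ^+ 2 }.

(* Real form of the initial-boundary value problem: [G1 t], [G2 t] are the space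
   derivatives of the real and imaginary parts of the solution at time [t], and
   the equation is tested against the sine functions. *)
Record reduced_solution L T nu F (c1 c2 : R) (dz1 dz2 : R -> R)
    (G1 G2 : R -> R -> R) : Prop := ReducedSolution {
  red_sqint1 : forall t, 0 <= t <= T -> sqint L (G1 t);
  red_sqint2 : forall t, 0 <= t <= T -> sqint L (G2 t);
  red_end1 : forall t, 0 <= t <= T -> prim L (G1 t) L = 0;
  red_end2 : forall t, 0 <= t <= T -> prim L (G2 t) L = 0;
  red_cont1 : forall t, 0 <= t <= T -> forall e : R, 0 < e -> exists2 d, 0 < d &
    forall s, 0 <= s <= T -> `|s - t| < d -> h1sq L (fun x => G1 s x - G1 t x) <= e;
  red_cont2 : forall t, 0 <= t <= T -> forall e : R, 0 < e -> exists2 d, 0 < d &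
    forall s, 0 <= s <= T -> `|s - t| < d -> h1sq L (fun x => G2 s x - G2 t x) <= e;
  red_eq1 : forall k t, 0 < t < T ->
    let f1 := profile L c1 dz1 (G1 t) in let f2 := profile L c2 dz2 (G2 t) in
    is_derive t 1 (fun s => ip L (prim L (G1 s)) (sinf L k.+1))
     (nu * freq L k.+1 * ip L (fun x => dz2 x + G2 t x) (cosf L k.+1)
      - ip L (nonlin F f1 f2 f2) (sinf L k.+1));
  red_eq2 : forall k t, 0 < t < T ->
    let f1 := profile L c1 dz1 (G1 t) in let f2 := profile L c2 dz2 (G2 t) in
    is_derive t 1 (fun s => ip L (prim L (G2 s)) (sinf L k.+1))
     (ip L (nonlin F f1 f2 f1) (sinf L k.+1)
      - nu * freq L k.+1 * ip L (fun x => dz1 x + G1 t x) (cosf L k.+1)) }.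

Lemma h1sq_ge0 L g : 0 <= h1sq L g.
Proof. by rewrite addr_ge0 ?ip_ge0. Qed.

Lemma sqr_le_of_le (a b : R) : 0 <= b -> a <= b ^+ 2 -> Num.sqrt a <= b.
Proof. by move=> b0 ab; rewrite -[leRHS]ger0_norm// -sqrtr_sqr; exact: ler_wsqrtr. Qed.

Lemma sqrt_le_sqr (x y : R) : 0 <= x -> Num.sqrt x <= y -> x <= y ^+ 2.
Proof.
move=> x0 xy; rewrite -[leLHS]sqr_sqrtr// lerXn2r ?nnegrE ?sqrtr_ge0//.
exact: le_trans (sqrtr_ge0 _) xy.
Qed.

Lemma ip_add3_le L (f g h : R -> R) : sqint L f -> sqint L g -> sqint L h ->
  ip L (fun x => f x + (g x + h x)) (fun x => f x + (g x + h x)) <=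
  3 * (ip L f f + (ip L g g + ip L h h)).
Proof.
move=> sf sg sh; have sgh := sqintD sg sh; rewrite ip_addl// ip_addl// ipDr//.
have := ip_ge0 L (fun x => f x - g x); rewrite ip_subl//.
have := ip_ge0 L (fun x => f x - h x); rewrite ip_subl//.
have := ip_ge0 L (fun x => g x - h x); rewrite ip_subl//.
move: (ip L f f) (ip L g g) (ip L h h) (ip L f g) (ip L f h) (ip L g h) => *; lra.
Qed.

Lemma dist_add_le (x y x' y' : R) : `|x + y - (x' + y')| <= `|x - x'| + `|y - y'|.
Proof. by rewrite opprD addrACA ler_normD. Qed.

Lemma sum_quarters (e : R) : e / 4 + e / 4 + (e / 4 + e / 4) = e.
Proof. by field. Qed.

Lemma sum_halves (x y : R) : 2 * x + 2 * x + (y + y) <= 4 * x + 2 * y.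
Proof. lra. Qed.

Lemma sqrD_scale (a b x y : R) : 0 <= a -> a <= b -> 0 <= x -> 0 <= y ->
  a * (x ^+ 2 + y ^+ 2) <= b * (x + y) ^+ 2.
Proof.
move=> a0 ab x0 y0; apply: ler_pM => //; first exact: addr_ge0 (sqr_ge0 _) (sqr_ge0 _).
have := mulr_ge0 x0 y0; rewrite !expr2; lra.
Qed.

Lemma itv_widen (a b T : R) : 0 < a < b -> 0 <= b <= T -> 0 <= a <= T.
Proof. by move=> /andP[/ltW-> /ltW ab] /andP[_ /(le_trans ab)]. Qed.

(** * Bounds of the source at a fixed time *)

Section fixed_time.
Variables (L q zb ze be : R) (c1 c2 : R) (dz1 dz2 b : R -> R).
Hypothesis L0 : 0 < L.
Hypothesis bg : background_data L q zb ze be c1 c2 dz1 dz2 b.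
Variables (g1 g2 : R -> R) (m K : R) (F : R -> R).
Hypothesis sg1 : sqint L g1.
Hypothesis sg2 : sqint L g2.
Hypothesis g1L : prim L g1 L = 0.
Hypothesis g2L : prim L g2 L = 0.
Hypothesis m0 : 0 <= m.
Hypothesis K0 : 0 <= K.
Hypothesis g_le : h1sq L g1 + h1sq L g2 <= m ^+ 2.
(** Sobolev bounds each component of the solution by 2 m, hence its modulus by 4 m. *)
Let rho := zb + 4 * m.
Hypothesis Fq : F q = 0.
Hypothesis F_lip : lipschitz_upto F K rho.
Let f1 := profile L c1 dz1 g1.
Let f2 := profile L c2 dz2 g2.

Lemma prim_le_h1 g x : sqint L g -> h1sq L g <= m ^+ 2 -> x <= L -> `|prim L g x| <= 2 * m.
Proof.
move=> sg gm xL; apply: le_trans (sobolev sg xL) _.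
have := ip_ge0 L g; have := ip_ge0 L (prim L g); rewrite /h1sq in gm => h1 h2.
have : Num.sqrt (ip L g g) <= m by apply: sqr_le_of_le => //; move: m0; lra.
have : Num.sqrt (ip L (prim L g) (prim L g)) <= m by apply: sqr_le_of_le => //; move: m0; lra.
lra.
Qed.

Let h1g1 : h1sq L g1 <= m ^+ 2. Proof. by apply: le_trans g_le; rewrite lerDl h1sq_ge0. Qed.
Let h1g2 : h1sq L g2 <= m ^+ 2. Proof. by apply: le_trans g_le; rewrite lerDr h1sq_ge0. Qed.

Let z x := (c1 + prim L dz1 x) +i* (c2 + prim L dz2 x).
Let w x := prim L g1 x +i* prim L g2 x.
Let fE x : f1 x +i* f2 x = z x + w x. Proof. by []. Qed.

Lemma profile_le x : - L <= x <= L -> normc (f1 x +i* f2 x) <= rho.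
Proof.
move=> xL; rewrite fE; apply: le_trans (normcDl _ _) _; rewrite /rho.
have := bg_sup bg xL; have := normc_le_sum (w x) => /=.
have xL' : x <= L by case/andP: xL.
have := prim_le_h1 sg1 h1g1 xL'; have := prim_le_h1 sg2 h1g2 xL'; rewrite /z /w; lra.
Qed.

Let D1 x := dz1 x + g1 x.
Let D2 x := dz2 x + g2 x.

(** The constant 16 is 8 from [nonlin_bessel] times 2 for splitting the derivative into dz + g. The
    constant 3 comes from bounding the distance to q by three terms: b and the two components of the
    solution. *)
Lemma nonlin_fixed (f : R -> R) n : (forall x, f x = f1 x) \/ (forall x, f x = f2 x) ->
  [/\ sqint L (nonlin F f1 f2 f),
  \sum_(k < n) (freq L k.+1 * ip L (nonlin F f1 f2 f) (sinf L k.+1)) ^+ 2 <=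
    16 * (K * rho) ^+ 2 * (ze ^+ 2 + m ^+ 2) &
  \sum_(k < n) ip L (nonlin F f1 f2 f) (sinf L k.+1) ^+ 2 <=
    3 * (K * rho) ^+ 2 * (be ^+ 2 + m ^+ 2)].
Proof.
move=> f_sub.
have [[sdz1 sdz2] sb] := (bg_dz1 bg, bg_dz2 bg, bg_b bg).
have sD1 : sqint L D1 := sqintD sdz1 sg1.
have sD2 : sqint L D2 := sqintD sdz2 sg2.
have f1E x y : f1 x - f1 y = prim L D1 x - prim L D1 y.
  by rewrite /f1 /profile /D1 !primD//; ring.
have f2E x y : f2 x - f2 y = prim L D2 x - prim L D2 y.
  by rewrite /f2 /profile /D2 !primD//; ring.
have q_itv : 0 <= q <= rho by have := bg_q bg; rewrite /rho; move: m0; lra.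
have f_left : normc (f1 (- L) +i* f2 (- L)) = q.
  by rewrite /f1 /f2 /profile !prim_le// !addr0; exact: bg_left bg.
have f_right : normc (f1 L +i* f2 L) = q.
  by rewrite /f1 /f2 /profile g1L g2L !addr0; exact: bg_right bg.
have sN := sqint_nonlin K0 q_itv Fq F_lip sD1 sD2 f1E f2E profile_le f_sub.
split => //.
  apply: le_trans (nonlin_bessel K0 q_itv Fq F_lip L0 sD1 sD2 f1E f2E profile_le f_left f_right f_sub n) _.
  have h1 := ip_add_le sdz1 sg1; have h2 := ip_add_le sdz2 sg2.
  have h3 := bg_dz_le bg; have := g_le; rewrite /h1sq => h4.
  have h5 := ip_ge0 L (prim L g1); have h6 := ip_ge0 L (prim L g2).
  have -> : 16 * (K * rho) ^+ 2 * (ze ^+ 2 + m ^+ 2) =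
    8 * (K * rho) ^+ 2 * (2 * (ze ^+ 2 + m ^+ 2)) by ring.
  apply: ler_wpM2l; first by apply: mulr_ge0 => //; exact: sqr_ge0.
  apply: le_trans (lerD h1 h2) _; move: h3 h4 h5 h6.
  move: (ip L g1 g1) (ip L g2 g2) (ip L _ _) (ip L _ _) (ip L dz1 dz1) (ip L dz2 dz2) => *; lra.
have := @bessel _ L (fun k => sinf L k.+1) n (fun k => sqint_sinf L k.+1) (ip_sinf L0) _ sN.
move=> h; apply: le_trans h _.
have [sw1 sw2] := (sqint_prim sg1, sqint_prim sg2).
have [[nb nw1] nw2] := (sqint_norm sb, sqint_norm sw1, sqint_norm sw2).
have sww := sqintD nw1 nw2.
pose b' x := `|b x| + (`|prim L g1 x| + `|prim L g2 x|).
have sb' : sqint L b' := sqintD nb sww.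
apply: le_trans (nonlin_sqr K0 q_itv Fq F_lip sD1 sD2 f1E f2E profile_le f_sub sb' _) _.
  move=> x Ix; rewrite [leRHS]ger0_norm ?addr_ge0//.
  have := bg_dist bg Ix; have := normc_dist (z x + w x) (z x).
  rewrite addrAC subrr add0r -fE -/(z x); have := normc_le_sum (w x) => /= hw hd hb.
  have := ler_distD (normc (z x)) (normc (f1 x +i* f2 x)) q; rewrite /b'; lra.
have -> : 3 * (K * rho) ^+ 2 * (be ^+ 2 + m ^+ 2) = (K * rho) ^+ 2 * (3 * (be ^+ 2 + m ^+ 2)) by ring.
rewrite ler_wpM2l ?sqr_ge0//.
apply: le_trans (ip_add3_le nb nw1 nw2) _; rewrite !ip_norm ler_pM2l//.
apply: le_trans (lerD (bg_b_le bg) (le_refl _)) _; rewrite lerD2l.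
by apply: le_trans g_le; apply: lerD; rewrite lerDr ip_ge0.
Qed.

End fixed_time.

(** * Evolution in time and the a priori step *)

Section evolution.
Variables (L T nu q zb ze be : R) (c1 c2 : R) (dz1 dz2 b : R -> R).
Hypothesis L0 : 0 < L.
Hypothesis T0 : 0 < T.
Hypothesis nu0 : 0 <= nu.
Hypothesis bg : background_data L q zb ze be c1 c2 dz1 dz2 b.
Variables (F : R -> R) (G1 G2 : R -> R -> R).
Hypothesis sol : reduced_solution L T nu F c1 c2 dz1 dz2 G1 G2.

Definition sol_size L (G1 G2 : R -> R -> R) t := h1sq L (G1 t) + h1sq L (G2 t).

Lemma ip_diff_sqr (u v : R -> R) : sqint L u -> sqint L v ->
  ip L u u - ip L v v = ip L (fun x => u x - v x) (fun x => u x - v x) +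
    2 * ip L (fun x => u x - v x) v.
Proof. by move=> su sv; rewrite ip_subl// ipBl//; ring. Qed.

Lemma ip_cauchy_sqrt (u v : R -> R) : sqint L u -> sqint L v ->
  `|ip L u v| <= Num.sqrt (ip L u u) * Num.sqrt (ip L v v).
Proof.
move=> su sv; rewrite -sqrtrM ?ip_ge0// -sqrtr_sqr; apply: ler_wsqrtr.
exact: ip_cauchy.
Qed.

Lemma continuous_ip (I : R -> Prop) (u : R -> R -> R) (v : R -> R) (t : R) :
  (forall s, I s -> sqint L (u s)) -> sqint L v -> I t ->
  (forall e : R, 0 < e -> exists2 d, 0 < d & forall s, I s -> `|s - t| < d ->
    ip L (fun x => u s x - u t x) (fun x => u s x - u t x) <= e) ->
  forall e : R, 0 < e -> exists2 d, 0 < d & forall s, I s -> `|s - t| < d ->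
    `|ip L (u s) v - ip L (u t) v| <= e.
Proof.
move=> su sv It H e e0; have v0 := ip_ge0 L v.
have e1 : 0 < e ^+ 2 / (ip L v v + 1) by rewrite divr_gt0 ?exprn_gt0//; lra.
have [d d0 Hd] := H _ e1; exists d => // s Is st.
have [ss st'] := (su s Is, su t It); rewrite -ipBl//.
apply: le_trans (ip_cauchy_sqrt (sqintB ss st') sv) _.
rewrite -sqrtrM ?ip_ge0//; apply: sqr_le_of_le; first exact: ltW.
apply: (@le_trans _ _ (e ^+ 2 / (ip L v v + 1) * ip L v v)).
  by rewrite ler_wpM2r// Hd.
rewrite -mulrA ler_piMr ?sqr_ge0// mulrC ler_pdivrMr; lra.
Qed.

Lemma continuous_ip_sqr (I : R -> Prop) (u : R -> R -> R) (t : R) :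
  (forall s, I s -> sqint L (u s)) -> I t ->
  (forall e : R, 0 < e -> exists2 d, 0 < d & forall s, I s -> `|s - t| < d ->
    ip L (fun x => u s x - u t x) (fun x => u s x - u t x) <= e) ->
  forall e : R, 0 < e -> exists2 d, 0 < d & forall s, I s -> `|s - t| < d ->
    `|ip L (u s) (u s) - ip L (u t) (u t)| <= e.
Proof.
move=> su It H e e0; have st' := su t It.
have e1 : 0 < e / 4 by lra.
have [d1 d10 H1] := H _ e1.
have [d2 d20 H2] := continuous_ip su st' It H e1.
exists (Num.min d1 d2); first by rewrite lt_min d10.
move=> s Is; rewrite lt_min => /andP[s1 s2]; have ss := su s Is.
have := H1 s Is s1; have := H2 s Is s2; rewrite ip_diff_sqr// -ipBl//.
have := ip_ge0 L (fun x => u s x - u t x).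
move: (ip L _ _) (ip L _ _) => x y; rewrite !ler_norml => y0 /andP[? ?] ?.
by apply/andP; split; lra.
Qed.

Let inT (t : R) : Prop := 0 <= t <= T.

Let ip_cont1 t e : inT t -> 0 < e -> exists2 d, 0 < d & forall s, inT s -> `|s - t| < d ->
  ip L (fun x => G1 s x - G1 t x) (fun x => G1 s x - G1 t x) <= e.
Proof.
move=> tT e0; have [d d0 H] := red_cont1 sol tT e0; exists d => // s sT st.
by apply: le_trans (H s sT st); rewrite /h1sq lerDl ip_ge0.
Qed.

Let ip_cont2 t e : inT t -> 0 < e -> exists2 d, 0 < d & forall s, inT s -> `|s - t| < d ->
  ip L (fun x => G2 s x - G2 t x) (fun x => G2 s x - G2 t x) <= e.
Proof.
move=> tT e0; have [d d0 H] := red_cont2 sol tT e0; exists d => // s sT st.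
by apply: le_trans (H s sT st); rewrite /h1sq lerDl ip_ge0.
Qed.

Let ip_contw1 t e : inT t -> 0 < e -> exists2 d, 0 < d & forall s, inT s -> `|s - t| < d ->
  ip L (fun x => prim L (G1 s) x - prim L (G1 t) x) (fun x => prim L (G1 s) x - prim L (G1 t) x) <= e.
Proof.
move=> tT e0; have [d d0 H] := red_cont1 sol tT e0; exists d => // s sT st.
have [s1 s2] := (red_sqint1 sol sT, red_sqint1 sol tT).
have E : ip L (fun x => prim L (G1 s) x - prim L (G1 t) x) (fun x => prim L (G1 s) x - prim L (G1 t) x) =
  ip L (prim L (fun x => G1 s x - G1 t x)) (prim L (fun x => G1 s x - G1 t x)).
  by apply: eq_ip => x _; rewrite primB.
by apply: le_trans (H s sT st); rewrite E /h1sq lerDr ip_ge0.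
Qed.

Let ip_contw2 t e : inT t -> 0 < e -> exists2 d, 0 < d & forall s, inT s -> `|s - t| < d ->
  ip L (fun x => prim L (G2 s) x - prim L (G2 t) x) (fun x => prim L (G2 s) x - prim L (G2 t) x) <= e.
Proof.
move=> tT e0; have [d d0 H] := red_cont2 sol tT e0; exists d => // s sT st.
have [s1 s2] := (red_sqint2 sol sT, red_sqint2 sol tT).
have E : ip L (fun x => prim L (G2 s) x - prim L (G2 t) x) (fun x => prim L (G2 s) x - prim L (G2 t) x) =
  ip L (prim L (fun x => G2 s x - G2 t x)) (prim L (fun x => G2 s x - G2 t x)).
  by apply: eq_ip => x _; rewrite primB.
by apply: le_trans (H s sT st); rewrite E /h1sq lerDr ip_ge0.
Qed.

Lemma sol_size_continuous t : 0 <= t <= T -> forall e : R, 0 < e -> exists2 d, 0 < d &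
  forall s, 0 <= s <= T -> `|s - t| < d -> `|sol_size L G1 G2 s - sol_size L G1 G2 t| <= e.
Proof.
move=> tT e e0; have e1 : 0 < e / 4 by lra.
have sw1 s : inT s -> sqint L (prim L (G1 s)) by move=> sT; exact: sqint_prim (red_sqint1 sol sT).
have sw2 s : inT s -> sqint L (prim L (G2 s)) by move=> sT; exact: sqint_prim (red_sqint2 sol sT).
have [a a0 Ha] := continuous_ip_sqr (red_sqint1 sol) tT (fun e => ip_cont1 tT) e1.
have [c c0 Hc] := continuous_ip_sqr (red_sqint2 sol) tT (fun e => ip_cont2 tT) e1.
have [f f0 Hf] := continuous_ip_sqr sw1 tT (fun e => ip_contw1 tT) e1.
have [g g0 Hg] := continuous_ip_sqr sw2 tT (fun e => ip_contw2 tT) e1.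
exists (Num.min (Num.min a c) (Num.min f g)); first by rewrite !lt_min a0 c0 f0 g0.
move=> s sT; rewrite !lt_min => /andP[/andP[h1 h2] /andP[h3 h4]].
have := Ha s sT h1; have := Hc s sT h2; have := Hf s sT h3; have := Hg s sT h4.
rewrite /sol_size /h1sq => k4 k3 k2 k1; rewrite addrACA [X in _ - X]addrACA.
apply: le_trans (dist_add_le _ _ _ _) _.
apply: le_trans (lerD (dist_add_le _ _ _ _) (dist_add_le _ _ _ _)) _.
by apply: le_trans (lerD (lerD k1 k2) (lerD k3 k4)) _; rewrite sum_quarters.
Qed.

Lemma sol_coef_cont1 k : {within `[0, T], continuous (fun t => ip L (prim L (G1 t)) (sinf L k))}.
Proof.
apply: within_continuous_eps => t tT e e0.
have sw1 s : inT s -> sqint L (prim L (G1 s)) by move=> sT; exact: sqint_prim (red_sqint1 sol sT).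
exact: (continuous_ip sw1 (sqint_sinf L k) tT (fun e => ip_contw1 tT)).
Qed.

Lemma sol_coef_cont2 k : {within `[0, T], continuous (fun t => ip L (prim L (G2 t)) (sinf L k))}.
Proof.
apply: within_continuous_eps => t tT e e0.
have sw2 s : inT s -> sqint L (prim L (G2 s)) by move=> sT; exact: sqint_prim (red_sqint2 sol sT).
exact: (continuous_ip sw2 (sqint_sinf L k) tT (fun e => ip_contw2 tT)).
Qed.

Let kap k := freq L k.+1.
Let a1 k t := ip L (prim L (G1 t)) (sinf L k.+1).
Let a2 k t := ip L (prim L (G2 t)) (sinf L k.+1).
Let z1 k := ip L dz1 (cosf L k.+1).
Let z2 k := ip L dz2 (cosf L k.+1).
Let f1 t := profile L c1 dz1 (G1 t).
Let f2 t := profile L c2 dz2 (G2 t).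
Let n1 k t := ip L (nonlin F (f1 t) (f2 t) (f1 t)) (sinf L k.+1).
Let n2 k t := ip L (nonlin F (f1 t) (f2 t) (f2 t)) (sinf L k.+1).

Lemma ip_cosf_split (dz g : R -> R) k : sqint L dz -> sqint L g -> prim L g L = 0 ->
  ip L (fun x => dz x + g x) (cosf L k.+1) =
  freq L k.+1 * ip L (prim L g) (sinf L k.+1) + ip L dz (cosf L k.+1).
Proof.
move=> sdz sg gL; rewrite ipDl//; last exact: sqint_cosf.
by rewrite [ip L g _]ip_cosf_prim// addrC.
Qed.

Let a1_deriv k t : 0 < t < T ->
  is_derive t 1 (a1 k) (nu * kap k * (kap k * a2 k t + z2 k) - n2 k t).
Proof.
move=> tT; have tT' : inT t by rewrite /inT; lra.
apply: is_derive_eq (red_eq1 sol k tT) _.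
by rewrite (ip_cosf_split k (bg_dz2 bg) (red_sqint2 sol tT') (red_end2 sol tT')).
Qed.

Let a2_deriv k t : 0 < t < T ->
  is_derive t 1 (a2 k) (n1 k t - nu * kap k * (kap k * a1 k t + z1 k)).
Proof.
move=> tT; have tT' : inT t by rewrite /inT; lra.
apply: is_derive_eq (red_eq2 sol k tT) _.
by rewrite (ip_cosf_split k (bg_dz1 bg) (red_sqint1 sol tT') (red_end1 sol tT')).
Qed.

Let z_le n : \sum_(k < n) (z1 k ^+ 2 + z2 k ^+ 2) <= ze ^+ 2.
Proof.
apply: le_trans (bg_dz_le bg); rewrite big_split/=.
have sc k : sqint L (cosf L k.+1) by exact: sqint_cosf.
have oc j k : ip L (cosf L j.+1) (cosf L k.+1) = (j == k)%:R by rewrite ip_cosf.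
apply: lerD; first exact: (@bessel _ L (fun k => cosf L k.+1) n sc oc _ (bg_dz1 bg)).
exact: (@bessel _ L (fun k => cosf L k.+1) n sc oc _ (bg_dz2 bg)).
Qed.

Variables (m K s0 : R).
Hypothesis m0 : 0 <= m.
Hypothesis K0 : 0 <= K.
Hypothesis s00 : 0 <= s0.
Let rho := zb + 4 * m.
Hypothesis Fq : F q = 0.
Hypothesis F_lip : lipschitz_upto F K rho.

Let rho0 : 0 <= rho.
Proof. by have := bg_q bg; move: m0; rewrite /rho; lra. Qed.

(** The two components add up to the constants 2 * 16 = 32 and 2 * 3 = 6, rounded up to the squares
    of 6 and 3. *)
Lemma nonlin_time n t : 0 <= t <= T -> sol_size L G1 G2 t <= m ^+ 2 ->
  \sum_(k < n) ((kap k * n1 k t) ^+ 2 + (kap k * n2 k t) ^+ 2) <= (6 * (K * rho) * (ze + m)) ^+ 2 /\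
  \sum_(k < n) (n1 k t ^+ 2 + n2 k t ^+ 2) <= (3 * (K * rho) * (be + m)) ^+ 2.
Proof.
move=> tT Sm.
have [sg1 sg2] := (red_sqint1 sol tT, red_sqint2 sol tT).
have [e1 e2] := (red_end1 sol tT, red_end2 sol tT).
have [_ p1 r1] := nonlin_fixed L0 bg sg1 sg2 e1 e2 m0 K0 Sm Fq F_lip n (or_introl (fun=> erefl)).
have [_ p2 r2] := nonlin_fixed L0 bg sg1 sg2 e1 e2 m0 K0 Sm Fq F_lip n (or_intror (fun=> erefl)).
have KK : 0 <= (K * rho) ^+ 2 by exact: sqr_ge0.
rewrite !big_split/=; split.
  apply: le_trans (lerD p1 p2) _.
  have -> : (6 * (K * rho) * (ze + m)) ^+ 2 = (K * rho) ^+ 2 * (36 * (ze + m) ^+ 2) by ring.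
  have -> : 16 * (K * (zb + 4 * m)) ^+ 2 * (ze ^+ 2 + m ^+ 2) + 16 * (K * (zb + 4 * m)) ^+ 2 * (ze ^+ 2 + m ^+ 2) =
    (K * rho) ^+ 2 * (32 * (ze ^+ 2 + m ^+ 2)) by rewrite /rho; ring.
  by apply: ler_wpM2l => //; apply: sqrD_scale; rewrite ?ler_nat// (bg_ze bg).
apply: le_trans (lerD r1 r2) _.
have -> : (3 * (K * rho) * (be + m)) ^+ 2 = (K * rho) ^+ 2 * (9 * (be + m) ^+ 2) by ring.
have -> : 3 * (K * (zb + 4 * m)) ^+ 2 * (be ^+ 2 + m ^+ 2) + 3 * (K * (zb + 4 * m)) ^+ 2 * (be ^+ 2 + m ^+ 2) =
  (K * rho) ^+ 2 * (6 * (be ^+ 2 + m ^+ 2)) by rewrite /rho; ring.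
by apply: ler_wpM2l => //; apply: sqrD_scale; rewrite ?ler_nat// (bg_be bg).
Qed.

(** The constant mode of g vanishes with its mean, so the sine coefficients of the primitive see all
    of g. *)
Lemma sum_cosf_prim (g : R -> R) (e : R) : sqint L g -> prim L g L = 0 ->
  (forall n, \sum_(k < n) (freq L k.+1 * ip L (prim L g) (sinf L k.+1)) ^+ 2 <= e) ->
  ip L g g <= e.
Proof.
move=> sg gL H; apply: parseval_le => // -[|n]; first by have := H 0%N; rewrite !big_ord0.
rewrite big_ord_recl [ip L g _]ip_cosf_prim// freq0 mul0r expr0n add0r.
apply: le_trans (H n); rewrite le_eqVlt; apply/orP; left; apply/eqP.
by apply: eq_bigr => k _; rewrite lift0 ip_cosf_prim.
Qed.

Hypothesis init : sol_size L G1 G2 0 <= s0 ^+ 2.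
(** Bound of the root of the energy on [0, T]: its initial value plus the accumulated source. *)
Let e := 2 * (ze + s0) + 6 * (K * rho) * (ze + m) * T.
(** Recovering kap a as d - z costs 2 (e^2 + ze^2) for each component; the mass bound is likewise
    counted once for each component. *)
Let S1 := 4 * (e ^+ 2 + ze ^+ 2) +
  2 * (s0 ^+ 2 + (2 * nu * e * ze + 2 * (3 * (K * rho) * (be + m)) * m) * T).

Let sc k : sqint L (cosf L k.+1). Proof. exact: sqint_cosf. Qed.
Let ss k : sqint L (sinf L k.+1). Proof. exact: sqint_sinf. Qed.
Let oc j k : ip L (cosf L j.+1) (cosf L k.+1) = (j == k)%:R.
Proof. by rewrite ip_cosf. Qed.
Let os j k : ip L (sinf L j.+1) (sinf L k.+1) = (j == k)%:R.
Proof. by rewrite ip_sinf. Qed.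

(** The assumed bound m enters [S1] only in terms carrying the factor K rho of the source, which is
    what lets the bootstrap close. The energy is bounded before the mass, whose growth depends on
    it. *)
Lemma sol_size_step t : 0 <= t <= T ->
  (forall s, 0 <= s <= t -> sol_size L G1 G2 s <= m ^+ 2) ->
  sol_size L G1 G2 t <= S1.
Proof.
move=> tT Hs.
have ze0 := bg_ze bg; have be0 := bg_be bg.
have [t0 tT2] := andP tT.
have tt : 0 <= t <= t by rewrite t0 lexx.
have b0 : 0 <= 6 * (K * rho) * (ze + m) by rewrite !mulr_ge0// addr_ge0.
have al0 : 0 <= 3 * (K * rho) * (be + m) by rewrite !mulr_ge0// addr_ge0.
have e0 : 0 <= e.
  by apply: addr_ge0; [apply: mulr_ge0 => //; exact: addr_ge0|apply: mulr_ge0 => //; exact: ltW].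
have I0 : 0 <= (0 : R) <= T by rewrite lexx ltW.
have sT (s : R) : 0 <= s <= t -> 0 <= s <= T by move=> /andP[-> /le_trans->].
have [g10 g20] := (red_sqint1 sol I0, red_sqint2 sol I0).
have cc1 k : {within `[0, T], continuous (a1 k)} by exact: sol_coef_cont1.
have cc2 k : {within `[0, T], continuous (a2 k)} by exact: sol_coef_cont2.
have E0 n : energy kap z1 z2 a1 a2 n 0 <= (2 * (ze + s0)) ^+ 2.
  have [sdz1 sdz2] := (bg_dz1 bg, bg_dz2 bg).
  have [sD1 sD2] := (sqintD sdz1 g10, sqintD sdz2 g20).
  rewrite /energy big_split/=.
  apply: (@le_trans _ _ (ip L (fun x => dz1 x + G1 0 x) (fun x => dz1 x + G1 0 x) +
                         ip L (fun x => dz2 x + G2 0 x) (fun x => dz2 x + G2 0 x))).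
    apply: lerD.
      apply: le_trans (bessel n sc oc sD1); rewrite le_eqVlt; apply/orP; left; apply/eqP.
      by apply: eq_bigr => k _; rewrite ip_cosf_split// (red_end1 sol I0).
    apply: le_trans (bessel n sc oc sD2); rewrite le_eqVlt; apply/orP; left; apply/eqP.
    by apply: eq_bigr => k _; rewrite ip_cosf_split// (red_end2 sol I0).
  apply: le_trans (lerD (ip_add_le sdz1 g10) (ip_add_le sdz2 g20)) _.
  rewrite exprMn -mulrDr; apply: (@le_trans _ _ (2 * (ze ^+ 2 + s0 ^+ 2))); last first.
    by rewrite -natrX; apply: sqrD_scale => //; rewrite ler_nat.
  rewrite ler_pM2l// addrACA; apply: lerD (bg_dz_le bg) _; apply: le_trans init.
  by apply: lerD; rewrite lerDl ip_ge0.
have energy_le n s : 0 <= s <= t -> energy kap z1 z2 a1 a2 n s <= e ^+ 2.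
  move=> st; have sT' := sT _ st.
  have := energy_growth cc1 cc2 a1_deriv a2_deriv (n := n) sT' b0.
  move=> H; have {}H := H _.
  have Hn u : 0 < u < s -> \sum_(k < n) ((kap k * n1 k u) ^+ 2 + (kap k * n2 k u) ^+ 2) <=
      (6 * (K * rho) * (ze + m)) ^+ 2.
    by move=> us; have ut := itv_widen us st; apply: (nonlin_time n (sT _ ut) (Hs _ ut)).1.
  have {}H := H Hn.
  have h0 : Num.sqrt (energy kap z1 z2 a1 a2 n 0) <= 2 * (ze + s0).
    by apply: sqr_le_of_le => //; rewrite mulr_ge0// addr_ge0.
  have h1 : Num.sqrt (energy kap z1 z2 a1 a2 n s) <= e.
    apply: le_trans H _; rewrite /e; apply: lerD => //; apply: ler_wpM2l => //; lra.
  rewrite -[leLHS]sqr_sqrtr ?energy_ge0// lerXn2r ?nnegrE ?sqrtr_ge0//.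
have mass_le_size n s : 0 <= s <= T -> mass a1 a2 n s <= sol_size L G1 G2 s.
  move=> sT'; have [sw1 sw2] := (sqint_prim (red_sqint1 sol sT'), sqint_prim (red_sqint2 sol sT')).
  rewrite /mass big_split/=; apply: lerD.
    by apply: le_trans (bessel n ss os sw1) _; rewrite /h1sq lerDr ip_ge0.
  by apply: le_trans (bessel n ss os sw2) _; rewrite /h1sq lerDr ip_ge0.
pose A := s0 ^+ 2 + (2 * nu * e * ze + 2 * (3 * (K * rho) * (be + m)) * m) * T.
have mass_le n : mass a1 a2 n t <= A.
  have H := mass_growth nu0 cc1 cc2 a1_deriv a2_deriv (n := n) tT al0 e0 ze0 m0.
  apply: le_trans (H _ _ (z_le n) _) _.
  - by move=> u /itv_widen-/(_ _ tt) ut; apply: (nonlin_time n (sT _ ut) (Hs _ ut)).2.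
  - by move=> u /itv_widen-/(_ _ tt); exact: energy_le.
  - by move=> u /itv_widen-/(_ _ tt) ut; apply: le_trans (mass_le_size n u (sT _ ut)) (Hs u ut).
  - rewrite /A; apply: lerD; first by apply: le_trans (mass_le_size n 0 I0) init.
    apply: ler_wpM2l => //; apply: addr_ge0.
      by apply: mulr_ge0 => //; apply: mulr_ge0 => //; apply: mulr_ge0.
    by apply: mulr_ge0 => //; apply: mulr_ge0.
have [sg1 sg2] := (red_sqint1 sol tT, red_sqint2 sol tT).
have [e1 e2] := (red_end1 sol tT, red_end2 sol tT).
have w1 : ip L (prim L (G1 t)) (prim L (G1 t)) <= A.
  apply: parseval_prim_le => // n; apply: le_trans (mass_le n); apply: ler_sum => k _.
  by rewrite lerDl sqr_ge0.
have w2 : ip L (prim L (G2 t)) (prim L (G2 t)) <= A.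
  apply: parseval_prim_le => // n; apply: le_trans (mass_le n); apply: ler_sum => k _.
  by rewrite lerDr sqr_ge0.
(* Applied with x = kap a and x + z = d. *)
have sq_le (x z : R) : x ^+ 2 <= 2 * ((x + z) ^+ 2 + z ^+ 2).
  by have := sqr_ge0 (x + 2 * z); rewrite !expr2; lra.
have v1 : ip L (G1 t) (G1 t) <= 2 * (e ^+ 2 + ze ^+ 2).
  apply: sum_cosf_prim => // n; apply: (@le_trans _ _ (2 * (energy kap z1 z2 a1 a2 n t + \sum_(k < n) (z1 k ^+ 2 + z2 k ^+ 2)))).
    rewrite -big_split mulr_sumr; apply: ler_sum => k _ /=.
    apply: le_trans (sq_le _ (z1 k)) _; rewrite ler_pM2l//; apply: lerD; rewrite lerDl sqr_ge0//.
  by rewrite ler_pM2l// lerD// energy_le.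
have v2 : ip L (G2 t) (G2 t) <= 2 * (e ^+ 2 + ze ^+ 2).
  apply: sum_cosf_prim => // n; apply: (@le_trans _ _ (2 * (energy kap z1 z2 a1 a2 n t + \sum_(k < n) (z1 k ^+ 2 + z2 k ^+ 2)))).
    rewrite -big_split mulr_sumr; apply: ler_sum => k _ /=.
    apply: le_trans (sq_le _ (z2 k)) _; rewrite ler_pM2l//; apply: lerD; rewrite lerDr sqr_ge0//.
  by rewrite ler_pM2l// lerD// energy_le.
by rewrite /sol_size /h1sq addrACA; apply: le_trans (lerD (lerD v1 v2) (lerD w1 w2)) _; exact: sum_halves.
Qed.

End evolution.

End reduced_system.

(** * The bootstrap and the choice of radii *)

Section reduced_estimates.
Context {R : realType}.
Implicit Types (L T nu q : R) (F : R -> R).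

(** The root of the energy in units of eps: the initial bound 2 (B1 + c), and 1 reserved for the
    source. *)
Definition energy_radius (c B1 : R) : R := 2 * (B1 + c) + 1.

(** The bound [S1] in units of eps^2, with [energy_radius] for e and 1 for the source in the mass;
    the last 1 is the margin of the bootstrap. *)
Definition apriori_radius nu T (c B1 : R) : R :=
  4 * (energy_radius c B1 ^+ 2 + B1 ^+ 2) +
  2 * (c ^+ 2 + (2 * nu * energy_radius c B1 * B1 * T + 1)) + 1.

Lemma apriori_radius_ge1 nu T c B1 : 0 <= nu -> 0 <= T -> 0 <= c -> 0 <= B1 ->
  1 <= apriori_radius nu T c B1.
Proof.
move=> nu0 T0 c0 B10; rewrite /apriori_radius lerDr.
have e0 : 0 <= energy_radius c B1 by rewrite /energy_radius; lra.
by rewrite addr_ge0// mulr_ge0// addr_ge0 ?sqr_ge0// addr_ge0// !mulr_ge0.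
Qed.

(** Here k is K rho / eps^2. The two smallness conditions bound the share of the source in e by eps
    and in the mass by eps^2, which are the amounts reserved in the radii. *)
Lemma apriori_arith nu T (c B1 B2 M k eps : R) :
  0 <= nu -> 0 <= T -> 0 <= c -> 0 <= B1 -> 0 <= B2 -> 0 <= M -> 0 <= k -> 0 <= eps ->
  6 * k * (B1 + M) * T * eps ^+ 2 <= 1 -> 6 * k * (B2 + M) * M * T * eps ^+ 2 <= 1 ->
  forall e, e = 2 * (B1 * eps + c * eps) + 6 * (k * eps ^+ 2) * (B1 * eps + M * eps) * T ->
  4 * (e ^+ 2 + (B1 * eps) ^+ 2) +
  2 * ((c * eps) ^+ 2 + (2 * nu * e * (B1 * eps) +
    2 * (3 * (k * eps ^+ 2) * (B2 * eps + M * eps)) * (M * eps)) * T) <=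
  (apriori_radius nu T c B1 - 1) * eps ^+ 2.
Proof.
move=> nu0 T0 c0 B10 B20 M0 k0 eps0 small1 small2 e eE.
have e0 : 0 <= e.
  rewrite eE addr_ge0//; first by rewrite mulr_ge0// addr_ge0// mulr_ge0.
  by rewrite !mulr_ge0 ?addr_ge0 ?mulr_ge0 ?sqr_ge0.
set e1 := energy_radius c B1.
have ee : e <= e1 * eps.
  have -> : e = 2 * (B1 + c) * eps + 6 * k * (B1 + M) * T * eps ^+ 2 * eps.
    by rewrite eE; ring.
  have -> : e1 * eps = 2 * (B1 + c) * eps + 1 * eps by rewrite /e1 /energy_radius; ring.
  by rewrite lerD2l ler_wpM2r.
have ee2 : e ^+ 2 <= e1 ^+ 2 * eps ^+ 2 by rewrite -exprMn lerXn2r ?nnegrE ?(le_trans e0).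
have h1 : 2 * nu * e * (B1 * eps) * T <= 2 * nu * e1 * B1 * T * eps ^+ 2.
  have -> : 2 * nu * e * (B1 * eps) * T = 2 * nu * B1 * T * eps * e by ring.
  have -> : 2 * nu * e1 * B1 * T * eps ^+ 2 = 2 * nu * B1 * T * eps * (e1 * eps) by ring.
  by rewrite ler_wpM2l// !mulr_ge0.
have h2 : 2 * (3 * (k * eps ^+ 2) * (B2 * eps + M * eps)) * (M * eps) * T <= eps ^+ 2.
  have -> : 2 * (3 * (k * eps ^+ 2) * (B2 * eps + M * eps)) * (M * eps) * T =
    6 * k * (B2 + M) * M * T * eps ^+ 2 * eps ^+ 2 by ring.
  by rewrite ler_piMl ?sqr_ge0.
rewrite /apriori_radius -/e1 addrK [(_ + _) * T]mulrDl !exprMn.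
have -> : (4 * (e1 ^+ 2 + B1 ^+ 2) + 2 * (c ^+ 2 + (2 * nu * e1 * B1 * T + 1))) * eps ^+ 2 =
  4 * (e1 ^+ 2 * eps ^+ 2 + B1 ^+ 2 * eps ^+ 2) +
  2 * (c ^+ 2 * eps ^+ 2 + (2 * nu * e1 * B1 * T * eps ^+ 2 + eps ^+ 2)) by ring.
apply: lerD; rewrite ler_pM2l//; first by rewrite lerD2r.
by rewrite lerD2l lerD.
Qed.

Lemma sol_size_le L T nu q eps c B0 B1 B2 k c1 c2 (dz1 dz2 b : R -> R) F (G1 G2 : R -> R -> R) :
  0 < L -> 0 < T -> 0 <= nu -> 0 < eps -> 0 <= c -> 0 <= B0 -> 0 <= B1 -> 0 <= B2 -> 0 <= k ->
  background_data L q (B0 * eps) (B1 * eps) (B2 * eps) c1 c2 dz1 dz2 b ->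
  reduced_solution L T nu F c1 c2 dz1 dz2 G1 G2 ->
  let M := apriori_radius nu T c B1 in
  F q = 0 -> lipschitz_upto F (k * eps) ((B0 + 4 * M) * eps) ->
  6 * (k * (B0 + 4 * M)) * (B1 + M) * T * eps ^+ 2 <= 1 ->
  6 * (k * (B0 + 4 * M)) * (B2 + M) * M * T * eps ^+ 2 <= 1 ->
  sol_size L G1 G2 0 <= (c * eps) ^+ 2 ->
  forall t : R, 0 <= t <= T -> sol_size L G1 G2 t <= (M * eps) ^+ 2.
Proof.
move=> L0 T0 nu0 eps0 c0 B00 B10 B20 k0 bg sol M Fq Flip small1 small2 init.
have M1 : 1 <= M by apply: apriori_radius_ge1 => //; exact: ltW.
have M0 : 0 <= M by apply: le_trans M1.
have [e0 T0'] := (ltW eps0, ltW T0).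
have e20 : 0 < eps ^+ 2 by rewrite exprn_gt0.
have rhoE : (B0 + 4 * M) * eps = B0 * eps + 4 * (M * eps) by ring.
rewrite rhoE in Flip.
(* The strict gap required by [bootstrap], from M - 1 < M <= M^2. *)
have MM : (M - 1) * eps ^+ 2 < (M * eps) ^+ 2.
  rewrite exprMn ltr_pM2r// expr2; have := ler_peMr M0 M1; lra.
apply: (bootstrap T0' MM _ (sol_size_continuous sol)).
  apply: le_trans init _; rewrite exprMn ler_pM2r//.
  rewrite /M /apriori_radius addrK; set e1 := energy_radius c B1.
  have e10 : 0 <= e1 by rewrite /e1 /energy_radius; lra.
  have h1 : 0 <= 2 * nu * e1 * B1 * T by rewrite !mulr_ge0.
  have := sqr_ge0 e1; have := sqr_ge0 B1; have := sqr_ge0 c; lra.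
move=> t tT Hs.
have s1 := sol_size_step L0 T0 nu0 bg sol (mulr_ge0 M0 e0) (mulr_ge0 k0 e0)
  (mulr_ge0 c0 e0) Fq Flip init tT Hs.
apply: le_trans s1 _; rewrite -rhoE.
have -> : k * eps * ((B0 + 4 * M) * eps) = k * (B0 + 4 * M) * eps ^+ 2 by ring.
apply: (@apriori_arith nu T c B1 B2 M _ eps) => //; rewrite mulr_ge0// addr_ge0// mulr_ge0//.
Qed.

Lemma is_derive_inside (T : R) (f g : R -> R) (t v : R) : 0 < t < T ->
  (forall s, 0 <= s <= T -> f s = g s) -> is_derive t 1 f v -> is_derive t 1 g v.
Proof.
move=> tT fg df.
have nfg : \forall s \near t, f s = g s.
  have : \forall s \near t, s \in `]0, T[ by apply: near_in_itvoo; rewrite in_itv.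
  by apply: filterS => s; rewrite in_itv/= => /andP[/ltW s0 /ltW sT]; rewrite fg// s0.
by apply: near_eq_is_derive nfg df; exact: oner_neq0.
Qed.

(** * The difference of two solutions *)

Section difference.
Variables (L T nu q zb ze be : R) (c1 c2 : R) (dz1 dz2 b : R -> R).
Hypothesis L0 : 0 < L.
Hypothesis bg : background_data L q zb ze be c1 c2 dz1 dz2 b.
Variables (F F' : R -> R) (G1 G2 G1' G2' : R -> R -> R).
Hypothesis sol : reduced_solution L T nu F c1 c2 dz1 dz2 G1 G2.
Hypothesis sol' : reduced_solution L T nu F' c1 c2 dz1 dz2 G1' G2'.
Variables (m K : R).
Hypothesis m0 : 0 <= m.
Hypothesis K0 : 0 <= K.
Let rho := zb + 4 * m.
Hypothesis Fq : F q = 0.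
Hypothesis F_lip : lipschitz_upto F K rho.
Hypothesis Fq' : F' q = 0.
Hypothesis F_lip' : lipschitz_upto F' K rho.
Hypothesis size_le : forall t, 0 <= t <= T -> sol_size L G1 G2 t <= m ^+ 2.
Hypothesis size_le' : forall t, 0 <= t <= T -> sol_size L G1' G2' t <= m ^+ 2.

(** Twice the bound of [nonlin_time]: the two nonlinear terms are estimated separately, with no
    comparison between them, so no Gronwall argument is needed. The same holds for [be1]. *)
Let al := 2 * (3 * (K * rho) * (be + m)).
Let be1 := 2 * (6 * (K * rho) * (ze + m)).
Let H1 t x := G1 t x - G1' t x.
Let H2 t x := G2 t x - G2' t x.
Let kap k := freq L k.+1.
Let a1 k t := ip L (prim L (H1 t)) (sinf L k.+1).
Let a2 k t := ip L (prim L (H2 t)) (sinf L k.+1).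
Let f1 t := profile L c1 dz1 (G1 t).
Let f2 t := profile L c2 dz2 (G2 t).
Let f1' t := profile L c1 dz1 (G1' t).
Let f2' t := profile L c2 dz2 (G2' t).
Let N1 t k := ip L (nonlin F (f1 t) (f2 t) (f1 t)) (sinf L k.+1).
Let N2 t k := ip L (nonlin F (f1 t) (f2 t) (f2 t)) (sinf L k.+1).
Let N1' t k := ip L (nonlin F' (f1' t) (f2' t) (f1' t)) (sinf L k.+1).
Let N2' t k := ip L (nonlin F' (f1' t) (f2' t) (f2' t)) (sinf L k.+1).
Let n1 k t := N1 t k - N1' t k.
Let n2 k t := N2 t k - N2' t k.

Let coefB (g g' : R -> R) k : sqint L g -> sqint L g' ->
  ip L (prim L g) (sinf L k) - ip L (prim L g') (sinf L k) =
  ip L (prim L (fun x => g x - g' x)) (sinf L k).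
Proof.
move=> sg sg'; have [sp sp'] := (sqint_prim sg, sqint_prim sg').
rewrite -ipBl//; last exact: sqint_sinf.
by apply: eq_ip => x _ //; rewrite (primB _ sg sg').
Qed.

Let sH1 t : 0 <= t <= T -> sqint L (H1 t).
Proof. by move=> tT; have := sqintB (red_sqint1 sol tT) (red_sqint1 sol' tT). Qed.

Let sH2 t : 0 <= t <= T -> sqint L (H2 t).
Proof. by move=> tT; have := sqintB (red_sqint2 sol tT) (red_sqint2 sol' tT). Qed.

Let H1L t : 0 <= t <= T -> prim L (H1 t) L = 0.
Proof.
move=> tT; rewrite /H1 (primB _ (red_sqint1 sol tT) (red_sqint1 sol' tT)).
by rewrite (red_end1 sol tT) (red_end1 sol' tT) subrr.
Qed.

Let H2L t : 0 <= t <= T -> prim L (H2 t) L = 0.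
Proof.
move=> tT; rewrite /H2 (primB _ (red_sqint2 sol tT) (red_sqint2 sol' tT)).
by rewrite (red_end2 sol tT) (red_end2 sol' tT) subrr.
Qed.

Let a1E k t : 0 <= t <= T ->
  ip L (prim L (G1 t)) (sinf L k.+1) - ip L (prim L (G1' t)) (sinf L k.+1) = a1 k t.
Proof. by move=> tT; rewrite (coefB _ (red_sqint1 sol tT) (red_sqint1 sol' tT)). Qed.

Let a2E k t : 0 <= t <= T ->
  ip L (prim L (G2 t)) (sinf L k.+1) - ip L (prim L (G2' t)) (sinf L k.+1) = a2 k t.
Proof. by move=> tT; rewrite (coefB _ (red_sqint2 sol tT) (red_sqint2 sol' tT)). Qed.

Let within_continuous_diff (f g h : R -> R) : {within `[0, T], continuous f} ->
  {within `[0, T], continuous g} -> (forall t, 0 <= t <= T -> f t - g t = h t) ->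
  {within `[0, T], continuous h}.
Proof.
move=> cf cg fgh; have cB : {within `[0, T], continuous (fun t => f t - g t)}.
  by move=> x; apply: cvgB; [exact: cf|exact: cg].
by apply: subspace_eq_continuous cB => t /set_mem/=; rewrite in_itv/= => /fgh.
Qed.

Let a1_cont k : {within `[0, T], continuous (a1 k)}.
Proof. exact (@within_continuous_diff (fun t => ip L (prim L (G1 t)) (sinf L k.+1))
  (fun t => ip L (prim L (G1' t)) (sinf L k.+1)) (a1 k)
  (sol_coef_cont1 sol (k:=k.+1)) (sol_coef_cont1 sol' (k:=k.+1)) (fun t tT => a1E k tT)). Qed.

Let a2_cont k : {within `[0, T], continuous (a2 k)}.
Proof. exact (@within_continuous_diff (fun t => ip L (prim L (G2 t)) (sinf L k.+1))
  (fun t => ip L (prim L (G2' t)) (sinf L k.+1)) (a2 k)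
  (sol_coef_cont2 sol (k:=k.+1)) (sol_coef_cont2 sol' (k:=k.+1)) (fun t tT => a2E k tT)). Qed.

Let zero0 := fun _ : nat => 0 : R.

Let a1_deriv k t : 0 < t < T ->
  is_derive t 1 (a1 k) (nu * kap k * (kap k * a2 k t + zero0 k) - n2 k t).
Proof.
move=> tT; have tT' : 0 <= t <= T by case/andP: tT => /ltW-> /ltW.
apply: (is_derive_inside tT (fun s => @a1E k s)).
apply: is_derive_eq (is_deriveB (red_eq1 sol k tT) (red_eq1 sol' k tT)) _.
rewrite (ip_cosf_split L0 k (bg_dz2 bg) (red_sqint2 sol tT') (red_end2 sol tT')).
rewrite (ip_cosf_split L0 k (bg_dz2 bg) (red_sqint2 sol' tT') (red_end2 sol' tT')).
rewrite -a2E// /n2 /N2 /N2' /kap /zero0 -/(f1 t) -/(f2 t) -/(f1' t) -/(f2' t).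
move: (freq L k.+1) (ip L _ _) (ip L _ _) (ip L _ _) (ip L _ _) (ip L dz2 _) => *; ring.
Qed.

Let a2_deriv k t : 0 < t < T ->
  is_derive t 1 (a2 k) (n1 k t - nu * kap k * (kap k * a1 k t + zero0 k)).
Proof.
move=> tT; have tT' : 0 <= t <= T by case/andP: tT => /ltW-> /ltW.
apply: (is_derive_inside tT (fun s => @a2E k s)).
apply: is_derive_eq (is_deriveB (red_eq2 sol k tT) (red_eq2 sol' k tT)) _.
rewrite (ip_cosf_split L0 k (bg_dz1 bg) (red_sqint1 sol tT') (red_end1 sol tT')).
rewrite (ip_cosf_split L0 k (bg_dz1 bg) (red_sqint1 sol' tT') (red_end1 sol' tT')).
rewrite -a1E// /n1 /N1 /N1' /kap /zero0 -/(f1 t) -/(f2 t) -/(f1' t) -/(f2' t).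
move: (freq L k.+1) (ip L _ _) (ip L _ _) (ip L _ _) (ip L _ _) (ip L dz1 _) => *; ring.
Qed.

Let sqrB_le (x y : R) : (x - y) ^+ 2 <= 2 * (x ^+ 2 + y ^+ 2).
Proof. by have := sqr_ge0 (x + y); rewrite !expr2; lra. Qed.

Let sum_diff_le n (u v u' v' : nat -> R) (c : R) :
  \sum_(k < n) (u k ^+ 2 + v k ^+ 2) <= c ^+ 2 ->
  \sum_(k < n) (u' k ^+ 2 + v' k ^+ 2) <= c ^+ 2 ->
  \sum_(k < n) ((u k - u' k) ^+ 2 + (v k - v' k) ^+ 2) <= (2 * c) ^+ 2.
Proof.
move=> h h'; apply: (@le_trans _ _ (2 * (\sum_(k < n) (u k ^+ 2 + v k ^+ 2) +
  \sum_(k < n) (u' k ^+ 2 + v' k ^+ 2)))).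
  rewrite -big_split mulr_sumr; apply: ler_sum => k _ /=; rewrite addrACA mulrDr.
  by apply: lerD; exact: sqrB_le.
apply: le_trans (_ : 2 * (c ^+ 2 + c ^+ 2) <= _); first by rewrite ler_pM2l// lerD.
by rewrite exprMn le_eqVlt; apply/orP; left; apply/eqP; ring.
Qed.

Let mass_src n t : 0 <= t <= T -> \sum_(k < n) (n1 k t ^+ 2 + n2 k t ^+ 2) <= al ^+ 2.
Proof.
move=> tT; apply: (@sum_diff_le n (N1 t) (N2 t) (N1' t) (N2' t)).
  exact: (nonlin_time L0 bg sol m0 K0 Fq F_lip n tT (size_le tT)).2.
exact: (nonlin_time L0 bg sol' m0 K0 Fq' F_lip' n tT (size_le' tT)).2.
Qed.

Let energy_src n t : 0 <= t <= T ->
  \sum_(k < n) ((kap k * n1 k t) ^+ 2 + (kap k * n2 k t) ^+ 2) <= be1 ^+ 2.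
Proof.
move=> tT; under eq_bigr do rewrite !mulrBr.
apply: (@sum_diff_le n (fun k => kap k * N1 t k) (fun k => kap k * N2 t k)
  (fun k => kap k * N1' t k) (fun k => kap k * N2' t k)).
  exact: (nonlin_time L0 bg sol m0 K0 Fq F_lip n tT (size_le tT)).1.
exact: (nonlin_time L0 bg sol' m0 K0 Fq' F_lip' n tT (size_le' tT)).1.
Qed.

Let rho0 : 0 <= rho.
Proof. by have := bg_q bg; move: m0; rewrite /rho; lra. Qed.

Let al0 : 0 <= al.
Proof. by rewrite !mulr_ge0// addr_ge0// (bg_be bg). Qed.

Let be10 : 0 <= be1.
Proof. by rewrite !mulr_ge0// addr_ge0// (bg_ze bg). Qed.

(** The background cancels, so [mass_growth0] applies. The factor 2 arises because each component is
    bounded by the full mass. *)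
Lemma difference_mass t (s0 : R) : 0 <= t <= T -> 0 <= s0 ->
  ip L (prim L (H1 0)) (prim L (H1 0)) + ip L (prim L (H2 0)) (prim L (H2 0)) <= s0 ^+ 2 ->
  ip L (prim L (H1 t)) (prim L (H1 t)) + ip L (prim L (H2 t)) (prim L (H2 t)) <=
  2 * (s0 + al * T) ^+ 2.
Proof.
move=> tT s00 init; have [t0 tT2] := andP tT; have T0 := le_trans t0 tT2.
have I0 : 0 <= (0 : R) <= T by rewrite lexx.
have [sw1 sw2] := (sqint_prim (sH1 I0), sqint_prim (sH2 I0)).
have ss k : sqint L (sinf L k.+1) by exact: sqint_sinf.
have os j k : ip L (sinf L j.+1) (sinf L k.+1) = (j == k)%:R by rewrite ip_sinf.
have mass_le n : mass a1 a2 n t <= (s0 + al * T) ^+ 2.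
  apply: sqrt_le_sqr; first exact: mass_ge0.
  apply: le_trans (mass_growth0 a1_cont a2_cont a1_deriv a2_deriv tT al0 _ _ _) _ => //.
    by move=> s /itv_widen-/(_ _ tT); exact: mass_src.
  apply: lerD; last by rewrite ler_wpM2l.
  apply: sqr_le_of_le => //; apply: le_trans init; rewrite /mass big_split/=.
  by apply: lerD; [exact: (bessel n ss os sw1)|exact: (bessel n ss os sw2)].
rewrite mulr_natl mulr2n; apply: lerD; (apply: parseval_prim_le => //; first by [exact: sH1|exact: sH2];
  first by [exact: H1L|exact: H2L]) => n; apply: le_trans (mass_le n); apply: ler_sum => k _.
  by rewrite lerDl sqr_ge0.
by rewrite lerDr sqr_ge0.
Qed.

(** With zero background the energy consists of the squared cosine coefficients of H1 and H2. The
    factor 2 again comes from bounding each component by the whole. *)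
Lemma difference_energy t (s0 : R) : 0 <= t <= T -> 0 <= s0 ->
  ip L (H1 0) (H1 0) + ip L (H2 0) (H2 0) <= s0 ^+ 2 ->
  ip L (H1 t) (H1 t) + ip L (H2 t) (H2 t) <= 2 * (s0 + be1 * T) ^+ 2.
Proof.
move=> tT s00 init; have [t0 tT2] := andP tT; have T0 := le_trans t0 tT2.
have I0 : 0 <= (0 : R) <= T by rewrite lexx.
have sc k : sqint L (cosf L k.+1) by exact: sqint_cosf.
have oc j k : ip L (cosf L j.+1) (cosf L k.+1) = (j == k)%:R by rewrite ip_cosf.
have energy_le n : energy kap zero0 zero0 a1 a2 n t <= (s0 + be1 * T) ^+ 2.
  apply: sqrt_le_sqr; first exact: energy_ge0.
  apply: le_trans (energy_growth a1_cont a2_cont a1_deriv a2_deriv tT be10 _) _ => //.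
    by move=> s /itv_widen-/(_ _ tT); exact: energy_src.
  apply: lerD; last by rewrite ler_wpM2l.
  apply: sqr_le_of_le => //; apply: le_trans init; rewrite /energy big_split/=.
  apply: lerD.
    apply: le_trans (bessel n sc oc (sH1 I0)); rewrite le_eqVlt; apply/orP; left; apply/eqP.
    by apply: eq_bigr => k _; rewrite [in RHS]ip_cosf_prim ?addr0//; [exact: sH1|exact: H1L].
  apply: le_trans (bessel n sc oc (sH2 I0)); rewrite le_eqVlt; apply/orP; left; apply/eqP.
  by apply: eq_bigr => k _; rewrite [in RHS]ip_cosf_prim ?addr0//; [exact: sH2|exact: H2L].
rewrite mulr_natl mulr2n; apply: lerD; (apply: sum_cosf_prim => //; first by [exact: sH1|exact: sH2];
  first by [exact: H1L|exact: H2L]) => n; apply: le_trans (energy_le n); apply: ler_sum => k _.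
  by rewrite !addr0 lerDl sqr_ge0.
by rewrite !addr0 lerDr sqr_ge0.
Qed.

End difference.
End reduced_estimates.

(** * Weak derivatives *)

Section cutoff.
Context {R : realType}.
Implicit Types (L x a : R) (f g psi : R -> R).

Lemma test_function_derive L psi n x : test_function L psi ->
  is_derive x 1 (derive1n n psi) (derive1n n.+1 psi x).
Proof.
by move=> [smooth _]; rewrite derive1nS derive1E; apply: derivableP; exact: smooth.
Qed.

Lemma test_function_continuous L psi n : test_function L psi -> continuous (derive1n n psi).
Proof. by move=> h; apply: continuous_is_derive => x; exact: test_function_derive h. Qed.

(** A test function vanishes in a neighbourhood of each end, hence so do its derivatives. This
    removes boundary terms in integrations by parts. *)
Lemma test_function_end L psi n x : test_function L psi -> `|x| = L -> derive1n n psi x = 0.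
Proof.
move=> tpsi xL; have [_ [a [b [La bL out]]]] := tpsi.
have near0 m : \forall y \near x, derive1n m psi y = 0.
  elim: m => [|m IH].
    have [->|->] : x = L \/ x = - L.
      by rewrite -xL; case: (ger0P x) => _; [left|right; rewrite opprK].
      by near=> y; rewrite derive1n0; apply: out; apply/negP; rewrite negb_and -!ltNge orbC;
        apply/orP; left; near: y; exact: lt_nbhsr.
    by near=> y; rewrite derive1n0; apply: out; apply/negP; rewrite negb_and -!ltNge;
      apply/orP; left; near: y; exact: lt_nbhsl.
  move/near_join: IH; apply: filterS => y near_y.
  have near_y' : \forall z \near y, cst 0 z = derive1n m psi z.
    by apply: filterS near_y => z ->.
  have h := near_eq_is_derive near_y' (is_derive_cst 0 y 1).
  by have [_ <-] := test_function_derive m y tpsi; have [_ ->] := h.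
exact: nbhs_singleton (near0 n).
Unshelve. all: by end_near. Qed.

(** The two ramps have width 1 / a and stay at distance 1 / a from the ends of I, which makes the
    support compact in I. *)
Definition cutoff L a x : R :=
  step (a * (x + (L - a^-1))) * step ((- a) * (x + (a^-1 - L))).

Lemma elementary_cutoff L a : elementary (cutoff L a).
Proof. by apply: elementary_mul; exact: elementary_step. Qed.

Lemma cutoff_out L a x : 0 < a -> ~ (- L + a^-1 <= x <= L - a^-1) -> cutoff L a x = 0.
Proof.
move=> a0 nx; rewrite /cutoff; have [h|h] := ltP x (- L + a^-1).
  rewrite step_le0 ?mul0r//; apply: mulr_ge0_le0; first exact: ltW.
  by move: h; move: (a^-1) => c; lra.
have [h'|h'] := ltP (L - a^-1) x; last by exfalso; apply: nx; rewrite h h'.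
rewrite [X in _ * X]step_le0 ?mulr0// mulNr oppr_le0; apply: mulr_ge0; first exact: ltW.
by move: h'; move: (a^-1) => c; lra.
Qed.

Lemma cutoff_in L a x : 0 < a -> - L + 2 * a^-1 <= x <= L - 2 * a^-1 -> cutoff L a x = 1.
Proof.
move=> a0 /andP[h h']; have aa : a * a^-1 = 1 by rewrite divff// gt_eqF.
have e1 : 1 <= a * (x + (L - a^-1)).
  by rewrite -[leLHS]aa ler_pM2l//; move: h h'; move: (a^-1) => c; lra.
have e2 : 1 <= - a * (x + (a^-1 - L)).
  by rewrite mulNr -mulrN -[leLHS]aa ler_pM2l//; move: h h'; move: (a^-1) => c; lra.
by rewrite /cutoff !step_ge1// mulr1.
Qed.

Lemma cutoff_itv L a x : 0 <= cutoff L a x <= 1.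
Proof.
have /andP[u0 u1] := step_itv (a * (x + (L - a^-1))).
have /andP[v0 v1] := step_itv (- a * (x + (a^-1 - L))).
by rewrite /cutoff mulr_ge0// mulr_ile1.
Qed.

Lemma cutoff_derive : exists2 M, 0 <= M & forall L a, 0 < a -> exists2 dc,
  forall x, is_derive x 1 (cutoff L a) (dc x) & forall x, `|dc x| <= 2 * M * a.
Proof.
have [ds dds [M dsM]] := @step_derive R.
exists M; first by apply: le_trans (dsM 0).
move=> L a a0.
exists (fun x => step (a * (x + (L - a^-1))) * (- a * ds (- a * (x + (a^-1 - L)))) +
    step (- a * (x + (a^-1 - L))) * (a * ds (a * (x + (L - a^-1))))) => x.
  exact: (is_deriveM (is_derive_affine (dds _)) (is_derive_affine (dds _))).
have /andP[u0 u1] := step_itv (a * (x + (L - a^-1))).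
have /andP[v0 v1] := step_itv (- a * (x + (a^-1 - L))).
move: (step _) (step _) u0 u1 v0 v1 => u v u0 u1 v0 v1.
apply: le_trans (ler_normD _ _) _; rewrite !normrM normrN !(ger0_norm (ltW a0)).
rewrite (ger0_norm u0) (ger0_norm v0) -mulrA mulr_natl mulr2n.
by apply: lerD; (rewrite -[leRHS]mul1r; apply: ler_pM => //; first by [exact: mulr_ge0 (ltW a0) _];
  rewrite mulrC ler_wpM2r// ltW).
Qed.

Lemma test_function_cutoff L a f : 0 < a -> elementary f ->
  test_function L (fun x => cutoff L a x * f x).
Proof.
move=> a0 ef; split; first by apply: elementary_smooth; apply: elementary_mul => //; exact: elementary_cutoff.
have a1 : 0 < a^-1 by rewrite invr_gt0.
exists (- L + a^-1), (L - a^-1); split.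
- by rewrite ltrDl.
- by rewrite gtrDl oppr_lt0.
- by move=> x nx; rewrite cutoff_out// mul0r.
Qed.

(* [1 - ray (L - d)] and [ray (- L + d)] are the indicators of the two strips. *)
Lemma ip_strip_le L d f (C : R) : 0 < L -> 0 < d -> d <= L -> sqint L f -> 0 <= C ->
  (forall x, oitv L x -> `|f x| <= C) ->
  (forall x, - L + d < x <= L - d -> f x = 0) -> ip L f f <= C ^+ 2 * (2 * d).
Proof.
move=> L0 d0 dL sf C0 fC f0.
have s1 := sqint_cst L (1 : R).
have r1 := sqint_ray L (- L + d); have r2 := sqint_ray L (L - d).
pose h x := ray (- L + d) x + (1 - ray (L - d) x).
have sh : sqint L h := sqintD r1 (sqintB s1 r2).
have prim1 x : - L <= x <= L -> ip L (fun=> 1) (ray x) = x + L.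
  move=> xL; have c1 : continuous ((fun=> 1) : R -> R) by move=> y; exact: cvg_cst.
  by have := prim_FTC (fun y => is_derive_id y 1) c1 xL; rewrite primE opprK.
have -> : C ^+ 2 * (2 * d) = ip L (fun=> C ^+ 2) h.
  have -> : ip L (fun=> C ^+ 2) h = ip L (fun x => C ^+ 2 * 1) h by apply: eq_ip => // x _; rewrite mulr1.
  rewrite ipZl// ipDr//; last exact: sqintB.
  rewrite ipBr// !prim1; [|lra..].
  have -> : ip L (fun=> 1) (fun=> 1) = 2 * L.
    have <- : ip L (fun=> 1) (ray L) = 2 * L by rewrite prim1 //; lra.
    by apply: eq_ip => // y /set_mem; rewrite oitvE rayE => /andP[_ /ltW->].
  by congr (_ * _); lra.
rewrite !ipE; apply: le_Rintegral; [exact: measurable_oitv|exact: sqint_mul|apply: sqint_mul => //; exact: sqint_cst|].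
move=> x Ix; rewrite -expr2.
have fx : f x ^+ 2 <= C ^+ 2.
  by rewrite -real_normK ?num_real// lerXn2r ?nnegrE// fC.
rewrite /h !rayE; have [h1|h1] := leP x (- L + d).
  apply: le_trans fx _; rewrite ler_peMr ?sqr_ge0//.
  by case: (x <= L - d); rewrite ?subrr ?subr0 ?addr0// lerDl.
have [h2|h2] := leP x (L - d).
  by rewrite f0 ?h1// expr0n subrr addr0 mulr0.
by rewrite subr0 add0r mulr1.
Qed.

(** Mean value bound from the nearest end, where the sine vanishes. This smallness will offset the
    slope of the cutoff. *)
Lemma sinf_strip L k x d : 0 < L -> oitv L x -> x <= - L + d \/ L - d < x ->
  `|sinf L k x| <= freq L k * (Num.sqrt L)^-1 * d.
Proof.
move=> L0; rewrite oitvE => /andP[xl xr] side.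
have s0 : 0 <= (Num.sqrt L)^-1 by rewrite invr_ge0 sqrtr_ge0.
have f0 : 0 <= freq L k.
  by case: k {side} => [|k]; rewrite ?freq0// ltW// freq_gt0.
have cos_le y : `|freq L k * cosf L k y| <= freq L k * (Num.sqrt L)^-1.
  rewrite normrM (ger0_norm f0); case: (k) => [|j]; first by rewrite freq0 !mul0r.
  rewrite ler_wpM2l ?(ltW (freq_gt0 _ _))//= normrM (ger0_norm s0) ler_piMr//.
  by rewrite ler_norml cos_geN1 cos_le1.
have csin a b : {within `[a, b], continuous (sinf L k)}.
  by apply: continuous_subspaceT; exact: continuous_sinf.
have M0 : 0 <= freq L k * (Num.sqrt L)^-1 by exact: mulr_ge0.
case: side => [xd|xd].
  have := mean_value_bound (ltW xl) (fun y _ => is_derive_sinf L k y) (csin _ _) (fun y _ => cos_le y).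
  by rewrite sinf_left subr0 => /le_trans; apply; rewrite ler_wpM2l//; lra.
have := mean_value_bound (ltW xr) (fun y _ => is_derive_sinf L k y) (csin _ _) (fun y _ => cos_le y).
by rewrite (sinf_right L0) sub0r normrN => /le_trans; apply; rewrite ler_wpM2l//; lra.
Qed.

(** The sine times a cutoff. The slope of the cutoff is O(a), but it meets a sine of size O(1/a), so
    the error in the derivative is bounded, and it lives on strips of measure O(1/a). *)
Lemma sinf_test_approx L k (e : R) : 0 < L -> 0 < e -> exists psi, [/\ test_function L psi,
  ip L (fun x => psi x - sinf L k x) (fun x => psi x - sinf L k x) <= e &
  ip L (fun x => derive1 psi x - freq L k * cosf L k x)
       (fun x => derive1 psi x - freq L k * cosf L k x) <= e].
Proof.
move=> L0 e0.
have [M M0 dcut] := cutoff_derive.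
pose C0 := freq L k * (Num.sqrt L)^-1.
have s0 : 0 <= (Num.sqrt L)^-1 by rewrite invr_ge0 sqrtr_ge0.
have f0 : 0 <= freq L k.
  by case: (k) => [|j]; rewrite ?freq0// ltW// freq_gt0.
have C00 : 0 <= C0 by exact: mulr_ge0.
(* Pointwise bounds of the two errors. In C2 the first term is |sinf| <= 3 C0 / a times the cutoff
   slope 2 M a. *)
pose C1 := (Num.sqrt L)^-1; pose C2 := 6 * M * C0 + C0.
pose C := C1 + C2.
have C20 : 0 <= C2 by apply: addr_ge0 => //; apply: mulr_ge0 => //; exact: mulr_ge0.
have CC : 0 <= C by rewrite addr_ge0.
(* The strips of width 3 / a must fit into I, and the squared error C^2 (6 / a) must not exceed
   e. *)
pose a := 3 / L + 6 * C ^+ 2 / e + 1.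
have a_gt0 : 0 < a.
  by rewrite /a addrC ltr_pwDl// addr_ge0// divr_ge0// ?mulr_ge0 ?sqr_ge0 ?(ltW L0) ?(ltW e0).
have ai : 0 < a^-1 by rewrite invr_gt0.
have aL : 3 * a^-1 <= L.
  rewrite ler_pdivrMr// mulrC -ler_pdivrMr// /a -addrA lerDl.
  by rewrite addr_ge0// divr_ge0 ?mulr_ge0 ?sqr_ge0// ltW.
have ae : C ^+ 2 * (2 * (3 * a^-1)) <= e.
  have -> : C ^+ 2 * (2 * (3 * a^-1)) = 6 * C ^+ 2 / a by ring.
  rewrite ler_pdivrMr// -ler_pdivrMl// mulrC /a addrAC lerDr.
  by rewrite addr_ge0// divr_ge0// ltW.
have d0 : 0 < 3 * a^-1 by rewrite mulr_gt0.
have [dc ddc dcM] := dcut L a a_gt0.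
pose psi x := cutoff L a x * sinf L k x.
have tpsi : test_function L psi by apply: test_function_cutoff => //; exact: elementary_sinf.
have cpsi : continuous psi := test_function_continuous (n := 0) tpsi.
have dpsi : continuous (derive1 psi) := test_function_continuous (n := 1) tpsi.
have dpsiE x : derive1 psi x = cutoff L a x * (freq L k * cosf L k x) + sinf L k x * dc x.
  by rewrite derive1E; have [_ ->] := is_deriveM (ddc x) (is_derive_sinf L k x).
have le3 x : - L + 3 * a^-1 < x <= L - 3 * a^-1 ->
    - L + 2 * a^-1 < x < L - 2 * a^-1.
  by move: ai; move: (a^-1) => c *; lra.
have C_sqr D : 0 <= D -> D <= C -> D ^+ 2 * (2 * (3 * a^-1)) <= e.
  move=> D0 DC; apply: le_trans ae; rewrite ler_wpM2r ?mulr_ge0// ?(ltW ai)//.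
  by rewrite lerXn2r ?nnegrE.
exists psi; split => //.
- have s1 : sqint L (fun x => psi x - sinf L k x).
    by apply: sqintB; [exact: sqint_continuous|exact: sqint_sinf].
  apply: le_trans (C_sqr C1 s0 _); last by rewrite /C lerDl.
  apply: (ip_strip_le L0 d0 aL s1 s0).
    move=> x _; have /andP[c0 c1] := cutoff_itv L a x.
    rewrite /psi -{2}[sinf L k x]mul1r -mulrBl normrM distrC.
    have sl : `|sinf L k x| <= C1.
      rewrite normrM (ger0_norm s0) ler_piMr// ler_norml sin_geN1 sin_le1//.
    rewrite -[leRHS]mul1r; apply: ler_pM => //; rewrite ger0_norm; lra.
  move=> x /le3/andP[/ltW x1 /ltW x2].
  by rewrite /psi cutoff_in ?x1// mul1r subrr.
- have s1 : sqint L (fun x => derive1 psi x - freq L k * cosf L k x).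
    by apply: sqintB; [exact: sqint_continuous|apply: sqintZ; exact: sqint_cosf].
  apply: le_trans (C_sqr C2 C20 _); last by rewrite /C lerDr.
  have inside x : - L + 3 * a^-1 < x <= L - 3 * a^-1 -> derive1 psi x - freq L k * cosf L k x = 0.
    move=> /le3/andP[x1 x2]; apply/eqP; rewrite subr_eq0; apply/eqP.
    have near1 : \forall y \near x, sinf L k y = psi y.
      near=> y; rewrite /psi cutoff_in ?mul1r//; apply/andP; split; apply: ltW; near: y.
        exact: lt_nbhsr.
      exact: lt_nbhsl.
    by rewrite derive1E; have [_ ->] := near_eq_is_derive near1 (is_derive_sinf L k x).
  apply: (ip_strip_le L0 d0 aL s1 C20) => // x Ix.
  have [/inside->|xout] := boolP (- L + 3 * a^-1 < x <= L - 3 * a^-1); first by rewrite normr0.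
  have side : x <= - L + 3 * a^-1 \/ L - 3 * a^-1 < x.
    by move: xout; rewrite negb_and -leNgt -ltNge => /orP[]; [left|right].
  have sl := sinf_strip k L0 Ix side; have /andP[c0 c1] := cutoff_itv L a x.
  have cl : `|freq L k * cosf L k x| <= C0.
    rewrite normrM (ger0_norm f0) /C0; case: (k) => [|j]; first by rewrite freq0 !mul0r.
    rewrite ler_wpM2l ?(ltW (freq_gt0 _ _))//= normrM (ger0_norm s0) ler_piMr//.
    by rewrite ler_norml cos_geN1 cos_le1.
  rewrite dpsiE addrAC -{2}[freq L k * _]mul1r -mulrBl.
  apply: le_trans (ler_normD _ _) _; rewrite addrC; apply: lerD.
    rewrite normrM; apply: le_trans (ler_pM _ _ sl (dcM x)) _ => //.
    have aa : a^-1 * a = 1 by rewrite mulVf// gt_eqF.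
    have -> : freq L k / Num.sqrt L * (3 / a) * (2 * M * a) = 6 * M * C0 * (a^-1 * a) by rewrite /C0; ring.
    by rewrite aa mulr1.
  rewrite normrM -[leRHS]mul1r; apply: ler_pM => //; rewrite distrC ger0_norm; lra.
Unshelve. all: by end_near. Qed.

End cutoff.

(** * Functions with a weak derivative as primitives *)

Section weak_derivatives.
Context {R : realType} (L : R).
Hypothesis L0 : 0 < L.
Notation mu := (@lebesgue_measure R).
Notation I := (oitv L).
Implicit Types (f g psi : R -> R).

Definition wderiv f g : Prop := forall psi, test_function L psi ->
  ip L f (derive1 psi) = - ip L g psi.

Lemma sqint_test psi n : test_function L psi -> sqint L (derive1n n psi).
Proof. by move=> tpsi; apply: sqint_continuous; exact: test_function_continuous tpsi. Qed.

Lemma prim_test_parts g psi n : sqint L g -> test_function L psi ->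
  ip L (prim L g) (derive1n n.+1 psi) = - ip L g (derive1n n psi).
Proof.
move=> sg tpsi.
rewrite (prim_parts L0 sg (fun x => test_function_derive n x tpsi)).
  by rewrite (test_function_end _ tpsi) ?mulr0 ?sub0r// ger0_norm// ltW.
exact: test_function_continuous tpsi.
Qed.

Lemma ip_cst_test (c : R) psi n : test_function L psi ->
  ip L (fun=> c) (derive1n n.+1 psi) = 0.
Proof.
move=> tpsi; have cpsi := test_function_continuous (n := n.+1) tpsi.
have dpsi x := test_function_derive n x tpsi.
have spsi := sqint_test n.+1 tpsi; have s1 := sqint_cst L (1 : R).
have -> : ip L (fun=> c) (derive1n n.+1 psi) = ip L (fun x => c * 1) (derive1n n.+1 psi).
  by apply: eq_ip => // x _; rewrite mulr1.
rewrite ipZl// ipC.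
have -> : ip L (derive1n n.+1 psi) (fun=> 1) = prim L (derive1n n.+1 psi) L.
  by rewrite primE; apply: eq_ip => // x /set_mem; rewrite oitvE rayE => /andP[_ /ltW->].
rewrite (prim_FTC dpsi cpsi); last by have := L0; lra.
by rewrite !(test_function_end _ tpsi) ?subrr ?mulr0 ?normrN ?ger0_norm// ltW.
Qed.

Lemma prim_cst_test_parts (c : R) g psi n : sqint L g -> test_function L psi ->
  ip L (fun x => c + prim L g x) (derive1n n.+1 psi) = - ip L g (derive1n n psi).
Proof.
move=> sg tpsi; have sp := sqint_prim sg; have sc := sqint_cst L c.
by rewrite ipDl//; [rewrite ip_cst_test// add0r prim_test_parts|exact: sqint_test].
Qed.

(** The du Bois-Reymond lemma on Fourier coefficients: derivatives of test functions approximate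
    freq times each nonconstant cosine, by [sinf_test_approx]. *)
Lemma ip_cosf_eq0 f : sqint L f -> (forall psi, test_function L psi -> ip L f (derive1 psi) = 0) ->
  forall k, ip L f (cosf L k.+1) = 0.
Proof.
move=> sf H k; have fk := freq_gt0 L0 k.
suff : `|freq L k.+1 * ip L f (cosf L k.+1)| <= 0.
  by rewrite normr_le0 mulf_eq0 gt_eqF//= => /eqP.
apply/ler_addgt0Pr => e e0; rewrite add0r.
have e1 : 0 < e ^+ 2 / (ip L f f + 1) by rewrite divr_gt0 ?exprn_gt0// ltr_wpDl// ip_ge0.
have [psi [tpsi _ Hpsi]] := sinf_test_approx k.+1 L0 e1.
have spsi := sqint_test 1 tpsi; rewrite derive1n1 in spsi.
have sc : sqint L (fun x => freq L k.+1 * cosf L k.+1 x) by apply: sqintZ; exact: sqint_cosf.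
have -> : freq L k.+1 * ip L f (cosf L k.+1) =
    - ip L f (fun x => derive1 psi x - freq L k.+1 * cosf L k.+1 x).
  by rewrite ipBr// H// sub0r opprK ipZr//; exact: sqint_cosf.
rewrite normrN; apply: le_trans (ip_cauchy_sqrt sf (sqintB spsi sc)) _.
rewrite -sqrtrM ?ip_ge0//; apply: sqr_le_of_le; first exact: ltW.
apply: (@le_trans _ _ (ip L f f * (e ^+ 2 / (ip L f f + 1)))).
  by rewrite ler_wpM2l// ip_ge0.
have := ip_ge0 L f; move: (ip L f f) => A A0.
by rewrite mulrCA ler_piMr ?sqr_ge0// ler_pdivrMr ?mul1r ?lerDl// ltr_wpDl.
Qed.

Lemma ip1_cosf k : ip L (fun=> 1) (cosf L k.+1) = 0.
Proof.
have s : Num.sqrt (2 * L) != 0 by rewrite gt_eqF// sqrtr_gt0 mulr_gt0.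
have -> : ip L (fun=> 1) (cosf L k.+1) = ip L (fun x => Num.sqrt (2 * L) * cosf L 0 x) (cosf L k.+1).
  by apply: eq_ip => // x _ /=; rewrite divff.
by rewrite ipZl ?ip_cosf ?mulr0//; exact: sqint_cosf.
Qed.

Lemma eq0_ae_of_cosf f : sqint L f -> (forall k, ip L f (cosf L k) = 0) ->
  ip L f f = 0.
Proof.
move=> sf H; apply/eqP; rewrite eq_le ip_ge0 andbT; apply: parseval_le => // n.
by rewrite big1// => k _; rewrite H expr0n.
Qed.

(** The difference f - prim g has zero weak derivative, so its nonconstant cosine coefficients
    vanish; c matches the constant one, and completeness concludes. *)
Lemma wderiv_rep f g : sqint L f -> sqint L g -> wderiv f g ->
  exists c, {ae mu, forall x, I x -> f x = c + prim L g x}.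
Proof.
move=> sf sg fg; have sp := sqint_prim sg.
have s1 := sqint_cst L (1 : R).
pose h x := f x - prim L g x.
have sh : sqint L h := sqintB sf sp.
pose c := ip L h (cosf L 0) / ip L (fun=> 1) (cosf L 0).
have n1 : ip L (fun=> 1) (cosf L 0) != 0.
  have -> : ip L (fun=> 1) (cosf L 0) = ip L (fun x => Num.sqrt (2 * L) * cosf L 0 x) (cosf L 0).
    by apply: eq_ip => // x _ /=; rewrite divff// gt_eqF// sqrtr_gt0 mulr_gt0.
  rewrite ipZl ?ip_cosf//; [|exact: sqint_cosf..].
  by rewrite eqxx mulr1 gt_eqF// sqrtr_gt0 mulr_gt0.
pose v x := h x - c * 1.
have sv : sqint L v := sqintB sh (sqintZ c s1).
have hv psi : test_function L psi -> ip L h (derive1 psi) = 0.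
  move=> tpsi; have spsi := sqint_test 1 tpsi; rewrite derive1n1 in spsi.
  rewrite ipBl// fg//; have := prim_test_parts 0 sg tpsi.
  by rewrite derive1n1 derive1n0 => ->; rewrite subrr.
exists c; have v0 : ip L v v = 0.
  apply: eq0_ae_of_cosf => // -[|k].
    rewrite ipBl ?ipZl//; [|exact: sqint_cosf|exact: sqintZ|exact: sqint_cosf].
    by rewrite /c divfK// subrr.
  rewrite ipBl ?ipZl//; [|exact: sqint_cosf|exact: sqintZ|exact: sqint_cosf].
  by rewrite ip1_cosf mulr0 subr0 ip_cosf_eq0.
apply: filterS (ip_eq0_ae sv v0); first exact: (ae_filter_ringOfSetsType mu).
by move=> x H /H; rewrite /v /h mulr1; lra.
Qed.

(** Turns almost everywhere relations between continuous functions into relations on the closed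
    interval: a nonempty open interval has positive measure and cannot lie in the exceptional
    set. *)
Lemma ae_dense (P : R -> Prop) x (d : R) : {ae mu, forall y, I y -> P y} ->
  - L <= x <= L -> 0 < d -> exists y, [/\ I y, `|y - x| < d & P y].
Proof.
move=> [A [mA A0 NA]] xL d0; apply: contrapT => nex.
have := L0 => L0'.
pose a := Num.max (- L) (x - d); pose b := Num.min L (x + d).
have ab : a < b by rewrite gt_max !lt_min; lra.
have sub : `]a, b[%classic `<=` A.
  move=> y; rewrite /= in_itv/= gt_max lt_min => /andP[/andP[y1 y2] /andP[y3 y4]].
  apply: NA => /= H; apply: nex; exists y.
  have Iy : I y by rewrite oitvE y1.
  by split => //; [rewrite ltr_norml; lra|exact: H].
have : (mu `]a, b[%classic <= mu A)%E by apply: le_measure; rewrite ?inE.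
rewrite A0 lebesgue_measure_itv/= lte_fin ab -EFinB lee_fin; lra.
Qed.

Lemma ae_eq_continuous (f g : R -> R) : continuous f -> continuous g ->
  {ae mu, forall x, I x -> f x = g x} -> forall x, - L <= x <= L -> f x = g x.
Proof.
move=> cf cg fg x xL; apply/eqP; rewrite -subr_eq0 -normr_le0; apply/ler_addgt0Pr => e e0.
rewrite add0r; have c : {for x, continuous (fun y => f y - g y)} by apply: cvgB; [exact: cf|exact: cg].
have /cvgrPdist_le/(_ e e0)/nbhs_ballP[d /= d0 Hd] := c.
have [y [_ yx fgy]] := ae_dense fg xL d0.
by have := Hd y; rewrite /ball/= distrC => /(_ yx); rewrite fgy subrr subr0.
Qed.

Lemma ae_le_continuous (f : R -> R) (M : R) : continuous f ->
  {ae mu, forall x, I x -> f x <= M} -> forall x, - L <= x <= L -> f x <= M.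
Proof.
move=> cf fM x xL; apply/ler_addgt0Pr => e e0.
have /cvgrPdist_le/(_ e e0)/nbhs_ballP[d /= d0 Hd] := cf x.
have [y [_ yx fy]] := ae_dense fM xL d0.
by have := Hd y; rewrite /ball/= distrC => /(_ yx); rewrite ler_norml; lra.
Qed.

Lemma ip_prim_cst_eq0 g (c : R) : sqint L g ->
  (forall x, - L <= x <= L -> prim L g x = c) -> ip L g g = 0.
Proof.
move=> sg H; have := L0 => L0'.
have c0 : c = 0 by rewrite -(H (- L)) ?prim_le//; lra.
apply: eq0_ae_of_cosf => // k; rewrite ip_cosf_prim//; last by rewrite H ?c0//; lra.
have -> : ip L (prim L g) (sinf L k) = ip L (fun x => 0 * sinf L k x) (sinf L k).
  apply: eq_ip => // x /set_mem; rewrite oitvE => /andP[/ltW x1 /ltW x2].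
  by rewrite H ?c0 ?mul0r// x1.
by rewrite ipZl ?mul0r ?mulr0//; exact: sqint_sinf.
Qed.

Lemma wderiv_unique f g g' : sqint L f -> sqint L g -> sqint L g' ->
  wderiv f g -> wderiv f g' -> {ae mu, forall x, I x -> g x = g' x}.
Proof.
move=> sf sg sg' fg fg'.
have [c Hc] := wderiv_rep sf sg fg; have [c' Hc'] := wderiv_rep sf sg' fg'.
have cp (a : R) h : sqint L h -> continuous (fun x => a + prim L h x).
  by move=> sh x; apply: cvgD; [exact: cvg_cst|exact: continuous_prim].
have H : {ae mu, forall x, I x -> c + prim L g x = c' + prim L g' x}.
  apply: filterS2 Hc Hc'; first exact: (ae_filter_ringOfSetsType mu).
  by move=> x H H' Ix; rewrite -H// -H'.
have E := ae_eq_continuous (cp c _ sg) (cp c' _ sg') H.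
have D : ip L (fun x => g x - g' x) (fun x => g x - g' x) = 0.
  apply: (@ip_prim_cst_eq0 _ (c' - c)); first exact: sqintB.
  by move=> x xL; rewrite primB//; have := E x xL; lra.
apply: filterS (ip_eq0_ae (sqintB sg sg') D); first exact: (ae_filter_ringOfSetsType mu).
by move=> x H' /H'; lra.
Qed.

(** Transfers the boundary limits of f to values of its continuous representative h. *)
Lemma ae_limit_end (f : R -> R) (h : R -> R) (x0 l : R) : continuous h -> - L <= x0 <= L ->
  {ae mu, forall x, I x -> f x = h x} ->
  (forall e : R, 0 < e -> exists2 d, 0 < d & forall x, I x -> `|x - x0| < d -> `|f x - l| <= e) ->
  h x0 = l.
Proof.
move=> ch x0L fh H; apply/eqP; rewrite -subr_eq0 -normr_le0; apply/ler_addgt0Pr => e e0.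
rewrite add0r; have e2 : 0 < e / 2 by lra.
have [d1 d10 H1] := H _ e2.
have /cvgrPdist_le/(_ _ e2)/nbhs_ballP[d2 /= d20 H2] := ch x0.
have d0 : 0 < Num.min d1 d2 by rewrite lt_min d10.
have [y [Iy + fy]] := ae_dense fh x0L d0; rewrite lt_min => /andP[yd1 yd2].
have := H1 y Iy yd1; have := H2 y; rewrite /ball/= distrC => /(_ yd2); rewrite fy.
by move=> a b; have := ler_distD (h y) (h x0) l; lra.
Qed.

End weak_derivatives.

(** * Norms of complex-valued functions *)

Section complex_norms.
Context {R : realType} (L : R).
Hypothesis L0 : 0 < L.
Notation mu := (@lebesgue_measure R).
Notation I := (oitv L).
Implicit Types (f h : R -> R[i]) (g psi : R -> R).

Definition csqint f : Prop :=
  sqint L (fun x => complex.Re (f x)) /\ sqint L (fun x => complex.Im (f x)).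

Definition cnormsq f : R :=
  ip L (fun x => complex.Re (f x)) (fun x => complex.Re (f x)) +
  ip L (fun x => complex.Im (f x)) (fun x => complex.Im (f x)).

Definition cmeasurable f : Prop :=
  measurable_fun I (fun x => complex.Re (f x)) /\ measurable_fun I (fun x => complex.Im (f x)).

Lemma cnormsq_ge0 f : 0 <= cnormsq f.
Proof. by rewrite addr_ge0 ?ip_ge0. Qed.

Lemma L2norm_integral f :
  L2norm L f = ((\int[mu]_(x in I) (normc (f x) ^+ 2)%:E) `^ 2^-1)%E.
Proof.
rewrite /L2norm /Lpnorm unlock /=; congr (_ `^ _)%E.
rewrite [RHS]integral_mkcond; apply: eq_integral => x _; rewrite /patch.
case: ifP => _; last by rewrite abse0 /= powR0// pnatr_eq0.
by rewrite /= ger0_norm ?normc_ge0// powR_mulrn ?normc_ge0.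
Qed.

Lemma integral_sqint g : sqint L g ->
  (\int[mu]_(x in I) (g x ^+ 2)%:E)%E = (ip L g g)%:E.
Proof.
move=> sg; rewrite ipE /Rintegral fineK; last first.
  by apply: integrable_fin_num; [exact: measurable_oitv|exact: sqint_mul].
by apply: eq_integral => x _; rewrite expr2.
Qed.

Lemma L2normE f : csqint f -> L2norm L f = (Num.sqrt (cnormsq f))%:E.
Proof.
move=> [s1 s2]; rewrite L2norm_integral -powR12_sqrt ?cnormsq_ge0// -poweR_EFin; congr (_ `^ _)%E.
rewrite /cnormsq EFinD -!integral_sqint//.
under eq_integral do rewrite normc_sqr EFinD.
have mI := measurable_oitv L.
rewrite ge0_integralD//.
- by move=> x _; rewrite lee_fin sqr_ge0.
- exact: measurable_int s1.2.
- by move=> x _; rewrite lee_fin sqr_ge0.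
- exact: measurable_int s2.2.
Qed.

Lemma sqint_of_lty g h : measurable_fun I g -> (forall x, I x -> `|g x| <= normc (h x)) ->
  cmeasurable h -> (L2norm L h < +oo)%E -> sqint L g.
Proof.
move=> mg gh [m1 m2]; rewrite L2norm_integral => hoo; split=> //.
have mg2 : measurable_fun I (EFin \o (fun x => g x ^+ 2)).
  by apply/measurable_EFinP; exact: measurable_funX.
apply/integrableP; split => //.
have h2 : (\int[mu]_(x in I) (normc (h x) ^+ 2)%:E < +oo)%E.
  by apply: (lty_poweRy _ hoo); rewrite invr_neq0// pnatr_eq0.
apply: le_lt_trans h2; apply: ge0_le_integral => //.
- exact: measurable_oitv.
- exact: measurableT_comp.
- apply/measurable_EFinP; under eq_fun do rewrite normc_sqr.
  by apply: measurable_funD; exact: measurable_funX.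
- move=> x Ix; rewrite lee_fin ger0_norm ?sqr_ge0// -real_normK ?num_real//.
  by rewrite lerXn2r ?nnegrE ?normc_ge0// gh.
Qed.

Lemma csqint_of_lty f : cmeasurable f -> (L2norm L f < +oo)%E -> csqint f.
Proof.
move=> mf foo; have [m1 m2] := mf; split.
  by apply: sqint_of_lty foo => // x _; exact: Re_le_normc.
by apply: sqint_of_lty foo => // x _; exact: Im_le_normc.
Qed.

Lemma sqint_integrable g : sqint L g -> mu.-integrable I (EFin \o g).
Proof.
move=> sg; have := sqint_mul sg (sqint_cst L 1).
by under [X in integrable _ _ (_ \o X) -> _]eq_fun do rewrite mulr1.
Qed.

Lemma open_oitv : open I.
Proof. exact: interval_open. Qed.

Lemma sqint_locally g : sqint L g -> locally_integrable I g.
Proof.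
move=> sg; split; [exact: sg.1|exact: open_oitv|] => K KI cK.
have /integrableP[mg ig] := sqint_integrable sg.
apply: le_lt_trans ig; apply: ge0_subset_integral => //.
- exact: compact_measurable.
- exact: measurable_oitv.
- by apply/measurable_EFinP; apply: measurableT_comp => //; exact: sg.1.
Qed.

Lemma csqint_locally f : csqint f -> clocally_integrable L f.
Proof. by move=> [s1 s2]; split; exact: sqint_locally. Qed.

Lemma clocally_measurable f : clocally_integrable L f -> cmeasurable f.
Proof. by move=> [[m1 _ _] [m2 _ _]]. Qed.

Lemma Re_mulC (z : R[i]) (r : R) : complex.Re (z * r%:C) = complex.Re z * r.
Proof. by case: z => a b /=; rewrite mulr0 subr0. Qed.

Lemma Im_mulC (z : R[i]) (r : R) : complex.Im (z * r%:C) = complex.Im z * r.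
Proof. by case: z => a b /=; rewrite mulr0 add0r. Qed.

Lemma cintegral_test f psi : cintegral L (fun x => f x * (psi x)%:C) =
  ip L (fun x => complex.Re (f x)) psi +i* ip L (fun x => complex.Im (f x)) psi.
Proof.
by rewrite /cintegral !ipE; congr (_ +i* _); apply: eq_Rintegral => x _; rewrite ?Re_mulC ?Im_mulC.
Qed.

Lemma weak_derivP f h : weak_deriv L f h <->
  [/\ clocally_integrable L f, clocally_integrable L h,
    wderiv L (fun x => complex.Re (f x)) (fun x => complex.Re (h x)) &
    wderiv L (fun x => complex.Im (f x)) (fun x => complex.Im (h x))].
Proof.
split=> [[lf lh H]|[lf lh H1 H2]]; split => // psi tpsi.
- by have := H psi tpsi; rewrite !cintegral_test => -[->].
- by have := H psi tpsi; rewrite !cintegral_test => -[_ ->].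
- by rewrite !cintegral_test H1// H2.
Qed.

Lemma H1_pairE f h : csqint f -> csqint h ->
  ((L2norm L f `^ 2 + L2norm L h `^ 2) `^ 2^-1)%E = (Num.sqrt (cnormsq f + cnormsq h))%:E.
Proof.
move=> sf sh; rewrite !L2normE// [X in (X + _)%E]poweR_EFin [X in (_ + X)%E]poweR_EFin -EFinD poweR_EFin powR12_sqrt.
  by rewrite !powR_mulrn ?sqrtr_ge0// !sqr_sqrtr ?cnormsq_ge0.
by rewrite addr_ge0// powR_ge0.
Qed.

(** H^1 functions with zero limit at -L, given through their weak derivative g1 + i g2. The
    condition at the right end is stated separately, as vanishing of the primitives at L. *)
Definition primitive_of f (g1 g2 : R -> R) : Prop := [/\ csqint f, sqint L g1, sqint L g2,
  {ae mu, forall x, I x -> complex.Re (f x) = prim L g1 x} &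
  {ae mu, forall x, I x -> complex.Im (f x) = prim L g2 x}].

Lemma ip_ae_sqr g g' : sqint L g -> sqint L g' -> {ae mu, forall x, I x -> g x = g' x} ->
  ip L g g = ip L g' g'.
Proof. by move=> sg sg' gg; rewrite (ip_ae sg sg' sg gg) ipC (ip_ae sg sg' sg' gg). Qed.

Lemma primitive_cnormsq f g1 g2 : primitive_of f g1 g2 ->
  cnormsq f = ip L (prim L g1) (prim L g1) + ip L (prim L g2) (prim L g2).
Proof.
move=> [[s1 s2] t1 t2 e1 e2]; rewrite /cnormsq.
by rewrite (ip_ae_sqr s1 (sqint_prim t1) e1) (ip_ae_sqr s2 (sqint_prim t2) e2).
Qed.

Lemma primitive_L2norm f g1 g2 : primitive_of f g1 g2 -> L2norm L f =
  (Num.sqrt (ip L (prim L g1) (prim L g1) + ip L (prim L g2) (prim L g2)))%:E.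
Proof. by move=> pf; rewrite -(primitive_cnormsq pf) L2normE//; case: pf. Qed.

Lemma wderiv_ae (f f' g : R -> R) : sqint L f -> sqint L f' ->
  {ae mu, forall x, I x -> f x = f' x} -> wderiv L f' g -> wderiv L f g.
Proof.
move=> sf sf' ff H psi tpsi; rewrite -H//; apply: ip_ae => //.
by have := sqint_test 1 tpsi; rewrite derive1n1.
Qed.

Lemma prim_wderiv g : sqint L g -> wderiv L (prim L g) g.
Proof.
by move=> sg psi tpsi; have := prim_test_parts L0 0 sg tpsi; rewrite derive1n1 derive1n0.
Qed.

Lemma primitive_weak_deriv f g1 g2 : primitive_of f g1 g2 ->
  weak_deriv L f (fun x => g1 x +i* g2 x).
Proof.
move=> [[s1 s2] t1 t2 e1 e2]; apply/weak_derivP; split.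
- exact: csqint_locally.
- exact: csqint_locally.
- exact: wderiv_ae s1 (sqint_prim t1) e1 (prim_wderiv t1).
- exact: wderiv_ae s2 (sqint_prim t2) e2 (prim_wderiv t2).
Qed.

(** The infimum is attained at g1 + i g2: a competitor of finite norm is another weak derivative,
    hence equal to it almost everywhere, and the others give +oo. *)
Lemma primitive_H1norm f g1 g2 : primitive_of f g1 g2 ->
  H1norm L f = (Num.sqrt (h1sq L g1 + h1sq L g2))%:E.
Proof.
move=> pf; have [sf t1 t2 e1 e2] := pf.
have wd := primitive_weak_deriv pf.
have sg : csqint (fun x => g1 x +i* g2 x) by split.
have E : (Num.sqrt (h1sq L g1 + h1sq L g2))%:E =
    ((L2norm L f `^ 2 + L2norm L (fun x => g1 x +i* g2 x) `^ 2) `^ 2^-1)%E.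
  rewrite H1_pairE// (primitive_cnormsq pf) /cnormsq/= /h1sq; congr (Num.sqrt _)%:E.
  by rewrite addrACA [RHS]addrC.
apply/eqP; rewrite eq_le; apply/andP; split.
  by rewrite E; apply: ereal_inf_lbound; exists (fun x => g1 x +i* g2 x).
apply: le_ereal_inf_tmp => _ [h wh <-].
have /weak_derivP[lf lh w1 w2] := wh; have /weak_derivP[_ _ v1 v2] := wd.
have [hoo|] := ltP (L2norm L h) +oo%E; last first.
  rewrite leye_eq => /eqP->; rewrite L2normE// poweRyr ?pnatr_eq0// addey//.
  by rewrite [leRHS]poweRyr ?leey// invr_eq0 pnatr_eq0.
have sh := csqint_of_lty (clocally_measurable lh) hoo.
have u1 := wderiv_unique L0 sf.1 t1 sh.1 v1 w1.
have u2 := wderiv_unique L0 sf.2 t2 sh.2 v2 w2.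
rewrite E !H1_pairE// lee_fin; apply: ler_wsqrtr; rewrite lerD2l /cnormsq/=.
by rewrite (ip_ae_sqr t1 sh.1 u1) (ip_ae_sqr t2 sh.2 u2).
Qed.

(** A finite infimum exhibits a weak derivative h for which the combined norm is finite, so f and h
    are both square integrable. *)
Lemma memH1_weak_deriv f : memH1 L f -> exists h, [/\ csqint f, csqint h & weak_deriv L f h].
Proof.
move=> [lf foo].
have [_ [h wh <-] hoo] := ereal_inf_lt foo.
have /weak_derivP[_ lh _ _] := wh.
have h1 : (L2norm L f `^ 2 + L2norm L h `^ 2 < +oo)%E.
  by apply: (lty_poweRy _ hoo); rewrite invr_neq0// pnatr_eq0.
have n2 : (2 : R) != 0 by rewrite pnatr_eq0.
have f2 : (L2norm L f < +oo)%E.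
  by apply: (lty_poweRy n2); apply: le_lt_trans h1; rewrite leeDl// poweR_ge0.
have h2 : (L2norm L h < +oo)%E.
  by apply: (lty_poweRy n2); apply: le_lt_trans h1; rewrite leeDr// poweR_ge0.
by exists h; split => //; apply: csqint_of_lty => //; exact: clocally_measurable.
Qed.

Lemma primitive_eq f f' g1 g2 : (forall x, I x -> f x = f' x) ->
  primitive_of f g1 g2 -> primitive_of f' g1 g2.
Proof.
move=> ff [[s1 s2] t1 t2 e1 e2]; split => //.
- by split; [apply: eq_sqint s1|apply: eq_sqint s2] => x /set_mem Ix; rewrite ff.
- by apply: filterS e1; [exact: (ae_filter_ringOfSetsType mu)|] => x H Ix; rewrite -ff// H.
- by apply: filterS e2; [exact: (ae_filter_ringOfSetsType mu)|] => x H Ix; rewrite -ff// H.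
Qed.

Lemma primitive_sub f f' g1 g2 g1' g2' : primitive_of f g1 g2 -> primitive_of f' g1' g2' ->
  primitive_of (fun x => f x - f' x) (fun x => g1 x - g1' x) (fun x => g2 x - g2' x).
Proof.
have ReB (z w : R[i]) : complex.Re (z - w) = complex.Re z - complex.Re w by case: z w => ? ? [].
have ImB (z w : R[i]) : complex.Im (z - w) = complex.Im z - complex.Im w by case: z w => ? ? [].
move=> [[s1 s2] t1 t2 e1 e2] [[s1' s2'] t1' t2' e1' e2']; split.
- split.
    by apply: eq_sqint (sqintB s1 s1') => x _; rewrite ReB.
  by apply: eq_sqint (sqintB s2 s2') => x _; rewrite ImB.
- exact: sqintB.
- exact: sqintB.
- apply: filterS2 e1 e1'; first exact: (ae_filter_ringOfSetsType mu).
  by move=> x H H' Ix; rewrite ReB primB// H// H'.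
- apply: filterS2 e2 e2'; first exact: (ae_filter_ringOfSetsType mu).
  by move=> x H H' Ix; rewrite ImB primB// H// H'.
Qed.

Lemma primitive_Linfnorm f g1 g2 (M : R) : primitive_of f g1 g2 -> 0 <= M ->
  (forall x, - L <= x <= L -> `|prim L g1 x| + `|prim L g2 x| <= M) ->
  (Linfnorm L f <= M%:E)%E.
Proof.
move=> [_ _ _ e1 e2] M0 H; rewrite /Linfnorm /Lpnorm unlock /=.
case: ifP => _; last by rewrite lee_fin.
apply/ess_supP; apply: filterS2 e1 e2; first exact: (ae_filter_ringOfSetsType mu).
move=> x e1 e2; rewrite /= /patch; case: ifPn => [/set_mem Ix|_]; last by rewrite abse0 lee_fin.
rewrite /= lee_fin ger0_norm ?normc_ge0//; apply: le_trans (normc_le_sum _) _.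
rewrite e1// e2// H//; move: Ix; rewrite oitvE => /andP[/ltW-> /ltW->//].
Qed.

Lemma Linfnorm_ae f (M : R) : (Linfnorm L f <= M%:E)%E ->
  {ae mu, forall x, I x -> normc (f x) <= M}.
Proof.
have muT : (0 < mu [set: R])%E.
  apply: (@lt_le_trans _ _ (mu I)); first by rewrite (lebesgue_oitv L0) lte_fin mulr_gt0.
  by apply: le_measure => //; rewrite ?inE//; exact: measurable_oitv.
rewrite /Linfnorm /Lpnorm unlock /= muT => /ess_supP H.
have {}H : {ae mu, forall x, ((abse \o (fun x => (normc (f x))%:E) \_ I) x <= M%:E)%E} := H.
apply: filterS H; first exact: (ae_filter_ringOfSetsType mu).
by move=> x + Ix; rewrite /= /patch mem_set//= lee_fin ger0_norm ?normc_ge0.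
Qed.

Lemma right_end_eps f (l : R[i]) : tends_right_end L f l ->
  forall e : R, 0 < e -> exists2 d, 0 < d & forall x, I x -> `|x - L| < d -> normc (f x - l) <= e.
Proof.
move=> H e e0; have /cvgrPdist_le/(_ e e0) := H.
rewrite /at_left near_withinE => /nbhs_ballP[d /= d0 Hd]; exists d => // x.
rewrite oitvE => /andP[_ xL] xd; have := Hd x; rewrite /ball/= distrC => /(_ xd xL).
by rewrite sub0r normrN ger0_norm ?normc_ge0.
Qed.

Lemma left_end_eps f (l : R[i]) : tends_left_end L f l ->
  forall e : R, 0 < e -> exists2 d, 0 < d & forall x, I x -> `|x - - L| < d -> normc (f x - l) <= e.
Proof.
move=> H e e0; have /cvgrPdist_le/(_ e e0) := H.
rewrite /at_right near_withinE => /nbhs_ballP[d /= d0 Hd]; exists d => // x.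
rewrite oitvE => /andP[xL _] xd; have := Hd x; rewrite /ball/= distrC => /(_ xd xL).
by rewrite sub0r normrN ger0_norm ?normc_ge0.
Qed.

Lemma Re_dist_le (z w : R[i]) : `|complex.Re z - complex.Re w| <= normc (z - w).
Proof. by case: z w => a b [c d]; exact: (Re_le_normc ((a - c) +i* (b - d))). Qed.

Lemma Im_dist_le (z w : R[i]) : `|complex.Im z - complex.Im w| <= normc (z - w).
Proof. by case: z w => a b [c d]; exact: (Im_le_normc ((a - c) +i* (b - d))). Qed.

Lemma ae_limit_end_complex f (h1 h2 : R -> R) (x0 : R) (l : R[i]) :
  continuous h1 -> continuous h2 -> - L <= x0 <= L ->
  {ae mu, forall x, I x -> complex.Re (f x) = h1 x} ->
  {ae mu, forall x, I x -> complex.Im (f x) = h2 x} ->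
  (forall e : R, 0 < e -> exists2 d, 0 < d & forall x, I x -> `|x - x0| < d -> normc (f x - l) <= e) ->
  h1 x0 +i* h2 x0 = l.
Proof.
move=> c1 c2 xL e1 e2 H; rewrite [RHS]complexE -complexE; case: l H => l1 l2 H; congr (_ +i* _).
  apply: (ae_limit_end L0 c1 xL e1) => e e0; have [d d0 Hd] := H e e0; exists d => // x Ix xd.
  by apply: le_trans (Hd x Ix xd); exact: (Re_dist_le (f x) (l1 +i* l2)).
apply: (ae_limit_end L0 c2 xL e2) => e e0; have [d d0 Hd] := H e e0; exists d => // x Ix xd.
by apply: le_trans (Hd x Ix xd); exact: (Im_dist_le (f x) (l1 +i* l2)).
Qed.

Lemma continuous_cst_prim (c : R) g : sqint L g -> continuous (fun x => c + prim L g x).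
Proof. by move=> sg x; apply: cvgD; [exact: cvg_cst|exact: continuous_prim]. Qed.

Lemma memH1_rep f : memH1 L f -> exists c1 c2 g1 g2, [/\ csqint f, sqint L g1, sqint L g2,
  {ae mu, forall x, I x -> complex.Re (f x) = c1 + prim L g1 x} &
  {ae mu, forall x, I x -> complex.Im (f x) = c2 + prim L g2 x}].
Proof.
move=> /memH1_weak_deriv[h [sf sh /weak_derivP[_ _ w1 w2]]].
have [c1 e1] := wderiv_rep L0 sf.1 sh.1 w1; have [c2 e2] := wderiv_rep L0 sf.2 sh.2 w2.
by exists c1, c2, (fun x => complex.Re (h x)), (fun x => complex.Im (h x)); split => //; case: sh.
Qed.

(** The left limit removes the additive constants of [memH1_rep], and the right limit then makes the
    primitives vanish at L. *)
Lemma memH1_primitive f : memH1 L f -> tends_left_end L f 0 -> tends_right_end L f 0 ->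
  exists g1 g2, [/\ primitive_of f g1 g2, prim L g1 L = 0 & prim L g2 L = 0].
Proof.
have L0' := L0; move=> /memH1_rep[c1 [c2 [g1 [g2 [sf s1 s2 e1 e2]]]]] fl fr.
have k1 := continuous_cst_prim (c := c1) s1; have k2 := continuous_cst_prim (c := c2) s2.
have LL : - L <= - L <= L by lra.
have RR : - L <= L <= L by lra.
have := ae_limit_end_complex k1 k2 LL e1 e2 (left_end_eps fl).
rewrite !prim_le// !addr0 => -[c10 c20].
have := ae_limit_end_complex k1 k2 RR e1 e2 (right_end_eps fr).
rewrite c10 c20 !add0r => -[p1 p2]; exists g1, g2; split => //; split => //.
  by apply: filterS e1; [exact: (ae_filter_ringOfSetsType mu)|] => x H Ix; rewrite H// c10 add0r.
by apply: filterS e2; [exact: (ae_filter_ringOfSetsType mu)|] => x H Ix; rewrite H// c20 add0r.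
Qed.

End complex_norms.

(** * From test functions to sines in the equation *)

Section limit_equation.
Context {R : realType}.
Implicit Types (a b : R -> R) (u D N : R -> R -> R).

(** Differentiability of a uniform limit. The mean value theorem for a' minus the line of slope b t
    compares increments over h, and the accuracy of the approximation is chosen proportional to
    |h|. *)
Lemma derive_limit a b (T t d0 : R) : 0 < t < T -> 0 < d0 ->
  (forall e : R, 0 < e -> exists2 d, 0 < d &
    forall s, 0 < s < T -> `|s - t| < d -> `|b s - b t| <= e) ->
  (forall e : R, 0 < e -> exists a' b' : R -> R, forall s, 0 < s < T -> `|s - t| < d0 ->
    [/\ is_derive s 1 a' (b' s), `|a' s - a s| <= e & `|b' s - b s| <= e]) ->
  is_derive t 1 a (b t).
Proof.
move=> tT d00 cb H; apply: is_derive_eps => e e0.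
have e2 : 0 < e / 2 by lra.
have [d1 d10 Hb] := cb _ e2.
exists (Num.min (Num.min d0 d1) (Num.min t (T - t))).
  by rewrite !lt_min d00 d10/=; lra.
move=> h; rewrite !lt_min => /andP[/andP[h0 h1] /andP[h2 h3]].
have [->|hn0] := eqVneq h 0.
  by rewrite addr0 subrr mul0r subr0 !normr0 mulr0.
have hp : 0 < `|h| by rewrite normr_gt0.
(* Two errors in the values and one in the slope add up to 2 eta + eta |h| = (e / 2) |h|; the
   approximants may depend on h. *)
pose eta := e * `|h| / (2 * (2 + `|h|)).
have den : 0 < 2 * (2 + `|h|) by rewrite mulr_gt0// ltr_wpDr// ltW.
have eta0 : 0 < eta by rewrite divr_gt0// mulr_gt0.
have etaE : 2 * eta + eta * `|h| = e / 2 * `|h|.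
  rewrite /eta; have n : 2 + `|h| != 0 by rewrite gt_eqF// ltr_wpDr// ltW.
  by field.
have [a' [b' Hab]] := H _ eta0.
have between s : (t <= s <= t + h) || (t + h <= s <= t) -> 0 < s < T /\ `|s - t| <= `|h|.
  move=> st; move: h2 h3; rewrite !ltr_norml => h2 h3.
  by case: (ler0P h) => hs; rewrite ?ler_norml; case/orP: st => st; split; lra.
have close s : (t <= s <= t + h) || (t + h <= s <= t) ->
  [/\ is_derive s 1 a' (b' s), `|a' s - a s| <= eta & `|b' s - b t| <= eta + e / 2].
  move=> /between[sT sh]; have [da ha hb] := Hab s sT (le_lt_trans sh h0).
  split => //; have := Hb s sT (le_lt_trans sh h1); have := ler_distD (b s) (b' s) (b t); lra.
have dp s : (t <= s <= t + h) || (t + h <= s <= t) ->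
    is_derive s 1 (fun y => a' y - y * b t) (b' s - b t).
  move=> /close[da _ _].
  have d2 : is_derive s 1 (fun y : R => y * b t) (b t).
    by apply: is_deriveE (is_deriveZ (b t) (is_derive_id s 1)) _ _ => [y|];
      rewrite -[LHS]/(_ * _) ?mulr1// mulrC.
  exact: is_deriveB.
have mv : `|a' (t + h) - (t + h) * b t - (a' t - t * b t)| <= (eta + e / 2) * `|h|.
  have [hs|hs] := leP 0 h.
    have th : t <= t + h by rewrite lerDl.
    have c : {within `[t, t + h], continuous (fun y => a' y - y * b t)}.
      apply: derivable_within_continuous => s; rewrite in_itv/= => st.
      by have := dp s; rewrite st => /(_ isT)[].
    have -> : `|h| = t + h - t by rewrite (ger0_norm hs); ring.
    apply: (mean_value_bound (M := eta + e / 2) (df := fun s => b' s - b t) th _ c _).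
      by move=> s /andP[/ltW s1 /ltW s2]; apply: dp; rewrite s1 s2.
    by move=> s /andP[/ltW s1 /ltW s2]; have := close s; rewrite s1 s2 => /(_ isT)[].
  have th : t + h <= t by rewrite gerDl ltW.
  have c : {within `[t + h, t], continuous (fun y => a' y - y * b t)}.
    apply: derivable_within_continuous => s; rewrite in_itv/= => st.
    by have := dp s; rewrite st orbT => /(_ isT)[].
  have -> : `|h| = t - (t + h) by rewrite (ltr0_norm hs); ring.
  rewrite distrC; apply: (mean_value_bound (M := eta + e / 2) (df := fun s => b' s - b t) th _ c _).
    by move=> s /andP[/ltW s1 /ltW s2]; apply: dp; rewrite s1 s2 orbT.
  by move=> s /andP[/ltW s1 /ltW s2]; have := close s; rewrite s1 s2 orbT => /(_ isT)[].
have c1 : `|a' (t + h) - a (t + h)| <= eta.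
  have := close (t + h); rewrite !lexx !andbT.
  by case: (leP 0 h) => hs; rewrite lerDl gerDl ?hs ?(ltW hs) ?orbT; case.
have c2 : `|a' t - a t| <= eta.
  have := close t; rewrite !lexx /= andbT.
  by case: (leP 0 h) => hs; rewrite lerDl gerDl ?hs ?(ltW hs) ?orbT; case.
have E : a (t + h) - a t - h * b t = (a' (t + h) - (t + h) * b t - (a' t - t * b t)) -
  (a' (t + h) - a (t + h)) + (a' t - a t) by ring.
rewrite E; apply: le_trans (ler_normD _ _) _.
apply: le_trans (lerD (ler_normB _ _) c2) _.
apply: le_trans (lerD (lerD mv c1) (lexx _)) _.
have -> : e * `|h| = (e / 2 * `|h|) + (e / 2 * `|h|) by field.
by rewrite -{1}etaE mulrDl; lra.
Qed.

Definition L2cont L T u t := forall e : R, 0 < e -> exists2 d, 0 < d &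
  forall s, 0 <= s <= T -> `|s - t| < d ->
    ip L (fun x => u s x - u t x) (fun x => u s x - u t x) <= e.

Lemma L2cont_bounded L T u t : (forall s, 0 <= s <= T -> sqint L (u s)) -> 0 <= t <= T ->
  L2cont L T u t -> exists2 d, 0 < d & exists2 M : R, 0 <= M & forall s, 0 <= s <= T -> `|s - t| < d ->
    Num.sqrt (ip L (u s) (u s)) <= M.
Proof.
move=> su tT cu; have [d d0 Hd] := cu 1 ltr01.
exists d => //; exists (Num.sqrt (2 * (1 + ip L (u t) (u t)))); first exact: sqrtr_ge0.
move=> s sT st; apply: ler_wsqrtr.
have -> : ip L (u s) (u s) = ip L (fun x => (u s x - u t x) + u t x) (fun x => (u s x - u t x) + u t x).
  by apply: eq_ip => x _; rewrite subrK.
apply: le_trans (ip_add_le (sqintB (su s sT) (su t tT)) (su t tT)) _.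
by rewrite ler_pM2l// lerD2r; exact: Hd.
Qed.

(** Test functions approximate the sine together with its derivative, and u, D, N are bounded in L^2
    near t, so the tested equations converge uniformly there and [derive_limit] applies. The
    coefficients al and be let one statement serve both components. *)
Lemma sinf_equation L T u D N (al be t : R) k : 0 < L -> 0 < t < T ->
  (forall s, 0 <= s <= T -> sqint L (u s)) -> (forall s, 0 <= s <= T -> sqint L (D s)) ->
  (forall s, 0 <= s <= T -> sqint L (N s)) ->
  L2cont L T u t -> L2cont L T D t -> L2cont L T N t ->
  (forall psi, test_function L psi -> forall s, 0 < s < T ->
    is_derive s 1 (fun r => ip L (u r) psi) (al * ip L (D s) (derive1 psi) + be * ip L (N s) psi)) ->
  is_derive t 1 (fun r => ip L (u r) (sinf L k))
    (al * ip L (D t) (fun x => freq L k * cosf L k x) + be * ip L (N t) (sinf L k)).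
Proof.
move=> L0 tT su sD sN cu cD cN H.
have tT' : 0 <= t <= T by case/andP: tT => /ltW-> /ltW->.
have inT (s : R) : 0 < s < T -> 0 <= s <= T by case/andP => /ltW-> /ltW->.
have sc : sqint L (fun x => freq L k * cosf L k x) by apply: sqintZ; exact: sqint_cosf.
have ss := sqint_sinf L k.
have [d1 d10 [M1 M10 B1]] := L2cont_bounded su tT' cu.
have [d2 d20 [M2 M20 B2]] := L2cont_bounded sD tT' cD.
have [d3 d30 [M3 M30 B3]] := L2cont_bounded sN tT' cN.
pose b s := al * ip L (D s) (fun x => freq L k * cosf L k x) + be * ip L (N s) (sinf L k).
(* Approximating the sine and its derivative up to e / C keeps both the function and its time
   derivative within e. *)
pose C := `|al| * M2 + `|be| * M3 + M1 + 1.
have C0 : 0 < C by rewrite ltr_wpDl// !addr_ge0// mulr_ge0.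
have d0 : 0 < Num.min d1 (Num.min d2 d3) by rewrite !lt_min d10 d20.
apply: (@derive_limit _ b T t _ tT d0).
  move=> e e0; have e1 : 0 < e / (`|al| + `|be| + 1).
    by rewrite divr_gt0// ltr_wpDl// addr_ge0.
  have [r1 r10 R1] := continuous_ip (I := fun s => 0 <= s <= T) sD sc tT' cD e1.
  have [r2 r20 R2] := continuous_ip (I := fun s => 0 <= s <= T) sN ss tT' cN e1.
  exists (Num.min r1 r2); first by rewrite lt_min r10.
  move=> s sT; rewrite lt_min => /andP[s1 s2].
  have := R1 s (inT s sT) s1; have := R2 s (inT s sT) s2 => v2 v1.
  rewrite /b opprD addrACA -!mulrBr; apply: le_trans (ler_normD _ _) _; rewrite !normrM.
  apply: le_trans (lerD (ler_wpM2l (normr_ge0 al) v1) (ler_wpM2l (normr_ge0 be) v2)) _.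
  rewrite -mulrDl mulrA ler_pdivrMr ?ltr_wpDl ?addr_ge0// mulrC ler_pM2l//; lra.
move=> e e0; have e1 : 0 < (e / C) ^+ 2 by rewrite exprn_gt0// divr_gt0.
have [psi [tpsi a1 a2]] := sinf_test_approx k L0 e1.
have eC : 0 <= e / C by rewrite divr_ge0// ltW.
have {}a1 := sqr_le_of_le eC a1; have {}a2 := sqr_le_of_le eC a2.
have s0 := sqint_test 0 tpsi; have s1 := sqint_test 1 tpsi.
rewrite derive1n0 in s0; rewrite derive1n1 in s1.
exists (fun s => ip L (u s) psi), (fun s => al * ip L (D s) (derive1 psi) + be * ip L (N s) psi).
move=> s sT; rewrite !lt_min => /and3P[h1 h2 h3].
have sT' := inT s sT; have [[su' sD'] sN'] := (su s sT', sD s sT', sN s sT').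
have pair (v w : R -> R) (M : R) (f : R -> R) : sqint L v -> sqint L f -> sqint L w -> 0 <= M ->
    Num.sqrt (ip L v v) <= M ->
    Num.sqrt (ip L (fun x => f x - w x) (fun x => f x - w x)) <= e / C ->
    `|ip L v f - ip L v w| <= M * (e / C).
  move=> sv sf sw M0 vM fw; rewrite -ipBr//.
  apply: le_trans (ip_cauchy_sqrt sv (sqintB sf sw)) _.
  by apply: ler_pM => //; exact: sqrtr_ge0.
have p1 := pair _ _ _ _ su' s0 ss M10 (B1 s sT' h1) a1.
have p2 := pair _ _ _ _ sD' s1 sc M20 (B2 s sT' h2) a2.
have p3 := pair _ _ _ _ sN' s0 ss M30 (B3 s sT' h3) a1.
have CE : C * (e / C) = e by rewrite mulrC divfK// gt_eqF.
have q1 : 0 <= `|al| * (M2 * (e / C)) by apply: mulr_ge0 => //; exact: mulr_ge0.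
have q2 : 0 <= `|be| * (M3 * (e / C)) by apply: mulr_ge0 => //; exact: mulr_ge0.
have q3 : 0 <= M1 * (e / C) by exact: mulr_ge0.
have CE' : `|al| * (M2 * (e / C)) + `|be| * (M3 * (e / C)) + M1 * (e / C) + e / C = e.
  by rewrite -[RHS]CE /C; ring.
split; first exact: H.
  by apply: le_trans p1 _; rewrite -[leRHS]CE'; lra.
rewrite /b opprD addrACA -!mulrBr; apply: le_trans (ler_normD _ _) _; rewrite !normrM.
apply: le_trans (lerD (ler_wpM2l (normr_ge0 al) p2) (ler_wpM2l (normr_ge0 be) p3)) _.
by rewrite -[leRHS]CE'; lra.
Qed.

End limit_equation.

(** * Background and solutions in real form *)

Section background_reduction.
Context {R : realType} (L : R).
Hypothesis L0 : 0 < L.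
Notation mu := (@lebesgue_measure R).
Notation I := (oitv L).
Implicit Types (f h : R -> R[i]) (g psi : R -> R).

Lemma measurable_sqrt : measurable_fun [set: R] (@Num.sqrt R).
Proof. exact: continuous_measurable_fun (@sqrt_continuous R). Qed.

Lemma measurable_normc f : cmeasurable L f -> measurable_fun I (fun x => normc (f x)).
Proof.
move=> [m1 m2].
have -> : (fun x => normc (f x)) =
    (@Num.sqrt R) \o (fun x => complex.Re (f x) ^+ 2 + complex.Im (f x) ^+ 2).
  by apply/funext => x /=; rewrite -normc_sqr sqrtr_sqr ger0_norm// normc_ge0.
apply: (measurableT_comp measurable_sqrt).
by apply: measurable_funD; exact: measurable_funX.
Qed.

Lemma continuous_normc (h1 h2 : R -> R) : continuous h1 -> continuous h2 ->
  continuous (fun x => normc (h1 x +i* h2 x)).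
Proof.
move=> c1 c2 x; apply: (@continuous_comp _ _ _ (fun y => h1 y ^+ 2 + h2 y ^+ 2) (@Num.sqrt R)).
  by apply: cvgD; under eq_fun do rewrite expr2; rewrite expr2;
    apply: cvgM; [exact: c1|exact: c1|exact: c2|exact: c2].
exact: sqrt_continuous.
Qed.

Lemma sqint_ae g g' : measurable_fun I g -> sqint L g' -> {ae mu, forall x, I x -> g x = g' x} ->
  sqint L g.
Proof.
move=> mg [mg' ig'] gg; split => //; have mI := measurable_oitv L.
have m2 (k : R -> R) : measurable_fun I k -> measurable_fun I (EFin \o (fun x => k x ^+ 2)).
  by move=> mk; apply/measurable_EFinP; exact: measurable_funX.
apply/integrableP; split; first exact: m2.
have /integrableP[_] := ig'; congr (_ < _)%E; apply: ae_eq_integral => //.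
- by apply: measurableT_comp => //; exact: m2.
- by apply: measurableT_comp => //; exact: m2.
- apply: filterS gg; first exact: (ae_filter_ringOfSetsType mu).
  by move=> x H Ix; rewrite /= H.
Qed.

Lemma csqint_bounded f (M : R) : cmeasurable L f -> (Linfnorm L f <= M%:E)%E -> csqint L f.
Proof.
move=> mf fM; have mn := measurable_normc mf.
apply: csqint_of_lty => //; rewrite L2norm_integral; apply: poweR_lty.
have mI := measurable_oitv L.
apply: (@le_lt_trans _ _ (\int[mu]_(x in I) (M ^+ 2)%:E)%E); last first.
  by rewrite integral_cst// [X in (_ * X)%E](lebesgue_oitv L0) -EFinM ltry.
apply: ae_ge0_le_integral => //.
- by move=> x _; rewrite lee_fin sqr_ge0.
- by apply/measurable_EFinP; exact: measurable_funX.
- by move=> x _; rewrite lee_fin sqr_ge0.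
- apply: filterS (Linfnorm_ae L0 fM); first exact: (ae_filter_ringOfSetsType mu).
  move=> x H Ix; have := H Ix; rewrite lee_fin => h; rewrite lerXn2r ?nnegrE ?normc_ge0//.
  exact: le_trans (normc_ge0 _) h.
Qed.

(** Sup bound and end values pass from zeta to its continuous representative, for which they hold on
    the closed interval. For b one takes the modulus of that representative minus q0. *)
Lemma background_reduce (q0 zb ze be : R) (zeta dzeta : R -> R[i]) (zm zp : R[i]) :
  0 <= q0 -> 0 <= ze -> 0 <= be ->
  background L q0 zeta dzeta zm zp -> (Linfnorm L zeta <= zb%:E)%E ->
  (L2norm L dzeta <= ze%:E)%E -> (L2norm L (fun x => (normc (zeta x) - q0)%:C) <= be%:E)%E ->
  exists c1 c2 dz1 dz2 b, [/\ background_data L q0 zb ze be c1 c2 dz1 dz2 b, csqint L zeta,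
    {ae mu, forall x, I x -> complex.Re (zeta x) = c1 + prim L dz1 x} &
    {ae mu, forall x, I x -> complex.Im (zeta x) = c2 + prim L dz2 x}].
Proof.
move=> q00 ze0 be0 bg zinf dz2 bn; have L0' := L0.
have /weak_derivP[lz ld w1 w2] := background_deriv bg.
have sz := csqint_bounded (clocally_measurable lz) zinf.
have sd : csqint L dzeta.
  by apply: csqint_of_lty (clocally_measurable ld) _; apply: le_lt_trans dz2 _; exact: ltry.
have [c1 e1] := wderiv_rep L0 sz.1 sd.1 w1; have [c2 e2] := wderiv_rep L0 sz.2 sd.2 w2.
have k1 := continuous_cst_prim (c := c1) sd.1; have k2 := continuous_cst_prim (c := c2) sd.2.
set g1 := fun x => complex.Re (dzeta x) in k1 e1 *.
set g2 := fun x => complex.Im (dzeta x) in k2 e2 *.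
pose N x := normc ((c1 + prim L g1 x) +i* (c2 + prim L g2 x)).
have cN : continuous N := continuous_normc k1 k2.
have NE : {ae mu, forall x, I x -> normc (zeta x) = N x}.
  apply: filterS2 e1 e2; first exact: (ae_filter_ringOfSetsType mu).
  by move=> x a1 a2 Ix; rewrite /N -a1// -a2//; case: (zeta x).
have Nle x : - L <= x <= L -> N x <= zb.
  apply: (ae_le_continuous L0 cN); apply: filterS2 NE (Linfnorm_ae L0 zinf).
    exact: (ae_filter_ringOfSetsType mu).
  by move=> y a1 a2 Iy; rewrite -a1// a2.
have LL : - L <= - L <= L by lra.
have RR : - L <= L <= L by lra.
have left_end := ae_limit_end_complex L0 k1 k2 LL e1 e2 (left_end_eps (background_left bg)).
have right_end := ae_limit_end_complex L0 k1 k2 RR e1 e2 (right_end_eps (background_right bg)).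
have Nl : N (- L) = q0 by rewrite /N left_end (background_normm bg).
have Nr : N L = q0 by rewrite /N right_end (background_normp bg).
have mb : cmeasurable L (fun x => (normc (zeta x) - q0)%:C).
  split => /=; last exact: measurable_cst.
  by apply: measurable_funB; [exact: measurable_normc (clocally_measurable lz)|exact: measurable_cst].
have sb : csqint L (fun x => (normc (zeta x) - q0)%:C).
  by apply: csqint_of_lty mb _; apply: le_lt_trans bn _; exact: ltry.
have cb : continuous (fun x => N x - q0).
  by move=> x; apply: cvgB; [exact: cN|exact: cvg_cst].
have sb' : sqint L (fun x => N x - q0) by exact: sqint_continuous.
have bE : {ae mu, forall x, I x -> normc (zeta x) - q0 = N x - q0}.
  by apply: filterS NE; [exact: (ae_filter_ringOfSetsType mu)|] => x H Ix; rewrite H.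
exists c1, c2, g1, g2, (fun x => N x - q0); split => //; split => //.
- exact: sd.1.
- exact: sd.2.
- by rewrite q00 -Nl Nle.
- by have := Nl; rewrite /N !prim_le// !addr0.
- have := dz2; rewrite L2normE// lee_fin => /(sqrt_le_sqr (cnormsq_ge0 _ _)); exact.
- have := bn; rewrite L2normE// lee_fin => /(sqrt_le_sqr (cnormsq_ge0 _ _)).
  rewrite /cnormsq/= (ip_ae_sqr sb.1 sb' bE); apply: le_trans.
  by rewrite lerDl ip_ge0.
Qed.

End background_reduction.

(** * Solutions in real form *)

Section solution_reduction.
Context {R : realType}.
Notation mu := (@lebesgue_measure R).
Variables (L T nu q zb ze be : R) (F : R -> R).
Hypothesis L0 : 0 < L.
Notation I := (oitv L).
Variables (c1 c2 : R) (dz1 dz2 b : R -> R) (zeta phi0 : R -> R[i]) (phi : R -> R -> R[i]).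
Hypothesis bg : background_data L q zb ze be c1 c2 dz1 dz2 b.
Hypothesis szeta : csqint L zeta.
Hypothesis zeta1 : {ae mu, forall x, I x -> complex.Re (zeta x) = c1 + prim L dz1 x}.
Hypothesis zeta2 : {ae mu, forall x, I x -> complex.Im (zeta x) = c2 + prim L dz2 x}.
Hypothesis Fq : F q = 0.
Hypothesis F_lip : forall rho, exists2 K, 0 <= K & lipschitz_upto F K rho.
Hypothesis mF : measurable_fun [set: R] F.
Hypothesis sol : ibvp_solution L T nu F zeta phi0 phi.

Lemma solution_primitive : exists G1 G2 : R -> R -> R, forall t, 0 <= t <= T ->
  [/\ primitive_of L (phi t) (G1 t) (G2 t), prim L (G1 t) L = 0 & prim L (G2 t) L = 0].
Proof.
have H t : exists g : (R -> R) * (R -> R), 0 <= t <= T ->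
    [/\ primitive_of L (phi t) g.1 g.2, prim L g.1 L = 0 & prim L g.2 L = 0].
  (* Outside [0, T] the zero functions are a mere default. *)
  have [tT|tT] := boolP (0 <= t <= T); last by exists (cst 0, cst 0).
  have [g1 [g2 Hg]] := memH1_primitive L0 (solution_H1 sol tT) (solution_left sol tT) (solution_right sol tT).
  by exists (g1, g2).
have [G HG] := choice H.
by exists (fun t => (G t).1), (fun t => (G t).2) => t tT; exact: HG.
Qed.

Variables (G1 G2 : R -> R -> R).
Hypothesis phiG : forall t, 0 <= t <= T ->
  [/\ primitive_of L (phi t) (G1 t) (G2 t), prim L (G1 t) L = 0 & prim L (G2 t) L = 0].

Let sG1 t : 0 <= t <= T -> sqint L (G1 t). Proof. by move=> /phiG[[]]. Qed.
Let sG2 t : 0 <= t <= T -> sqint L (G2 t). Proof. by move=> /phiG[[]]. Qed.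

Lemma solution_h1_cont t : 0 <= t <= T -> forall e : R, 0 < e -> exists2 d, 0 < d &
  forall s, 0 <= s <= T -> `|s - t| < d ->
    h1sq L (fun x => G1 s x - G1 t x) + h1sq L (fun x => G2 s x - G2 t x) <= e.
Proof.
move=> tT e e0; have se0 : (0 < (Num.sqrt e)%:E)%E by rewrite lte_fin sqrtr_gt0.
have nb : nbhs (0%E : \bar R) [set y | (y < (Num.sqrt e)%:E)%E].
  by apply: open_nbhs_nbhs; split => //; exact: open_ereal_lt_ereal.
have : \forall s \near within `[0, T] (nbhs t),
    (H1norm L (fun x => (phi s x - phi t x)%R) < (Num.sqrt e)%:E)%E.
  exact: (solution_continuous sol tT nb).
rewrite near_withinE => /nbhs_ballP[d /= d0 Hd]; exists d => // s sT sd.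
have [ps _ _] := phiG sT; have [pt _ _] := phiG tT.
have := Hd s; rewrite /ball/= distrC in_itv/= => /(_ sd sT).
rewrite (primitive_H1norm L0 (primitive_sub ps pt)) lte_fin ltr_sqrt// => /ltW.
exact.
Qed.

Let h1_cont1 t : 0 <= t <= T -> forall e : R, 0 < e -> exists2 d, 0 < d &
  forall s, 0 <= s <= T -> `|s - t| < d -> h1sq L (fun x => G1 s x - G1 t x) <= e.
Proof.
move=> tT e e0; have [d d0 H] := solution_h1_cont tT e0; exists d => // s sT st.
by apply: le_trans (H s sT st); rewrite lerDl h1sq_ge0.
Qed.

Let h1_cont2 t : 0 <= t <= T -> forall e : R, 0 < e -> exists2 d, 0 < d &
  forall s, 0 <= s <= T -> `|s - t| < d -> h1sq L (fun x => G2 s x - G2 t x) <= e.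
Proof.
move=> tT e e0; have [d d0 H] := solution_h1_cont tT e0; exists d => // s sT st.
by apply: le_trans (H s sT st); rewrite lerDr h1sq_ge0.
Qed.

Let prim_cont (G : R -> R -> R) t : 0 <= t <= T -> (forall s, 0 <= s <= T -> sqint L (G s)) ->
  (forall e : R, 0 < e -> exists2 d, 0 < d &
    forall s, 0 <= s <= T -> `|s - t| < d -> h1sq L (fun x => G s x - G t x) <= e) ->
  L2cont L T (fun s => prim L (G s)) t.
Proof.
move=> tT sG H e e0; have [d d0 Hd] := H e e0; exists d => // s sT st.
apply: le_trans (Hd s sT st); rewrite /h1sq.
have -> : ip L (fun x => prim L (G s) x - prim L (G t) x) (fun x => prim L (G s) x - prim L (G t) x) =
  ip L (prim L (fun x => G s x - G t x)) (prim L (fun x => G s x - G t x)).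
  by apply: eq_ip => x _; rewrite (primB _ (sG s sT) (sG t tT)).
by rewrite lerDr ip_ge0.
Qed.

Let shift_cont (G : R -> R -> R) (dz : R -> R) t :
  (forall e : R, 0 < e -> exists2 d, 0 < d &
    forall s, 0 <= s <= T -> `|s - t| < d -> h1sq L (fun x => G s x - G t x) <= e) ->
  L2cont L T (fun s x => dz x + G s x) t.
Proof.
move=> H e e0; have [d d0 Hd] := H e e0; exists d => // s sT st.
apply: le_trans (Hd s sT st); rewrite /h1sq.
have -> : ip L (fun x => dz x + G s x - (dz x + G t x)) (fun x => dz x + G s x - (dz x + G t x)) =
  ip L (fun x => G s x - G t x) (fun x => G s x - G t x).
  by apply: eq_ip => x _; rewrite opprD addrACA subrr add0r.
by rewrite lerDl ip_ge0.
Qed.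

Lemma h1sqD_le (g h : R -> R) : sqint L g -> sqint L h ->
  h1sq L (fun x => g x + h x) <= 2 * (h1sq L g + h1sq L h).
Proof.
move=> sg sh; rewrite /h1sq addrACA mulrDr; apply: lerD; first exact: ip_add_le.
have -> : ip L (prim L (fun x => g x + h x)) (prim L (fun x => g x + h x)) =
  ip L (fun x => prim L g x + prim L h x) (fun x => prim L g x + prim L h x).
  by apply: eq_ip => x _; rewrite primD.
by apply: ip_add_le; exact: sqint_prim.
Qed.

(** F is only locally Lipschitz, and the a priori bound presupposes the reduced form. Continuity in
    H^1 gives a bound near one time, enough to handle the source there. *)
Lemma solution_local_bound t : 0 <= t <= T -> exists2 d, 0 < d & exists2 m, 0 <= m &
  forall s, 0 <= s <= T -> `|s - t| < d -> h1sq L (G1 s) + h1sq L (G2 s) <= m ^+ 2.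
Proof.
move=> tT; have [d d0 Hd] := solution_h1_cont tT ltr01.
have S0 : 0 <= 2 * (1 + (h1sq L (G1 t) + h1sq L (G2 t))).
  by apply: mulr_ge0 => //; apply: addr_ge0 => //; apply: addr_ge0; exact: h1sq_ge0.
exists d => //; exists (Num.sqrt (2 * (1 + (h1sq L (G1 t) + h1sq L (G2 t))))); first exact: sqrtr_ge0.
move=> s sT st; rewrite sqr_sqrtr//.
have split_le (G : R -> R -> R) : sqint L (G s) -> sqint L (G t) ->
    h1sq L (G s) <= 2 * (h1sq L (fun x => G s x - G t x) + h1sq L (G t)).
  move=> s1 s2; have := h1sqD_le (sqintB s1 s2) s2.
  by under [X in h1sq L X <= _ -> _]eq_fun do rewrite subrK.
apply: le_trans (lerD (split_le _ (sG1 sT) (sG1 tT)) (split_le _ (sG2 sT) (sG2 tT))) _.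
by rewrite -mulrDr ler_pM2l// addrACA lerD2r; exact: Hd.
Qed.

Let f1 t := profile L c1 dz1 (G1 t).
Let f2 t := profile L c2 dz2 (G2 t).

Lemma sqint_nonlin_at t (f : R -> R) : 0 <= t <= T ->
  (forall x, f x = f1 t x) \/ (forall x, f x = f2 t x) -> sqint L (nonlin F (f1 t) (f2 t) f).
Proof.
move=> tT ff; have [d d0 [m m0 Hm]] := solution_local_bound tT.
have [K K0 Flip] := F_lip (zb + 4 * m).
have tt : `|t - t| < d by rewrite subrr normr0.
have [_ e1 e2] := phiG tT.
by have [] := nonlin_fixed L0 bg (sG1 tT) (sG2 tT) e1 e2 m0 K0 (Hm t tT tt) Fq Flip 0 ff.
Qed.

(** Near t all profiles stay below a common rho, up to which F is Lipschitz, so continuity of the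
    solution passes to the source by [nonlin_lip]. *)
Lemma nonlin_cont t (f : R -> R -> R) : 0 <= t <= T -> f = f1 \/ f = f2 ->
  L2cont L T (fun s => nonlin F (f1 s) (f2 s) (f s)) t.
Proof.
move=> tT ff e e0.
have fsub s : (forall x, f s x = f1 s x) \/ (forall x, f s x = f2 s x).
  by case: ff => ->; [left|right].
have [d d0 [m m0 Hm]] := solution_local_bound tT.
have [K K0 Flip] := F_lip (zb + 4 * m).
set rho := zb + 4 * m in Flip.
have q_itv : 0 <= q <= rho by have := bg_q bg; rewrite /rho; move: m0; lra.
have rho0 : 0 <= rho by case/andP: q_itv => /le_trans h /h.
pose C := 2 * K * rho.
have C0 : 0 <= C by rewrite /C !mulr_ge0.
have eC : 0 < e / (2 * C ^+ 2 + 1) by rewrite divr_gt0// ltr_wpDl// mulr_ge0 ?sqr_ge0.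
have [d' d'0 Hd'] := solution_h1_cont tT eC.
exists (Num.min d d'); first by rewrite lt_min d0.
move=> s sT; rewrite lt_min => /andP[sd sd'].
have tt : `|t - t| < d by rewrite subrr normr0.
have [sN tN] := (sqint_nonlin_at sT (fsub s), sqint_nonlin_at tT (fsub t)).
have [k1 k2] := (sG1 sT, sG2 sT); have [k1' k2'] := (sG1 tT, sG2 tT).
pose D1 := prim L (fun x => G1 s x - G1 t x); pose D2 := prim L (fun x => G2 s x - G2 t x).
have sD1 : sqint L D1 := sqint_prim (sqintB k1 k1').
have sD2 : sqint L D2 := sqint_prim (sqintB k2 k2').
have [n1 n2] := (sqint_norm sD1, sqint_norm sD2).
have bound x : I x -> `|nonlin F (f1 s) (f2 s) (f s) x - nonlin F (f1 t) (f2 t) (f t) x| <=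
    `|C * (`|D1 x| + `|D2 x|)|.
  rewrite oitvE => /andP[/ltW x1 /ltW x2]; have xL : - L <= x <= L by rewrite x1.
  have z1 := profile_le bg (sG1 sT) (sG2 sT) m0 (Hm s sT sd) xL.
  have z2 := profile_le bg (sG1 tT) (sG2 tT) m0 (Hm t tT tt) xL.
  rewrite -/(f1 s x) -/(f2 s x) -/rho in z1; rewrite -/(f1 t x) -/(f2 t x) -/rho in z2.
  have dE : (f1 s x +i* f2 s x) - (f1 t x +i* f2 t x) = D1 x +i* D2 x.
    rewrite /D1 /D2 !primB// /f1 /f2 /profile -[LHS]/((_ - _) +i* (_ - _)).
    by congr (_ +i* _); ring.
  have yb : `|f t x| <= normc (f1 t x +i* f2 t x).
    by case: (fsub t) => ->; [exact: (Re_le_normc (_ +i* _))|exact: (Im_le_normc (_ +i* _))].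
  have xy : `|f s x - f t x| <= normc ((f1 s x +i* f2 s x) - (f1 t x +i* f2 t x)).
    by case: ff => ->; [exact: (Re_le_normc ((_ - _) +i* (_ - _)))|
      exact: (Im_le_normc ((_ - _) +i* (_ - _)))].
  apply: le_trans (nonlin_lip K0 q_itv Fq Flip z1 z2 yb xy) _.
  rewrite dE -/C; have -> : `|C * (`|D1 x| + `|D2 x|)| = C * (`|D1 x| + `|D2 x|).
    by rewrite ger0_norm//; apply: mulr_ge0 => //; exact: addr_ge0.
  apply: ler_wpM2l => //.
  exact: (normc_le_sum (_ +i* _)).
apply: le_trans (le_ip_sqr (sqintB sN tN) (sqintZ C (sqintD n1 n2)) bound) _.
rewrite ipZl ?ipZr//; [|exact: sqintD|exact: sqintD|exact: sqintD|exact: sqintZ (sqintD n1 n2)].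
rewrite mulrA -expr2; apply: (@le_trans _ _ (C ^+ 2 * (2 * (ip L D1 D1 + ip L D2 D2)))).
  by rewrite ler_wpM2l ?sqr_ge0//; apply: le_trans (ip_add_le n1 n2) _; rewrite !ip_norm.
have DD : ip L D1 D1 + ip L D2 D2 <= e / (2 * C ^+ 2 + 1).
  by apply: le_trans (Hd' s sT sd'); rewrite /h1sq; apply: lerD; rewrite lerDr ip_ge0.
rewrite mulrA [C ^+ 2 * 2]mulrC.
apply: le_trans (ler_wpM2l _ DD) _; first by rewrite mulr_ge0 ?sqr_ge0.
rewrite mulrCA ler_piMr ?(ltW e0)// ler_pdivrMr ?mul1r ?lerDl//.
by rewrite ltr_wpDl// mulr_ge0 ?sqr_ge0.
Qed.

Let w t x := phi t x + zeta x.

Lemma profile_ae t : 0 <= t <= T ->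
  {ae mu, forall x, I x -> complex.Re (w t x) = f1 t x} /\
  {ae mu, forall x, I x -> complex.Im (w t x) = f2 t x}.
Proof.
have ReD (z z' : R[i]) : complex.Re (z + z') = complex.Re z + complex.Re z' by case: z z' => ? ? [].
have ImD (z z' : R[i]) : complex.Im (z + z') = complex.Im z + complex.Im z' by case: z z' => ? ? [].
move=> tT; have [[_ _ _ e1 e2] _ _] := phiG tT; split.
  apply: filterS2 e1 zeta1; first exact: (ae_filter_ringOfSetsType mu).
  by move=> x H H' Ix; rewrite ReD H// H'// addrC.
apply: filterS2 e2 zeta2; first exact: (ae_filter_ringOfSetsType mu).
by move=> x H H' Ix; rewrite ImD H// H'// addrC.
Qed.

Lemma csqint_w t : 0 <= t <= T -> csqint L (w t).
Proof.
move=> tT; have [[[s1 s2] _ _ _ _] _ _] := phiG tT; have [z1 z2] := szeta; split.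
  by apply: eq_sqint (sqintD s1 z1) => x _; rewrite /w; case: (phi t x) (zeta x) => ? ? [].
by apply: eq_sqint (sqintD s2 z2) => x _; rewrite /w; case: (phi t x) (zeta x) => ? ? [].
Qed.

Lemma sqint_profile (c : R) (dz g : R -> R) : sqint L dz -> sqint L g -> sqint L (profile L c dz g).
Proof. by move=> sd sg; apply: sqintD (sqint_prim sg); exact: sqintD (sqint_cst L c) (sqint_prim sd). Qed.

Lemma profile_test (c : R) (dz g psi : R -> R) : sqint L dz -> sqint L g -> test_function L psi ->
  ip L (profile L c dz g) (derive1n 2 psi) = - ip L (fun x => dz x + g x) (derive1 psi).
Proof.
move=> sd sg tpsi; rewrite -(derive1n1 psi) -(prim_cst_test_parts L0 c 1 (sqintD sd sg) tpsi).
by apply: eq_ip => // x _; rewrite /profile primD// addrA.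
Qed.

(** One of the two derivatives of psi is moved onto the profile by [profile_test], and phi + zeta is
    replaced by its continuous representative under the integrals. *)
Lemma tested_equation psi t : test_function L psi -> 0 < t < T ->
  is_derive t 1 (fun s => ip L (prim L (G1 s)) psi)
    (nu * ip L (fun x => dz2 x + G2 t x) (derive1 psi) + -1 * ip L (nonlin F (f1 t) (f2 t) (f2 t)) psi) /\
  is_derive t 1 (fun s => ip L (prim L (G2 s)) psi)
    (- nu * ip L (fun x => dz1 x + G1 t x) (derive1 psi) + 1 * ip L (nonlin F (f1 t) (f2 t) (f1 t)) psi).
Proof.
move=> tpsi tT; have tT' : 0 <= t <= T by case/andP: tT => /ltW-> /ltW->.
have spsi := sqint_test 0 tpsi; rewrite derive1n0 in spsi.
have spsi2 := sqint_test 2 tpsi.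
have [v [dv1 dv2]] := solution_eq sol tpsi tT.
have [w1 w2] := profile_ae tT'; have [sw1 sw2] := csqint_w tT'.
have mw : cmeasurable L (w t) by split; [exact: sw1.1|exact: sw2.1].
have mN (g : R -> R) : measurable_fun I g -> measurable_fun I (fun x => F (normc (w t x)) * g x).
  by move=> mg; apply: measurable_funM => //; apply: measurableT_comp => //; exact: measurable_normc.
have wE : {ae mu, forall x, I x -> w t x = f1 t x +i* f2 t x}.
  apply: filterS2 w1 w2; first exact: (ae_filter_ringOfSetsType mu).
  by move=> x h1 h2 Ix; rewrite -h1// -h2//; case: (w t x).
have N1 := sqint_nonlin_at tT' (or_introl (fun=> erefl)).
have N2 := sqint_nonlin_at tT' (or_intror (fun=> erefl)).
have n1E : {ae mu, forall x, I x -> F (normc (w t x)) * complex.Re (w t x) = nonlin F (f1 t) (f2 t) (f1 t) x}.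
  apply: filterS wE; first exact: (ae_filter_ringOfSetsType mu).
  by move=> x h Ix; rewrite h.
have n2E : {ae mu, forall x, I x -> F (normc (w t x)) * complex.Im (w t x) = nonlin F (f1 t) (f2 t) (f2 t) x}.
  apply: filterS wE; first exact: (ae_filter_ringOfSetsType mu).
  by move=> x h Ix; rewrite h.
have i1 : ip L (fun x => F (normc (w t x)) * complex.Re (w t x)) psi = ip L (nonlin F (f1 t) (f2 t) (f1 t)) psi.
  by apply: ip_ae => //; exact: sqint_ae (mN _ sw1.1) N1 n1E.
have i2 : ip L (fun x => F (normc (w t x)) * complex.Im (w t x)) psi = ip L (nonlin F (f1 t) (f2 t) (f2 t)) psi.
  by apply: ip_ae => //; exact: sqint_ae (mN _ sw2.1) N2 n2E.
have j1 : ip L (fun x => complex.Re (w t x)) (derive1n 2 psi) = - ip L (fun x => dz1 x + G1 t x) (derive1 psi).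
  rewrite (ip_ae sw1 (sqint_profile c1 (bg_dz1 bg) (sG1 tT')) spsi2 w1).
  by rewrite profile_test//; [exact: bg_dz1 bg|exact: sG1].
have j2 : ip L (fun x => complex.Im (w t x)) (derive1n 2 psi) = - ip L (fun x => dz2 x + G2 t x) (derive1 psi).
  rewrite (ip_ae sw2 (sqint_profile c2 (bg_dz2 bg) (sG2 tT')) spsi2 w2).
  by rewrite profile_test//; [exact: bg_dz2 bg|exact: sG2].
have pE s : 0 <= s <= T ->
    complex.Re (cintegral L (fun x => phi s x * (psi x)%:C)) = ip L (prim L (G1 s)) psi /\
    complex.Im (cintegral L (fun x => phi s x * (psi x)%:C)) = ip L (prim L (G2 s)) psi.
  move=> sT; have [[[p1 p2] _ _ e1 e2] _ _] := phiG sT; rewrite cintegral_test /=; split.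
    exact: ip_ae p1 (sqint_prim (sG1 sT)) spsi e1.
  exact: ip_ae p2 (sqint_prim (sG2 sT)) spsi e2.
rewrite -/(w t) !cintegral_test.
have -> : ip L (fun x => complex.Re ((F (normc (phi t x + zeta x)))%:C * (phi t x + zeta x))) psi =
    ip L (nonlin F (f1 t) (f2 t) (f1 t)) psi.
  by rewrite -i1; apply: eq_ip => // x _; rewrite -/(w t x); case: (w t x) => u1 u2 /=; rewrite mul0r subr0.
have -> : ip L (fun x => complex.Im ((F (normc (phi t x + zeta x)))%:C * (phi t x + zeta x))) psi =
    ip L (nonlin F (f1 t) (f2 t) (f2 t)) psi.
  by rewrite -i2; apply: eq_ip => // x _; rewrite -/(w t x); case: (w t x) => u1 u2 /=; rewrite mul0r addr0.
rewrite [ip L (fun x => complex.Re _) _]j1 [ip L (fun x => complex.Im _) _]j2.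
move: dv1 dv2; case: v => v1 v2 /= dv1 dv2 eqn.
(* Multiplication by i swaps the components of v: the real part of the equation gives Im v, the
   imaginary part gives Re v. *)
have /= e1 := congr1 (@complex.Re R) eqn; have /= e2 := congr1 (@complex.Im R) eqn.
split.
  apply: (is_derive_inside tT (fun s sT => (pE s sT).1)); apply: is_derive_eq dv1 _.
  move: e2; move: (ip L _ _) (ip L _ _) (ip L _ _) => A B C e2.
  by apply/eqP; rewrite -subr_eq0; apply/eqP; rewrite -[RHS]e2; ring.
apply: (is_derive_inside tT (fun s sT => (pE s sT).2)); apply: is_derive_eq dv2 _.
move: e1; move: (ip L _ _) (ip L _ _) (ip L _ _) => A B C e1.
by apply/eqP; rewrite -subr_eq0; apply/eqP; rewrite -[RHS]oppr0 -e1; ring.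
Qed.

Lemma solution_reduce : reduced_solution L T nu F c1 c2 dz1 dz2 G1 G2.
Proof.
have sw1 t : 0 <= t <= T -> sqint L (prim L (G1 t)) by move=> tT; exact: sqint_prim (sG1 tT).
have sw2 t : 0 <= t <= T -> sqint L (prim L (G2 t)) by move=> tT; exact: sqint_prim (sG2 tT).
have sd1 t : 0 <= t <= T -> sqint L (fun x => dz1 x + G1 t x).
  by move=> tT; exact: sqintD (bg_dz1 bg) (sG1 tT).
have sd2 t : 0 <= t <= T -> sqint L (fun x => dz2 x + G2 t x).
  by move=> tT; exact: sqintD (bg_dz2 bg) (sG2 tT).
have sn1 t : 0 <= t <= T -> sqint L (nonlin F (f1 t) (f2 t) (f1 t)).
  by move=> tT; apply: (sqint_nonlin_at tT); left.
have sn2 t : 0 <= t <= T -> sqint L (nonlin F (f1 t) (f2 t) (f2 t)).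
  by move=> tT; apply: (sqint_nonlin_at tT); right.
split => //; [by move=> t /phiG[]|by move=> t /phiG[]| |].
- move=> k t tT; have tT' : 0 <= t <= T by case/andP: tT => /ltW-> /ltW->.
  have := sinf_equation k.+1 L0 tT sw1 sd2 sn2 (prim_cont tT' sG1 (h1_cont1 tT'))
    (shift_cont dz2 (h1_cont2 tT')) (nonlin_cont tT' (or_intror erefl))
    (fun psi tpsi s sT => (tested_equation tpsi sT).1).
  move=> H; apply: is_derive_eq H _;
  rewrite (ipZr _ (sqint_cosf L k.+1) (sd2 t tT')).
  by rewrite mulrA mulN1r.
- move=> k t tT; have tT' : 0 <= t <= T by case/andP: tT => /ltW-> /ltW->.
  have := sinf_equation k.+1 L0 tT sw2 sd1 sn1 (prim_cont tT' sG2 (h1_cont2 tT'))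
    (shift_cont dz1 (h1_cont1 tT')) (nonlin_cont tT' (or_introl erefl))
    (fun psi tpsi s sT => (tested_equation tpsi sT).2).
  move=> H; apply: is_derive_eq H _;
  rewrite (ipZr _ (sqint_cosf L k.+1) (sd1 t tT')).
  by rewrite mul1r mulNr mulrA addrC.
Qed.

End solution_reduction.

(** * The cubic and power nonlinearities *)

Section factors.
Context {R : realType}.
Implicit Types (F : R -> R).

Lemma lipschitz_upto_weaken F (K K' rho rho' : R) : K <= K' -> rho' <= rho ->
  lipschitz_upto F K rho -> lipschitz_upto F K' rho'.
Proof.
move=> KK rr H r s /andP[r0 r1] /andP[s0 s1].
apply: le_trans (H r s _ _) _; first by rewrite r0 (le_trans r1).
  by rewrite s0 (le_trans s1).
by rewrite ler_wpM2r.
Qed.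

Lemma cubic_lipschitz (mu q0 rho : R) : 0 <= mu ->
  lipschitz_upto (cubic_factor mu q0) (2 * mu * rho) rho.
Proof.
move=> mu0 r s rr ss; rewrite /cubic_factor.
have -> : mu * (r ^+ 2 - q0 ^+ 2) - mu * (s ^+ 2 - q0 ^+ 2) = mu * (r + s) * (r - s) by ring.
rewrite normrM ler_wpM2r// ger0_norm; last by apply: mulr_ge0 => //; lra.
by rewrite [2 * mu]mulrC -mulrA ler_wpM2l//; lra.
Qed.

(** Mean value theorem between s and r. The derivative is taken only at positive points, so s = 0
    goes through r^a = r r^(a-1) and 1 <= a. *)
Lemma powR_lipschitz (a rho r s : R) : 1 <= a -> 0 <= r <= rho -> 0 <= s <= rho ->
  `|r `^ a - s `^ a| <= a * rho `^ (a - 1) * `|r - s|.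
Proof.
move=> a1; wlog sr : r s / s <= r => [H rr ss|].
  by have [/H->|/ltW/H h] := leP s r; rewrite // distrC [`|r - s|]distrC h.
move=> /andP[r0 rrho] /andP[s0 srho].
have a0 : 0 <= a by lra.
have b0 : 0 <= a - 1 by lra.
have rho0 : 0 <= rho by lra.
move: s0; rewrite le_eqVlt => /predU1P[<-|s0].
  rewrite powR0 ?gt_eqF ?(lt_le_trans _ a1)// !subr0 ger0_norm ?powR_ge0// ger0_norm//.
  rewrite -(@mulr_powRB1 _ r a) ?(lt_le_trans _ a1)// mulrC ler_wpM2r//.
  apply: (@le_trans _ _ (rho `^ (a - 1))); first by rewrite ge0_ler_powR ?nnegrE.
  by rewrite ler_peMl// powR_ge0.
rewrite [`|r - s|]ger0_norm ?subr_ge0//.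
have dp (x : R) : 0 < x -> is_derive x 1 (fun y : R => y `^ a) (a * x `^ (a - 1)).
  by move=> x0; exact: is_derive1_powR.
apply: (mean_value_bound (f := fun y : R => y `^ a) (df := fun x => a * x `^ (a - 1)) sr).
- by move=> x /andP[sx _]; apply: dp; exact: lt_trans sx.
- apply: derivable_within_continuous => x; rewrite in_itv/= => /andP[sx _].
  by have [] := dp x (lt_le_trans s0 sx).
- move=> x /andP[sx xr]; rewrite ger0_norm ?mulr_ge0 ?powR_ge0// ler_wpM2l//.
  rewrite ge0_ler_powR ?nnegrE//; lra.
Qed.

Lemma power_lipschitz (gamma p q0 rho : R) : 0 <= gamma -> 1 <= p ->
  lipschitz_upto (power_factor gamma p q0) (gamma * (2 * p * rho `^ (2 * p - 1))) rho.
Proof.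
move=> g0 p1 r s rr ss; rewrite /power_factor -mulrBr opprB addrA subrK normrM (ger0_norm g0) -mulrA.
by rewrite ler_wpM2l//; apply: powR_lipschitz => //; lra.
Qed.

Lemma measurable_cubic (mu q0 : R) : measurable_fun [set: R] (cubic_factor mu q0).
Proof.
apply: measurable_funM; first exact: measurable_cst.
apply: measurable_funB; last exact: measurable_cst.
exact: measurable_funX.
Qed.

Lemma measurable_power (gamma p q0 : R) : measurable_fun [set: R] (power_factor gamma p q0).
Proof.
apply: measurable_funM; first exact: measurable_cst.
apply: measurable_funB; last exact: measurable_cst.
exact: measurable_powR.
Qed.

(** For eps <= 1, eps times this is a Lipschitz constant of both factors on moduli up to r eps: 2 mu
    r eps for the cubic one, 2 p gamma (r eps)^(2p-1) for the other. *)
Definition lipschitz_scale (mu gamma p r : R) : R :=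
  2 * mu * r + gamma * (2 * p * r `^ (2 * p - 1)).

Lemma lipschitz_scale_ge0 (mu gamma p r : R) : 0 <= mu -> 0 <= gamma -> 0 <= p -> 0 <= r ->
  0 <= lipschitz_scale mu gamma p r.
Proof. by move=> *; rewrite addr_ge0 ?mulr_ge0 ?powR_ge0. Qed.

Lemma cubic_lipschitz_scale (mu gamma p q0 r eps : R) : 0 <= mu -> 0 <= gamma -> 0 <= p ->
  0 <= r -> 0 <= eps ->
  lipschitz_upto (cubic_factor mu q0) (lipschitz_scale mu gamma p r * eps) (r * eps).
Proof.
move=> mu0 g0 p0 r0 e0; refine (lipschitz_upto_weaken _ (lexx _) (cubic_lipschitz q0 (rho := r * eps) mu0)).
by rewrite mulrA ler_wpM2r// lerDl !mulr_ge0// powR_ge0.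
Qed.

(** Since 2p - 1 >= 1 and eps <= 1, the power eps^(2p-1) is at most eps. *)
Lemma power_lipschitz_scale (mu gamma p q0 r eps : R) : 0 <= mu -> 0 <= gamma -> 1 <= p ->
  0 <= r -> 0 < eps -> eps <= 1 ->
  lipschitz_upto (power_factor gamma p q0) (lipschitz_scale mu gamma p r * eps) (r * eps).
Proof.
move=> mu0 g0 p1 r0 e0 e1; refine (lipschitz_upto_weaken _ (lexx _) (power_lipschitz q0 (rho := r * eps) g0 p1)).
have p0 : 0 <= p by lra.
have p2 : 1 <= 2 * p - 1 by lra.
apply: (@le_trans _ _ (gamma * (2 * p * r `^ (2 * p - 1)) * eps)); last first.
  by rewrite ler_wpM2r ?(ltW e0)// lerDr !mulr_ge0.
rewrite -!mulrA; do 3 (apply: ler_wpM2l => //).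
rewrite powRM ?(ltW e0)// ler_wpM2l ?powR_ge0//.
by apply: ge1r_powR => //; rewrite e0.
Qed.

End factors.

Lemma cisNK {R : realType} (x : R) (z : R[i]) : cis (- x) * (cis x * z) = z.
Proof.
rewrite mulrA /cis cosN sinN.
have -> : (cos x +i* - sin x) * (cos x +i* sin x) = 1 :> R[i].
  apply/eqP; rewrite eq_complex /=; apply/andP; split; apply/eqP; last by ring.
  by rewrite mulNr opprK -!expr2 cos2Dsin2.
by rewrite mul1r.
Qed.

(** * Final constants and the theorem *)

Section final_estimates.
Context {R : realType}.

(** The origin of the cube: the Lipschitz constant, the bound on the modulus and the L^2 distance to
    q0 each carry one factor eps. *)
Lemma difference_mass_scale (C k r B2 M B0 T eps : R) : r = B0 + 4 * M ->
  2 * (C * eps ^+ 3 + 2 * (3 * (k * eps * (B0 * eps + 4 * (M * eps))) * (B2 * eps + M * eps)) * T) ^+ 2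
  <= 2 * ((C + 6 * (k * r) * (B2 + M) * T) * eps ^+ 3) ^+ 2.
Proof. by move=> ->; rewrite le_eqVlt; apply/orP; left; apply/eqP; ring. Qed.

Lemma difference_energy_scale (C k r B1 M B0 T eps : R) : r = B0 + 4 * M ->
  2 * (C * eps ^+ 3 + 2 * (6 * (k * eps * (B0 * eps + 4 * (M * eps))) * (B1 * eps + M * eps)) * T) ^+ 2
  <= 2 * ((C + 12 * (k * r) * (B1 + M) * T) * eps ^+ 3) ^+ 2.
Proof. by move=> ->; rewrite le_eqVlt; apply/orP; left; apply/eqP; ring. Qed.

End final_estimates.

Section solution_size.
Context {R : realType}.
Notation mu := (@lebesgue_measure R).

Lemma cubic_locally_lipschitz (m q0 rho : R) : 0 <= m ->
  exists2 K, 0 <= K & lipschitz_upto (cubic_factor m q0) K rho.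
Proof.
move=> m0; exists (2 * m * `|rho|); first by rewrite !mulr_ge0.
exact: (lipschitz_upto_weaken (lexx _) (ler_norm rho) (cubic_lipschitz q0 (rho := `|rho|) m0)).
Qed.

Lemma power_locally_lipschitz (gamma p q0 rho : R) : 0 <= gamma -> 1 <= p ->
  exists2 K, 0 <= K & lipschitz_upto (power_factor gamma p q0) K rho.
Proof.
move=> g0 p1; exists (gamma * (2 * p * `|rho| `^ (2 * p - 1))).
  by rewrite !mulr_ge0 ?powR_ge0//; lra.
exact: (lipschitz_upto_weaken (lexx _) (ler_norm rho) (power_lipschitz q0 (rho := `|rho|) g0 p1)).
Qed.

Lemma solution_size L T nu q eps c B0 B1 B2 k c1 c2 (dz1 dz2 b : R -> R) F
    (zeta f0 : R -> R[i]) (f : R -> R -> R[i]) :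
  0 < L -> 0 < T -> 0 <= nu -> 0 < eps -> 0 <= c -> 0 <= B0 -> 0 <= B1 -> 0 <= B2 -> 0 <= k ->
  background_data L q (B0 * eps) (B1 * eps) (B2 * eps) c1 c2 dz1 dz2 b ->
  csqint L zeta ->
  {ae mu, forall x, oitv L x -> complex.Re (zeta x) = c1 + prim L dz1 x} ->
  {ae mu, forall x, oitv L x -> complex.Im (zeta x) = c2 + prim L dz2 x} ->
  let M := apriori_radius nu T c B1 in
  F q = 0 -> (forall rho, exists2 K, 0 <= K & lipschitz_upto F K rho) ->
  measurable_fun [set: R] F ->
  lipschitz_upto F (k * eps) ((B0 + 4 * M) * eps) ->
  6 * (k * (B0 + 4 * M)) * (B1 + M) * T * eps ^+ 2 <= 1 ->
  6 * (k * (B0 + 4 * M)) * (B2 + M) * M * T * eps ^+ 2 <= 1 ->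
  ibvp_solution L T nu F zeta f0 f -> (H1norm L f0 <= (c * eps)%:E)%E ->
  exists G1 G2 : R -> R -> R, [/\
    forall t, 0 <= t <= T -> primitive_of L (f t) (G1 t) (G2 t),
    primitive_of L f0 (G1 0) (G2 0),
    reduced_solution L T nu F c1 c2 dz1 dz2 G1 G2 &
    forall t, 0 <= t <= T -> sol_size L G1 G2 t <= (M * eps) ^+ 2].
Proof.
move=> L0 T0 nu0 eps0 cc0 B00 B10 B20 k0 bg sz z1 z2 M Fq Floc mF Flip small1 small2 sol f0le.
have [G1 [G2 HG]] := solution_primitive L0 sol.
have red := solution_reduce L0 bg sz z1 z2 Fq Floc mF sol HG.
have I0 : 0 <= (0 : R) <= T by rewrite lexx ltW.
have [p0 _ _] := HG 0 I0.
have p0' := primitive_eq (solution_init sol) p0.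
have init : sol_size L G1 G2 0 <= (c * eps) ^+ 2.
  apply: sqrt_le_sqr; first by rewrite addr_ge0 ?h1sq_ge0.
  by have := f0le; rewrite (primitive_H1norm L0 p0') lee_fin.
exists G1, G2; split => //; first by move=> t /HG[].
exact: (sol_size_le L0 T0 nu0 eps0 cc0 B00 B10 B20 k0 bg red Fq Flip small1 small2 init).
Qed.

(** A single threshold on eps serves two smallness conditions, by symmetry in X and Y. *)
Lemma small_of_lt (X Y eps : R) : 0 <= X -> 0 <= Y -> 0 < eps < 1 -> eps < (X + Y + 1)^-1 ->
  X * eps ^+ 2 <= 1.
Proof.
move=> X0 Y0 /andP[e0 e1] small; have S0 : 0 < X + Y + 1 by rewrite ltr_wpDl// addr_ge0.
have h : (X + Y + 1) * eps <= 1 by rewrite mulrC -ler_pdivlMr// mul1r ltW.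
apply: (@le_trans _ _ (X * eps)).
  by rewrite ler_wpM2l// expr2 ler_piMr ?(ltW e0)// ltW.
by apply: le_trans h; rewrite ler_wpM2r ?(ltW e0)//; lra.
Qed.

Lemma sqrt_double (x y : R) : 0 <= y -> x <= 2 * y ^+ 2 -> Num.sqrt x <= 2 * y.
Proof.
move=> y0 xy; apply: sqr_le_of_le; first exact: mulr_ge0.
by apply: le_trans xy _; rewrite exprMn ler_wpM2r ?sqr_ge0// -natrX ler_nat.
Qed.

End solution_size.

Unset Implicit Arguments.
Set Strict Implicit.

Theorem theorem4p2 (R : realType) (nu mu gamma p c0 C0 B0 B1 B2 K Tf : R)
    (nu_gt0 : 0 < nu) (mu_gt0 : 0 < mu) (gamma_gt0 : 0 < gamma) (p_ge1 : 1 <= p)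
    (c0_gt0 : 0 < c0) (C0_gt0 : 0 < C0)
    (B0_gt0 : 0 < B0) (B1_gt0 : 0 < B1) (B2_gt0 : 0 < B2)
    (K_gt0 : 0 < K) (Tf_gt0 : 0 < Tf) :
  exists (eps0 : R) (Ct : R -> R -> R) (Ct1 Ct2 : R -> R), 0 < eps0 /\
  forall (B eps L q0 : R) (zeta dzeta : R -> R[i]) (zeta_m zeta_p : R[i])
    (phi0 Phi0 : R -> R[i]) (phi Phi u U : R -> R -> R[i]),
    0 < B -> 0 < eps < 1 -> eps < eps0 -> 0 < L -> L <= K / eps -> 0 < q0 ->
    background L q0 zeta dzeta zeta_m zeta_p ->
    memH1 L phi0 -> memH1 L Phi0 ->
    size_bounds c0 C0 B B0 B1 B2 eps L q0 zeta dzeta phi0 Phi0 ->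
    ibvp_solution L Tf nu (cubic_factor mu q0) zeta phi0 phi ->
    ibvp_solution L Tf nu (power_factor gamma p q0) zeta Phi0 Phi ->
    (forall t x, u t x = cis (mu * q0 ^+ 2 * t) * (phi t x + zeta x)) ->
    (forall t x, U t x = cis (gamma * q0 `^ (2 * p) * t) * (Phi t x + zeta x)) ->
    let diff0 := fun x => phi0 x - Phi0 x in
    let diff := fun t x => phi t x - Phi t x in
    let diff_uU := fun t x => cis (- (mu * q0 ^+ 2 * t)) * u t x
                    - cis (- (gamma * q0 `^ (2 * p) * t)) * U t x in
    (forall C : R, 0 < C -> (L2norm L diff0 <= (C * eps ^+ 3)%:E)%E ->
       sup_time Tf (L2norm L) diff = sup_time Tf (L2norm L) diff_uU /\
       (sup_time Tf (L2norm L) diff <= (Ct B C * eps ^+ 3)%:E)%E) /\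
    (forall C1 : R, 0 < C1 -> (H1norm L diff0 <= (C1 * eps ^+ 3)%:E)%E ->
       (sup_time Tf (H1norm L) diff = sup_time Tf (H1norm L) diff_uU /\
        (sup_time Tf (H1norm L) diff <= (Ct1 C1 * eps ^+ 3)%:E)%E) /\
       (sup_time Tf (Linfnorm L) diff = sup_time Tf (Linfnorm L) diff_uU /\
        (sup_time Tf (Linfnorm L) diff <= (Ct2 C1 * eps ^+ 3)%:E)%E)).
Proof.
(* A common bound for both initial data, so that one radius M serves both solutions. *)
pose c := c0 + C0.
have c_ge0 : 0 <= c by rewrite addr_ge0 ?ltW.
have [[nu0 mu0] [g0 T0]] := ((ltW nu_gt0, ltW mu_gt0), (ltW gamma_gt0, ltW Tf_gt0)).
have [[b00 b10] b20] := ((ltW B0_gt0, ltW B1_gt0), ltW B2_gt0).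
pose M := apriori_radius nu Tf c B1.
have M1 : 1 <= M by exact: apriori_radius_ge1.
have M0 : 0 <= M by exact: le_trans M1.
pose r := B0 + 4 * M.
have r0 : 0 <= r by apply: addr_ge0 => //; exact: mulr_ge0.
have p0 : 0 <= p by exact: le_trans p_ge1.
pose k := lipschitz_scale mu gamma p r.
have k0 : 0 <= k by exact: lipschitz_scale_ge0.
have kr0 : 0 <= k * r by exact: mulr_ge0.
have BM1 : 0 <= B1 + M by exact: addr_ge0.
have BM2 : 0 <= B2 + M by exact: addr_ge0.
(* Multiplied by eps^2, X and Y are the quantities that [solution_size] requires to be at most 1. *)
pose X := 6 * (k * r) * (B1 + M) * Tf.
pose Y := 6 * (k * r) * (B2 + M) * M * Tf.
have X0 : 0 <= X by apply: mulr_ge0 => //; apply: mulr_ge0 => //; exact: mulr_ge0.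
have Y0 : 0 <= Y.
  by apply: mulr_ge0 => //; apply: mulr_ge0 => //; apply: mulr_ge0 => //; exact: mulr_ge0.
(* The source bounds of the difference, for mass and energy, integrated over [0, Tf] and divided by
   eps^3. *)
pose al := 6 * (k * r) * (B2 + M) * Tf; pose be := 12 * (k * r) * (B1 + M) * Tf.
have al0 : 0 <= al by apply: mulr_ge0 => //; apply: mulr_ge0 => //; exact: mulr_ge0.
have be0 : 0 <= be by apply: mulr_ge0 => //; apply: mulr_ge0 => //; exact: mulr_ge0.
(* The L^2 factor 2 bounds the root of 2. In H^1 it comes from adding the mass and energy bounds.
   For the sup norm each of the two components costs twice the H^1 bound, whence 4. *)
exists (X + Y + 1)^-1, (fun _ C => 2 * (C + al)), (fun C => 2 * (C + al + be)),
  (fun C => 4 * (2 * (C + al + be))).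
split; first by rewrite invr_gt0 ltr_wpDl// addr_ge0.
move=> B eps L q0 zeta dzeta zeta_m zeta_p phi0 Phi0 phi Phi u U.
move=> B_gt0 eps01 eps_small L0 _ q00 bg _ _ sizes sol sol' uE UE diff0 diff diff_uU.
have /andP[e0 e1] := eps01; have e0' := ltW e0.
have small1 : X * eps ^+ 2 <= 1 by exact: small_of_lt X0 Y0 eps01 eps_small.
have small2 : Y * eps ^+ 2 <= 1.
  by apply: small_of_lt Y0 X0 eps01 _; rewrite [Y + X]addrC.
have [c1 [c2 [dz1 [dz2 [b [bd sz z1 z2]]]]]] := background_reduce L0 (ltW q00)
  (mulr_ge0 b10 e0') (mulr_ge0 b20 e0') bg (size_zeta sizes) (size_dzeta sizes) (size_modulus sizes).
have Fq : cubic_factor mu q0 q0 = 0 by rewrite /cubic_factor subrr mulr0.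
have Fq' : power_factor gamma p q0 q0 = 0 by rewrite /power_factor subrr mulr0.
have Flip : lipschitz_upto (cubic_factor mu q0) (k * eps) (r * eps).
  exact: cubic_lipschitz_scale.
have Flip' : lipschitz_upto (power_factor gamma p q0) (k * eps) (r * eps).
  by apply: power_lipschitz_scale => //; exact: ltW.
have phi0_le : (H1norm L phi0 <= (c * eps)%:E)%E.
  by apply: le_trans (size_phi0 sizes) _; rewrite lee_fin ler_wpM2r// lerDl ltW.
have Phi0_le : (H1norm L Phi0 <= (c * eps)%:E)%E.
  by apply: le_trans (size_Phi0 sizes) _; rewrite lee_fin ler_wpM2r// lerDr ltW.
have [G1 [G2 [pG pG0 red sG]]] := solution_size L0 Tf_gt0 nu0 e0 c_ge0 b00 b10 b20 k0 bd sz z1 z2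
  Fq (fun rho => cubic_locally_lipschitz q0 rho mu0) (measurable_cubic mu q0) Flip small1 small2 sol phi0_le.
have [G1' [G2' [pG' pG0' red' sG']]] := solution_size L0 Tf_gt0 nu0 e0 c_ge0 b00 b10 b20 k0 bd sz z1 z2
  Fq' (fun rho => power_locally_lipschitz q0 rho g0 p_ge1) (measurable_power gamma p q0)
  Flip' small1 small2 sol' Phi0_le.
(* The phases undo each other and zeta cancels, so the two differences agree pointwise; this settles
   every equality of suprema. *)
have diffE : diff = diff_uU.
  by apply/funext => t; apply/funext => x; rewrite /diff /diff_uU uE UE !cisNK opprD addrACA subrr addr0.
have rE : r * eps = B0 * eps + 4 * (M * eps) by rewrite /r; ring.
rewrite rE in Flip Flip'.
have m0 : 0 <= M * eps by exact: mulr_ge0.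
have K0 : 0 <= k * eps by exact: mulr_ge0.
have mass_diff := difference_mass L0 bd red red' m0 K0 Fq Flip Fq' Flip' sG sG'.
have energy_diff := difference_energy L0 bd red red' m0 K0 Fq Flip Fq' Flip' sG sG'.
have pd t : 0 <= t <= Tf -> primitive_of L (diff t) (fun x => G1 t x - G1' t x) (fun x => G2 t x - G2' t x).
  by move=> tT; exact: primitive_sub (pG t tT) (pG' t tT).
have pd0 : primitive_of L diff0 (fun x => G1 0 x - G1' 0 x) (fun x => G2 0 x - G2' 0 x).
  exact: primitive_sub pG0 pG0'.
have e3 : 0 <= eps ^+ 3 by exact: exprn_ge0.
have mass_le (C t : R) : 0 <= C -> 0 <= t <= Tf ->
    ip L (prim L (fun x => G1 0 x - G1' 0 x)) (prim L (fun x => G1 0 x - G1' 0 x)) +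
    ip L (prim L (fun x => G2 0 x - G2' 0 x)) (prim L (fun x => G2 0 x - G2' 0 x)) <= (C * eps ^+ 3) ^+ 2 ->
    ip L (prim L (fun x => G1 t x - G1' t x)) (prim L (fun x => G1 t x - G1' t x)) +
    ip L (prim L (fun x => G2 t x - G2' t x)) (prim L (fun x => G2 t x - G2' t x)) <=
    2 * ((C + al) * eps ^+ 3) ^+ 2.
  move=> C_ge0 tT init; apply: le_trans (mass_diff t _ tT (mulr_ge0 C_ge0 e3) init) _.
  exact: difference_mass_scale.
have energy_le (C t : R) : 0 <= C -> 0 <= t <= Tf ->
    ip L (fun x => G1 0 x - G1' 0 x) (fun x => G1 0 x - G1' 0 x) +
    ip L (fun x => G2 0 x - G2' 0 x) (fun x => G2 0 x - G2' 0 x) <= (C * eps ^+ 3) ^+ 2 ->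
    ip L (fun x => G1 t x - G1' t x) (fun x => G1 t x - G1' t x) +
    ip L (fun x => G2 t x - G2' t x) (fun x => G2 t x - G2' t x) <=
    2 * ((C + be) * eps ^+ 3) ^+ 2.
  move=> C_ge0 tT init; apply: le_trans (energy_diff t _ tT (mulr_ge0 C_ge0 e3) init) _.
  exact: difference_energy_scale.
split.
  move=> C C_gt0 init; split; first by rewrite diffE.
  apply: ge_ereal_sup => _ [t tT <-]; rewrite /= in_itv/= in tT.
  rewrite (primitive_L2norm (pd t tT)) lee_fin -mulrA.
  apply: sqrt_double; first by rewrite mulr_ge0// addr_ge0// ltW.
  apply: (mass_le C t (ltW C_gt0) tT).
  apply: sqrt_le_sqr; first by rewrite addr_ge0 ?ip_ge0.
  by have := init; rewrite (primitive_L2norm pd0) lee_fin.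
move=> C C_gt0 init; have C_ge0 := ltW C_gt0.
have init2 : h1sq L (fun x => G1 0 x - G1' 0 x) + h1sq L (fun x => G2 0 x - G2' 0 x) <= (C * eps ^+ 3) ^+ 2.
  apply: sqrt_le_sqr; first by rewrite addr_ge0 ?h1sq_ge0.
  by have := init; rewrite (primitive_H1norm L0 pd0) lee_fin.
(* Its square is twice 2 ((C + al + be) eps^3)^2, a bound for the mass and for the energy of the
   difference. *)
pose m := 2 * (C + al + be) * eps ^+ 3.
have m_ge0 : 0 <= m by apply: mulr_ge0 => //; apply: mulr_ge0 => //; apply: addr_ge0 => //; exact: addr_ge0.
have h1_le (t : R) : 0 <= t <= Tf ->
    h1sq L (fun x => G1 t x - G1' t x) + h1sq L (fun x => G2 t x - G2' t x) <= m ^+ 2.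
  move=> tT; rewrite /h1sq addrACA.
  have i1 : ip L (fun x => G1 0 x - G1' 0 x) (fun x => G1 0 x - G1' 0 x) +
      ip L (fun x => G2 0 x - G2' 0 x) (fun x => G2 0 x - G2' 0 x) <= (C * eps ^+ 3) ^+ 2.
    by apply: le_trans init2; apply: lerD; rewrite lerDl ip_ge0.
  have i2 : ip L (prim L (fun x => G1 0 x - G1' 0 x)) (prim L (fun x => G1 0 x - G1' 0 x)) +
      ip L (prim L (fun x => G2 0 x - G2' 0 x)) (prim L (fun x => G2 0 x - G2' 0 x)) <= (C * eps ^+ 3) ^+ 2.
    by apply: le_trans init2; apply: lerD; rewrite lerDr ip_ge0.
  apply: le_trans (lerD (energy_le C t C_ge0 tT i1) (mass_le C t C_ge0 tT i2)) _.
  have mono (x : R) : 0 <= x -> x <= C + al + be -> (x * eps ^+ 3) ^+ 2 <= ((C + al + be) * eps ^+ 3) ^+ 2.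
    move=> x0 xle; rewrite lerXn2r ?nnegrE ?mulr_ge0 ?(le_trans x0 xle)//.
    by rewrite ler_wpM2r.
  have n1 := mono (C + be) (addr_ge0 C_ge0 be0).
  have n2 := mono (C + al) (addr_ge0 C_ge0 al0).
  have -> : m ^+ 2 = 2 * ((C + al + be) * eps ^+ 3) ^+ 2 + 2 * ((C + al + be) * eps ^+ 3) ^+ 2.
    by rewrite /m; ring.
  apply: lerD; rewrite ler_pM2l//; [apply: n1|apply: n2]; last by rewrite lerDl.
  by rewrite lerD2r lerDl.
split; split; [by rewrite diffE| |by rewrite diffE|].
  apply: ge_ereal_sup => _ [t tT <-]; rewrite /= in_itv/= in tT.
  by rewrite (primitive_H1norm L0 (pd t tT)) lee_fin; apply: sqr_le_of_le => //; exact: h1_le.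
apply: ge_ereal_sup => _ [t tT <-]; rewrite /= in_itv/= in tT.
have [_ s1 s2 _ _] := pd t tT; have := h1_le t tT => hm.
apply: (primitive_Linfnorm (pd t tT)).
  by rewrite -mulrA; apply: mulr_ge0.
move=> x /andP[_ xL].
have h1 : h1sq L (fun x => G1 t x - G1' t x) <= m ^+ 2 by apply: le_trans hm; rewrite lerDl h1sq_ge0.
have h2 : h1sq L (fun x => G2 t x - G2' t x) <= m ^+ 2 by apply: le_trans hm; rewrite lerDr h1sq_ge0.
apply: le_trans (lerD (prim_le_h1 m_ge0 s1 h1 xL) (prim_le_h1 m_ge0 s2 h2 xL)) _.
by rewrite le_eqVlt; apply/orP; left; apply/eqP; rewrite /m; ring.
Qed.
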